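(* For all $d\in\mathbb N$, $C>0$ and $p\in\mathbb N_0$ there exists an $N\in\mathbb N$ such that for all $n\ge N$ and all bounded Borel sets $B\subseteq\mathbb R^d$ with $\lambda_d(B)>0$, $\lambda_d(\partial B)=0$ and $\frac{\lambda_d(\mathrm{conv}(B))}{\lambda_d(B)}\le C$, there exists an averaging set $x_1,\dots,x_n$ of $B$ of degree $p$ and size $n$, where $x_1,\dots,x_n\in B$ and $x_1,\dots,x_n$ are pairwise different.
   Context: $\lambda_d$ is Lebesgue measure on $\mathbb R^d$, $\partial B$ the boundary and $\mathrm{conv}(B)$ the convex hull of $B$. Points $x_1,\dots,x_n\in\mathbb R^d$ form an averaging set of $B$ of degree (order) $p$ and size $n$ if $$\frac{1}{\lambda_d(B)}\int_B x^{\otimes q}\,dx=\frac1n\sum_{k=1}^n x_k^{\otimes q},\qquad q\in\{0,\dots,p\},$$ i.e. if $\frac1{\lambda_d(B)}\int_B P(x)\,dx=\frac1n\sum_{k=1}^nP(x_k)$ for all polynomials $P$ on $\mathbb R^d$ of degree at most $p$. *)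

(* Defs.v *)
From HB Require Import structures.
From mathcomp Require Import all_boot all_order all_algebra.
From mathcomp Require Import all_classical all_reals all_analysis.

Set Implicit Arguments.
Unset Strict Implicit.
Unset Printing Implicit Defensive.

Import Order.TTheory GRing.Theory Num.Theory.
Import numFieldNormedType.Exports.

Local Open Scope classical_set_scope.
Local Open Scope ring_scope.

(* R^d is the space of row vectors 'rV[R]_d. *)
Notation rVborel R d := (g_sigma_algebraType (@open 'rV[R]_d)).

Section borel_rV.
Context (R : realType) (disp : measure_display) (T : measurableType disp).

Lemma open_rV_rat_boxes (d : nat) (A : set 'rV[R]_d) : open A ->
  A = \bigcup_(cq : 'rV[rat]_d * rat)
    (if `[< 0 < ratr cq.2 :> R /\ ball (map_mx (@ratr R) cq.1) (ratr cq.2) `<=` A >]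
     then \bigcap_(j in [set: 'I_d])
       [set y | ball (ratr (cq.1 ord0 j) : R) (ratr cq.2) (y ord0 j)]
     else set0).
Proof.
move=> oA; apply/seteqP; split=> [x Ax|x [[c q] _ /=]]; last first.
  case: ifPn => // /asboolP[q0 cqA] xj; apply: cqA.
  by split=> // i j; rewrite mxE ord1; exact: xj.
move: oA; rewrite openE => /(_ _ Ax); rewrite /interior => /nbhs_ballP[e/= e0 eA].
have [q] := @rat_in_itvoo R 0 (e / 2) (divr_gt0 e0 (ltr0Sn R 1)).
rewrite in_itv/= => /andP[q0 qe].
have /choice[c cP] : forall j, exists r : rat, ball (x ord0 j) (ratr q : R) (ratr r).
  move=> j; have xjq : x ord0 j < x ord0 j + ratr q by rewrite ltrDl.
  have [r] := rat_in_itvoo xjq; rewrite in_itv/= => /andP[xr rx]; exists r; rewrite /ball/= ltr_distlC.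
  by rewrite rx andbT (lt_trans _ xr)// gtrBl.
exists (\row_j c j, q) => //=; rewrite ifT.
  by move=> j _ /=; rewrite mxE; apply: ball_sym; exact: cP.
apply/asboolP; split=> // y [_ yc]; apply: eA; split=> // i j.
rewrite (ord1 i) [e]splitr; apply: (ball_triangle (y := ratr (c j) : R)).
  by apply: le_ball (cP j); exact: ltW.
by have := yc ord0 j; rewrite !mxE; apply: le_ball; exact: ltW.
Qed.

Lemma measurable_fun_rVP (d : nat) (f : T -> rVborel R d) :
  (forall j, measurable_fun [set: T] (fun t => (f t : 'rV[R]_d) ord0 j)) ->
  measurable_fun [set: T] f.
Proof.
move=> mf; apply: (@measurability _ _ T (rVborel R d) setT f open) => //.
move=> _ [A oA <-]; rewrite setTI (open_rV_rat_boxes oA) preimage_bigcup.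
apply: countable_bigcupT_measurable => // -[c q] /=.
case: ifPn => _; last by rewrite preimage_set0.
rewrite preimage_bigcap.
apply: fin_bigcap_measurable => [|j _]; first exact: finite_finset.
rewrite -[X in measurable X]setTI; apply: (mf j) => //.
by apply: measurable_realfun.open_measurable; exact: ball_open.
Qed.

End borel_rV.

Lemma sigma_finite_measure_ex (R : realType) (disp : measure_display)
    (T : measurableType disp) (nu : set T -> \bar R) :
  nu set0 = 0%E -> (forall A, (0 <= nu A)%E) -> semi_sigma_additive nu ->
  sigma_finite setT nu ->
  exists m : {sigma_finite_measure set T -> \bar R}, m = nu :> (set T -> \bar R).
Proof.
move=> nu0 nu_ge0 nus nusf.
pose mnu : {measure set T -> \bar R} :=
  HB.pack nu (isMeasure.Build _ _ _ nu nu0 nu_ge0 nus).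
pose b := isSigmaFinite.Build _ _ _ (mnu : set T -> \bar R) nusf.
pose c := isSFinite.Build _ _ _ (mnu : set T -> \bar R)
  (sfinite_measure_sigma_finite (mu := mnu) nusf).
pose snu : {sigma_finite_measure set T -> \bar R} :=
  HB.pack_for {sigma_finite_measure set T -> \bar R} (Measure.sort mnu) b c.
by exists snu.
Qed.

Section lebesgue_rV.
Context (R : realType).
Local Open Scope ereal_scope.

Definition rV_cons (d : nat) (z : measurableTypeR R * rVborel R d)
  : rVborel R d.+1 := row_mx (const_mx z.1 : 'rV[R]_1) (z.2 : 'rV[R]_d).

(* Lebesgue measure on the Borel sets of R^d, as the d-fold product of the
   Lebesgue measure of R. *)
Fixpoint lebesgue_rV (d : nat) : set (rVborel R d) -> \bar R :=
  match d with
  | 0 => @dirac _ (rVborel R 0) (0%R : 'rV[R]_0) R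
  | d'.+1 => pushforward (@lebesgue_measure R \x @lebesgue_rV d') (@rV_cons d')
  end.

Lemma measurable_coord_rV (d : nat) (j : 'I_d) :
  measurable_fun [set: rVborel R d] (fun v : rVborel R d => (v : 'rV[R]_d) ord0 j).
Proof.
apply: (measurability _ (measurable_realfun.RGenOpens.measurableE R)) => _ [_ [a [b ->] <-]].
rewrite setTI; apply: sub_sigma_algebra.
by apply: open_comp => [v _|]; [exact: coord_continuous|exact: interval_open].
Qed.

Lemma rV_cons0 (d : nat) (z : measurableTypeR R * rVborel R d) :
  (rV_cons z : 'rV[R]_d.+1) ord0 ord0 = z.1.
Proof.
have -> : ord0 = lshift d ord0 :> 'I_(1 + d) by exact/val_inj.
exact: etrans (@row_mxEl _ 1 1 d _ _ _ _) (mxE _ _ _ _).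
Qed.

Lemma rV_consS (d : nat) (z : measurableTypeR R * rVborel R d) (j : 'I_d) :
  (rV_cons z : 'rV[R]_d.+1) ord0 (lift ord0 j) = (z.2 : 'rV[R]_d) ord0 j.
Proof.
have -> : lift ord0 j = rshift 1 j :> 'I_(1 + d) by exact/val_inj.
exact: (@row_mxEr _ 1 1 d).
Qed.

Lemma measurable_rV_cons (d : nat) : measurable_fun [set: measurableTypeR R * rVborel R d] (@rV_cons d).
Proof.
apply: measurable_fun_rVP => j; case: (unliftP ord0 j) => [k ->|->].
  rewrite (_ : (fun _ => _) = (fun v : rVborel R d => (v : 'rV[R]_d) ord0 k) \o snd).
    by apply: measurableT_comp => //; exact: measurable_coord_rV.
  by apply/funext => z; exact: rV_consS.
by rewrite (_ : (fun _ => _) = fst) //; apply/funext => z; exact: rV_cons0.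
Qed.

Lemma measurable_rV_setX (d : nat) (A : 'I_d -> set (measurableTypeR R)) :
  (forall j, measurable (A j)) ->
  measurable ([set v : 'rV[R]_d | forall j, A j (v ord0 j)] : set (rVborel R d)).
Proof.
move=> mA; rewrite (_ : mkset _ = \bigcap_(j in [set: 'I_d])
    ((fun v : rVborel R d => (v : 'rV[R]_d) ord0 j) @^-1` A j)).
  apply: fin_bigcap_measurable => [|j _]; first exact: finite_finset.
  by rewrite -[X in measurable X]setTI; apply: (measurable_coord_rV j) => //; exact: mA.
by apply/seteqP; split=> v /= h; [move=> j _|move=> j]; exact: h.
Qed.

Let lebesgue_rV_ex (d : nat) :
  exists2 m : {sigma_finite_measure set (rVborel R d) -> \bar R},
    m = @lebesgue_rV d :> (set _ -> _) &
    forall A : 'I_d -> set (measurableTypeR R), (forall j, measurable (A j)) ->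
      lebesgue_rV [set v : 'rV[R]_d | forall j, A j (v ord0 j)] =
      \prod_(j < d) lebesgue_measure (A j).
Proof.
elim: d => [|d [m mE mX]].
  exists (@dirac _ (rVborel R 0) (0%R : 'rV[R]_0) R) => // A _.
  by rewrite big_ord0 /= diracE mem_set// => -[].
have mc := @measurable_rV_cons d.
pose nu := pushforward (@lebesgue_measure R \x m) (@rV_cons d).
have nu0 : nu set0 = 0 by exact: measure0.
have nu_ge0 A : 0 <= nu A by exact: measure_ge0.
have nus : semi_sigma_additive nu by exact: measure_semi_sigma_additive.
have nuX (A : 'I_d.+1 -> set (measurableTypeR R)) : (forall j, measurable (A j)) ->
    nu [set v : 'rV[R]_d.+1 | forall j, A j (v ord0 j)] =
    \prod_(j < d.+1) lebesgue_measure (A j).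
  move=> mA; rewrite big_ord_recl -(mX (fun j => A (lift ord0 j)))// -mE.
  have mB := measurable_rV_setX (fun j => mA (lift ord0 j)).
  rewrite -(product_measure1E _ _ (mA ord0) mB).
  rewrite /nu /pushforward; congr (_ _); apply/seteqP; split=> -[x v] /=.
    move=> h; split=> [|j]; first by have := h ord0; rewrite rV_cons0.
    by have := h (lift ord0 j); rewrite rV_consS.
  move=> [h0 h] j; case: (unliftP ord0 j) => [k ->|->].
    by rewrite rV_consS; exact: h.
  by rewrite rV_cons0.
have nusf : sigma_finite setT nu.
  exists (fun k : nat => [set v : 'rV[R]_d.+1 |
      forall j, `[(- k%:R)%R, k%:R : R]%classic (v ord0 j)]).
    apply/esym; rewrite -subTset => v _.
    exists (Num.bound `|v|) => //= j; rewrite in_itv/= -ler_norml.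
    rewrite (le_trans _ (ltW (archi_boundP _)))//.
    rewrite [leRHS]mx_normrE.
    exact: (le_bigmax _ (fun ij => `|v ij.1 ij.2|%R) (ord0, j)).
  move=> k; have mI (j : 'I_d.+1) : measurable
      (`[(- k%:R)%R, k%:R]%classic : set (measurableTypeR R)) by exact: measurable_itv.
  split; first exact: (measurable_rV_setX mI).
  rewrite (nuX _ mI).
  rewrite -ge0_fin_numE ?prode_ge0//; apply: prode_fin_num => j _.
  by rewrite /= lebesgue_measure_itv/=; case: ifP.
have nuE : @lebesgue_rV d.+1 = nu by rewrite /nu mE.
rewrite {}nuE; have [snu snuE] := sigma_finite_measure_ex nu0 nu_ge0 nus nusf.
by exists snu.
Qed.

Section lebesgue_rV_instances.
Variable d : nat.

Let lebesgue0 : @lebesgue_rV d set0 = 0.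
Proof. by have [m <- _] := lebesgue_rV_ex d; exact: measure0. Qed.

Let lebesgue_ge0 A : 0 <= @lebesgue_rV d A.
Proof. by have [m <- _] := lebesgue_rV_ex d; exact: measure_ge0. Qed.

Let lebesgue_sigma_additive : semi_sigma_additive (@lebesgue_rV d).
Proof.
by have [m <- _] := lebesgue_rV_ex d; exact: measure_semi_sigma_additive.
Qed.

HB.instance Definition _ := isMeasure.Build _ _ _ (@lebesgue_rV d)
  lebesgue0 lebesgue_ge0 lebesgue_sigma_additive.

Let lebesgue_sigma_finite : sigma_finite setT (@lebesgue_rV d).
Proof. by have [m <- _] := lebesgue_rV_ex d; exact: sigma_finiteT. Qed.

HB.instance Definition _ := Measure_isSigmaFinite.Build _ _ _ (@lebesgue_rV d)
  lebesgue_sigma_finite.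

End lebesgue_rV_instances.

Lemma lebesgue_rV_setX (d : nat) (A : 'I_d -> set (measurableTypeR R)) :
  (forall j, measurable (A j)) ->
  lebesgue_rV [set v : 'rV[R]_d | forall j, A j (v ord0 j)] =
  \prod_(j < d) lebesgue_measure (A j).
Proof. by have [m _] := lebesgue_rV_ex d; exact. Qed.

End lebesgue_rV.
Arguments lebesgue_rV : clear implicits.

(* The convex hull of a Borel set need not be Borel, but it is Lebesgue
   measurable, so its volume is taken in the completion. *)
Definition completed_lebesgue_rV (R : realType) (d : nat) :=
  @completed_measure_extension _ _ R (lebesgue_rV R d).
Arguments completed_lebesgue_rV : clear implicits.

Lemma completed_lebesgue_rVE (R : realType) (d : nat) (A : set (rVborel R d)) :
  measurable A -> completed_lebesgue_rV R d A = lebesgue_rV R d A.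
Proof. exact: measurable_mu_extE. Qed.

Definition boundary (T : topologicalType) (A : set T) : set T :=
  closure A `\` interior A.

Definition conv_hull (R : realType) (d : nat) (A : set 'rV[R]_d) : set 'rV[R]_d :=
  smallest (@convex_set R 'rV[R]_d) A.

(* A tensor of order q over R^d is given by its d^q coordinates in the
   canonical basis; those of the tensor power of x are x_(i_1) * ... * x_(i_q). *)
Definition tensor (R : realType) (d q : nat) := {ffun {ffun 'I_q -> 'I_d} -> R}.

Definition tensor_pow (R : realType) (d q : nat) (x : 'rV[R]_d) : tensor R d q :=
  [ffun i : {ffun 'I_q -> 'I_d} => \prod_(k < q) x ord0 (i k)].

Definition tensor_moment (R : realType) (d q : nat) (B : set 'rV[R]_d) : tensor R d q :=
  [ffun i => \int[lebesgue_rV R d]_(x in B) tensor_pow q x i].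

(* Meaningful for bounded Borel B of positive measure. *)
Definition averaging_set (R : realType) (d p n : nat) (B : set 'rV[R]_d)
    (x : 'I_n -> 'rV[R]_d) :=
  forall q : nat, (q <= p)%N ->
    (fine (lebesgue_rV R d B))^-1 *: (tensor_moment q B : tensor R d q) =
    n%:R^-1 *: \sum_(k < n) tensor_pow q (x k).

(* Main.v *)
(** Let x_0, ..., x_d in B span a simplex of almost maximal volume. In the affine
coordinates of this simplex B lies in [-2, 2]^d (Cramer's rule), and since the simplex
lies in conv(B), B fills a proportion of [-3, 3]^d bounded below in terms of d and C.
It remains to find x_k with sum_k phi(x_k) = n m, where phi is the vector of the
monomials with exponents at most p + 1 and m its mean over B.

Greedy step: as phi - m has mean 0 over B, for every vector v some point x of B satisfies
<v, phi(x) - m> <= - eta |v| with eta > 0 depending only on d, p and C (a polynomial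
cannot be small on a large part of B). Choosing the points one after the other keeps
the sum of phi(x_k) - m within a fixed radius R0 of any prescribed target.

Absorption: by Fubini some translate of the moment curve t -> (t^(M^i))_i, M = p + 2, meets B in
a set of parameters of measure bounded below. For a fixed number k of points of this set the
vectors of power sums already fill a box of radius R0. Indeed sums of a few points
reach a positive proportion of the small cells modulo a lattice; doubling in the finite
group (Z/L)^q, L prime, yields all residues; the remaining lattice vector is corrected by
exchanging two points of the curve which differ by a lattice generator.

Distinctness: q points on a moment curve in the interior of B are reserved, the other
points are perturbed to become distinct, and the error is corrected by moving the
reserved points, near which the sum of phi is an open map on the curve. *)

Require Import Defs.
From HB Require Import structures.
From mathcomp Require Import all_boot all_order all_algebra all_fingroup.
From mathcomp Require Import all_classical all_reals all_analysis.
From mathcomp Require Import ring lra zify.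
From mathcomp Require polyrcf.
From mathcomp Require Import measurable_realfun.

Set Implicit Arguments.
Unset Strict Implicit.
Unset Printing Implicit Defensive.

Import Order.TTheory GRing.Theory Num.Theory.
Import numFieldNormedType.Exports.

Local Open Scope classical_set_scope.
Local Open Scope ring_scope.

(** * Doubling in finite groups *)

Section doubling.
Local Open Scope nat_scope.
Variable G : finZmodType.
Implicit Types E H : {set G}.

(** The obstacle is uniformity: [N] sees only [d], [p] and [C], while the interior of [B] may
    consist of arbitrarily small pieces. An open map near given points of [B] therefore reaches only
    a tiny box: enough for the last correction, whose size is free, but not for absorbing an error
    of size [R0]. What survives uniformly is measure: the density of [B] in a cube, then the measure
    of a set of parameters. In the absorption the prime modulus ([M] in [curve_sum_cells]) depends
    on the parameter set, but the proportion of cells reached does not, so neither does the number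
    of doublings. Primality leaves no proper subgroup of bounded index.

    The constants are not circular: [R0] comes first, from the greedy step alone; the number k of
    absorbing points depends on [R0]; the initial error, proportional to k + q, influences only the
    number of greedy points.

    Volumes are compared without a determinant formula: the normalised measure is used through its
    invariance under translations, and the cube is covered by translates of a cell inside the
    simplex. *)

Definition sumset2 E : {set G} := [set (x + y)%R | x in E, y in E].

Lemma sumset2_seq (A : {set G}) j x : x \in iter j sumset2 A ->
  exists s : seq G, [/\ size s = 2 ^ j, {subset s <= A} & (\sum_(a <- s) a = x)%R].
Proof.
elim: j x => [|j IH] x /=.
  by move=> xA; exists [:: x]; split=> //; [move=> y; rewrite inE => /eqP->|rewrite big_seq1].
case/imset2P => y z /IH[s [ss sA <-]] /IH[t [ts tA <-]] ->.
exists (s ++ t); split; first by rewrite size_cat ss ts addnn -muln2 expnSr.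
  by move=> a; rewrite mem_cat => /orP[/sA|/tA].
by rewrite big_cat.
Qed.

Let shift E v : {set G} := [set (x + v)%R | x in E].

Let card_shift E v : #|shift E v| = #|E|.
Proof. by rewrite card_imset// => x y /GRing.addIr. Qed.

Let shift_sub E v : v \in E -> shift E v \subset sumset2 E.
Proof. by move=> vE; apply/fintype.subsetP => _ /imsetP[x xE ->]; exact: imset2_f. Qed.

Let diff E : {set G} := [set (x - y)%R | x in E, y in E].

(** For x = a - b, the translates E + a and E + b both lie in E + E, which has fewer than 4/3 |E|
    elements, so they share more than 2/3 |E|. Translating by -b turns this into the overlap of E
    with E + x. *)
Let overlap E x : 3 * #|sumset2 E| < 4 * #|E| -> x \in diff E ->
  2 * #|E| < 3 * #|E :&: shift E x|.
Proof.
move=> h /imset2P[a b aE bE ->].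
have -> : #|E :&: shift E (a - b)| = #|shift E b :&: shift E a|.
  rewrite -(card_shift (E :&: _) b); apply: eq_card => z; rewrite inE.
  apply/imsetP/andP => [[y /setIP[yE /imsetP[w wE yw]] ->]|[/imsetP[y yE zy] /imsetP[w wE zw]]].
    split; first by apply/imsetP; exists y.
    by apply/imsetP; exists w => //; rewrite yw -addrA subrK.
  exists y => //; rewrite inE yE; apply/imsetP; exists w => //.
  by apply: (@GRing.addIr _ b); rewrite -zy zw -addrA subrK.
have := cardsUI (shift E b) (shift E a); rewrite !card_shift.
have : #|shift E b :|: shift E a| <= #|sumset2 E|.
  by apply: subset_leq_card; rewrite finset.subUset !shift_sub.
lia.
Qed.

(** E + x and E - y each cover more than two thirds of E, so some z in E lies in both; with a = z -
    x and b = z + y in E, x + y = b - a. *)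
Let diff_closed E : 3 * #|sumset2 E| < 4 * #|E| ->
  {in diff E &, forall x y, (x + y)%R \in diff E}.
Proof.
move=> h x y xd yd.
have hx := overlap h xd; have hy := overlap h yd.
have sub : #|(E :&: shift E x) :&: shift (E :&: shift E (- y)) 0| > 0.
  have yd' : (- y)%R \in diff E.
    by case/imset2P: yd => a b aE bE ->; rewrite opprB; exact: imset2_f.
  have := overlap h yd'.
  have -> : shift (E :&: shift E (- y)) 0 = E :&: shift E (- y).
    by apply/setP => z; apply/imsetP/idP => [[w wE ->]|zE]; [rewrite addr0|exists z; rewrite ?addr0].
  have := cardsUI (E :&: shift E x) (E :&: shift E (- y)).
  have : #|(E :&: shift E x) :|: (E :&: shift E (- y))| <= #|E|.
    by apply: subset_leq_card; rewrite finset.subUset !finset.subsetIl.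
  lia.
case/card_gt0P: sub => z; rewrite !inE => /andP[/andP[zE /imsetP[a aE za]]].
case/imsetP => w; rewrite inE => /andP[wE /imsetP[b bE wb]]; rewrite addr0 => zw.
have -> : (x + y = b - a)%R.
  have -> : (x = z - a)%R by rewrite za addrC addKr.
  have -> : (b = z + y)%R by rewrite zw wb subrK.
  by rewrite addrAC.
exact: imset2_f.
Qed.

(* If E grows by a factor less than 4/3, then E - E is a subgroup, hence everything,
   and E meets each of its translates in more than two thirds of E; averaging over the
   translates, E has more than half of the elements. *)
Lemma iter_sumset2_setT (A : {set G}) D J :
  (forall H : {set G}, {in H &, forall x y, (x + y)%R \in H} ->
     0 < #|H| -> #|G| <= D * #|H| -> H = [set: G]%SET) ->
  0 < #|A| -> #|G| <= D * #|A| -> 3 ^ J * D < 4 ^ J ->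
  iter J.+1 sumset2 A = [set: G]%SET.
Proof.
move=> hH A0 DA hJ.
have stepT E : E = [set: G]%SET -> sumset2 E = [set: G]%SET.
  move=> ->; apply/setP => x; rewrite finset.in_setT; apply/imset2P.
  by exists x 0%R; rewrite ?finset.in_setT ?addr0.
have mono E : #|E| <= #|sumset2 E|.
  have [->|] := finset.set_0Vmem E; first by rewrite cards0.
  by case=> x xE; rewrite -(card_shift E x) subset_leq_card// shift_sub.
have cE i : #|A| <= #|iter i sumset2 A|.
  by elim: i => //= i IH; apply: leq_trans IH (mono _).
(* Either i + 1 doublings fill the group, or the first i have together gained a factor (4/3)^i,
   which the choice of [J] excludes for i = [J]. *)
have alt i : (iter i.+1 sumset2 A = [set: G]%SET) \/ 4 ^ i * #|A| <= 3 ^ i * #|iter i sumset2 A|.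
  elim: i => [|i [IH|IH]]; first by right.
    by left; rewrite iterS; exact: stepT.
  set E := iter i sumset2 A in IH *.
  case: (ltnP (3 * #|sumset2 E|) (4 * #|E|)) => h; last first.
    by right; rewrite iterS -/E !expnSr; nia.
  left; rewrite iterS; apply: stepT; rewrite iterS -/E.
  have ne : 0 < #|E| by apply: leq_trans A0 (cE i).
  have dT : diff E = [set: G]%SET.
    have Ed : #|E| <= #|diff E|.
      case/card_gt0P: ne => e eE; rewrite -(card_shift E (- e)).
      by apply: subset_leq_card; apply/fintype.subsetP => _ /imsetP[x xE ->]; exact: imset2_f.
    apply: hH; first exact: diff_closed.
      exact: leq_trans ne Ed.
    apply: leq_trans DA _; rewrite leq_mul2l; apply/orP; right.
    exact: leq_trans (cE i) Ed.
  (* Pairs of elements of E are counted by their difference. By [dT] every x is a difference, so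
     [overlap] applies to all translates and forces |E| > 2/3 |G|. *)
  have sum2 : \sum_(x : G) #|E :&: shift E x| = #|E| * #|E|.
    under eq_bigr do rewrite -sum1_card.
    rewrite (exchange_big_dep (mem E)) /=; last by move=> x z _ /setIP[].
    rewrite -sum_nat_const; apply: eq_bigr => z zE; rewrite sum1_card.
    rewrite -(card_imset (mem E) (f := fun w => (z - w)%R)); last first.
      by move=> a b /GRing.addrI /oppr_inj.
    apply: eq_card => x; apply/idP/imsetP => [/setIP[_ /imsetP[w wE h']]|[w wE h']].
      by exists w => //; rewrite h' addrC addKr.
    by apply/setIP; split=> //; apply/imsetP; exists w => //; rewrite h' addrC subrK.
  have big : 2 * #|G| < 3 * #|E|.
    have : \sum_(x : G) (2 * #|E|).+1 <= \sum_(x : G) 3 * #|E :&: shift E x|.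
      by apply: leq_sum => x _; apply: overlap => //; rewrite dT finset.in_setT.
    rewrite -big_distrr/= sum2 sum_nat_const.
    have : 0 < #|G| by apply: leq_trans ne (max_card _).
    move: #|E| #|G| => e g g0 h1; rewrite ltnNge; apply/negP => h2.
    have : 3 * e * e <= 2 * g * e by rewrite leq_mul2r h2 orbT.
    nia.
  apply/setP => x; rewrite finset.in_setT; apply/idP.
  (* E and x - E both have more than half of the elements, hence meet. *)
  have : 0 < #|E :&: [set (x - y)%R | y in E]%SET|.
    have cX : #|[set (x - y)%R | y in E]%SET| = #|E|.
      by rewrite card_imset// => a b /GRing.addrI /oppr_inj.
    have := cardsUI E [set (x - y)%R | y in E]%SET; rewrite cX.
    have : #|E :|: [set (x - y)%R | y in E]%SET| <= #|G| by exact: max_card.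
    move: big; lia.
  case/card_gt0P => z /setIP[zE /imsetP[y yE zy]].
  by apply/imset2P; exists z y => //; rewrite zy subrK.
case: (alt J) => [//|h].
have hm : #|iter J sumset2 A| <= #|G| by exact: max_card.
have : 4 ^ J * #|A| <= 3 ^ J * (D * #|A|).
  by apply: leq_trans h _; rewrite leq_mul2l (leq_trans hm DA) orbT.
by rewrite mulnA leq_pmul2r// leqNgt hJ.
Qed.

End doubling.

(** Since p x = 0, a nonempty set closed under addition contains 0 and is a subgroup. Its index is a
    power of p and at most D < p, hence 1. *)
Lemma closed_rV_Fp_setT (p q D : nat) (H : {set 'rV['F_p]_q}) : prime p -> (D < p)%N ->
  {in H &, forall x y, x + y \in H} -> (0 < #|H|)%N ->
  (#|{: 'rV['F_p]_q}| <= D * #|H|)%N -> H = [set: 'rV['F_p]_q]%SET.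
Proof.
move=> pp Dp cl H0 hc.
have H00 : 0 \in H.
  case/card_gt0P: H0 => x xH.
  have : forall n, x *+ n.+1 \in H.
    by elim=> // n IH; rewrite mulrS; apply: cl.
  move/(_ p.-1); rewrite prednK ?prime_gt0//.
  suff -> : x *+ p = 0 by [].
  by apply/rowP => j; rewrite mulmxnE mxE -mulr_natr pchar_Fp_0 ?mulr0.
pose K := @Group _ H (introT (@group_setP _ H) (conj H00 cl)).
have /= dv := cardSg (finset.subsetT K).
have cG : #|[set: 'rV['F_p]_q]%SET| = (p ^ q)%N.
  by rewrite finset.cardsT card_mx card_Fp// mul1n.
rewrite cG in dv.
have [k kq Hk] : exists2 k, (k <= q)%N & #|H| = (p ^ k)%N by apply/dvdn_pfactor.
apply/eqP; rewrite finset.eqEcard finset.subsetT cG Hk /= leq_exp2l ?prime_gt1//.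
rewrite leqNgt; apply/negP => ltkq; move: hc.
rewrite -finset.cardsT cG Hk -(subnK ltkq) expnD expnS => hc'.
have : (0 < p ^ (q - k.+1))%N by rewrite expn_gt0 prime_gt0.
have : (0 < p ^ k)%N by rewrite expn_gt0 prime_gt0.
move: (p ^ _)%N (p ^ _)%N hc' => a b hc' a0 b0.
have : (p * a <= D * a)%N.
  by apply: leq_trans hc'; rewrite -[X in (X <= _)%N]mul1n leq_mul2r b0 orbT.
by rewrite leq_pmul2r// leqNgt Dp.
Qed.

(** * Polynomials in one variable *)

Section poly_bounds.
Variable R : realType.
Implicit Types (P : {poly R}).

Lemma coef_prod_XsubC_le (I : Type) (s : seq I) (D : pred I) (f : I -> R) e :
  (forall i, `|f i| <= 1) ->
  `|(\prod_(i <- s | D i) ('X - (f i)%:P))`_e| <= 2 ^+ size s.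
Proof.
move=> f1; elim: s e => [|i s IH] e.
  by rewrite big_nil coef1 normr_nat; case: e.
rewrite big_cons; case: (D i); last first.
  by apply: le_trans (IH e) _; rewrite /= exprS ler_peMl ?exprn_ge0// ler1n.
rewrite mulrBl coefB coefXM coefCM (le_trans (ler_normB _ _))// normrM.
rewrite /= exprS mulr_natl mulr2n lerD//; last by rewrite -[leRHS]mul1r ler_pM.
by case: e => [|e] /=; rewrite ?normr0 ?exprn_ge0.
Qed.

(* Remez-type inequality, from the Lagrange interpolation formula. *)
Lemma coef_le_sum_separated n (t : 'I_n -> R) (sg : R) P e :
  0 < sg <= 1 -> (forall i, `|t i| <= 1) ->
  (forall i j, i != j -> sg <= `|t i - t j|) -> (size P <= n)%N ->
  `|P`_e| <= (2 / sg) ^+ n * \sum_i `|P.[t i]|.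
Proof.
move=> /andP[sg0 sg1] t1 sep szP.
have tne i j : i != j -> t i - t j != 0.
  by move=> /sep h; rewrite -normr_gt0 (lt_le_trans sg0).
pose V i := \prod_(j | j != i) ('X - (t j)%:P).
pose v i := \prod_(j | j != i) (t i - t j).
pose Q := \sum_i (P.[t i] / v i) *: V i.
have v0 i : v i != 0 by apply/prodf_neq0 => j ji; rewrite tne// eq_sym.
have szV i : size (V i) = n.
  rewrite /V -big_filter size_prod_XsubC /=.
  have -> : size [seq j <- index_enum 'I_n | j != i] = #|[pred j | j != i]|.
    by rewrite cardE.
  by rewrite (cardC1 i) card_ord prednK// (leq_ltn_trans _ (ltn_ord i)).
have Vx i j : (V i).[t j] = (i == j)%:R * v i.
  rewrite /V horner_prod; have [<-|ij] := eqVneq i j.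
    by rewrite mul1r; apply: eq_bigr => k _; rewrite !hornerE.
  by rewrite (bigD1 j) ?[j == i]eq_sym//= !hornerE subrr !mul0r.
have -> : P = Q.
  apply/eqP; rewrite -subr_eq0; apply/eqP.
  apply: (@roots_geq_poly_eq0 _ _ (map t (enum 'I_n))).
  - apply/allP => _ /mapP[j _ ->]; apply/rootP; rewrite hornerD hornerN horner_sum.
    rewrite (bigD1 j)//= big1 ?addr0 => [|i ij]; rewrite hornerZ Vx ?(negPf ij) ?mul0r ?mulr0//.
    by rewrite eqxx mul1r divfK// subrr.
  - rewrite map_inj_uniq ?enum_uniq// => i j /eqP; apply: contraTeq => /tne.
    by rewrite subr_eq0.
  - rewrite size_map size_enum_ord (leq_trans (size_polyD _ _))// size_polyN geq_max szP.
    apply: (leq_trans (size_sum _ _ _)); apply/bigmax_leqP => i _.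
    by rewrite (leq_trans (size_scale_leq _ _))// szV.
have Qx j : Q.[t j] = P.[t j].
  rewrite horner_sum (bigD1 j)//= big1 ?addr0 => [|i ij]; rewrite hornerZ Vx ?(negPf ij) ?mul0r ?mulr0//.
  by rewrite eqxx mul1r divfK.
under [in leRHS]eq_bigr do rewrite Qx.
rewrite coef_sum mulr_sumr (le_trans (ler_norm_sum _ _ _))// ler_sum// => i _.
rewrite coefZ !normrM -mulrA [leRHS]mulrC ler_wpM2l// expr_div_n mulrC ler_pM//.
  by rewrite (le_trans (coef_prod_XsubC_le _ _ _ t1))// /index_enum -enumT size_enum_ord.
rewrite normfV lef_pV2 ?posrE ?normr_gt0 ?exprn_gt0//.
rewrite normr_prod.
have -> : sg ^+ n = sg * \prod_(j | j != i) sg.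
  have -> : sg ^+ n = \prod_(j < n) sg by rewrite prodr_const card_ord.
  by rewrite (bigD1 i).
rewrite -[leRHS]mul1r ler_pM ?(ltW sg0) ?prodr_ge0// => [j _|]; first exact: ltW.
by apply: ler_prod => j ji; rewrite (ltW sg0) sep// eq_sym.
Qed.

Lemma horner_lipschitz P (K x y : R) :
  (forall z, Num.min x y <= z <= Num.max x y -> `|P^`().[z]| <= K) ->
  `|P.[x] - P.[y]| <= K * `|x - y|.
Proof.
wlog xy : x y / x <= y => [wl|].
  have /orP[xy|yx] := le_total x y; first exact: wl.
  move=> h; rewrite distrC [`|x - y|]distrC; apply: wl => // z.
  by rewrite minC maxC; exact: h.
rewrite (min_idPl xy) (max_idPr xy).
have [->|xney] := eqVneq x y; first by rewrite !subrr normr0 mulr0.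
have {xney}xy' : x < y by rewrite lt_neqAle xney.
have [c cxy e] := polyrcf.poly_mvt P xy'.
move=> h; rewrite distrC e normrM [`|x - y|]distrC ler_wpM2r// h//.
by move: cxy; rewrite in_itv/= => /andP[/ltW-> /ltW->].
Qed.

Lemma horner_dist_le P (n : nat) (K x y : R) : (size P <= n)%N -> 0 <= K ->
  (forall e, `|P`_e| <= K) -> `|x| <= 1 -> `|y| <= 1 ->
  `|P.[x] - P.[y]| <= n%:R ^+ 2 * K * `|x - y|.
Proof.
move=> szP K0 hK x1 y1; rewrite (horner_coef_wide _ szP) (horner_coef_wide _ szP).
rewrite -sumrB (le_trans (ler_norm_sum _ _ _))//.
have -> : n%:R ^+ 2 * K * `|x - y| = \sum_(i < n) n%:R * K * `|x - y|.
  by rewrite sumr_const card_ord -[RHS]mulr_natl; ring.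
apply: ler_sum => i _; rewrite -mulrBr normrM [n%:R * K]mulrC -mulrA ler_pM//.
rewrite subrXX normrM [leRHS]mulrC ler_wpM2l// (le_trans (ler_norm_sum _ _ _))//.
apply: (@le_trans _ _ (\sum_(j < i) 1)).
  by apply: ler_sum => j _; rewrite normrM !normrX mulr_ile1// exprn_ile1.
by rewrite sumr_const card_ord ler_nat ltnW.
Qed.

End poly_bounds.

Lemma le_measure_bigsetU_cond d (T : measurableType d) (R : realType)
    (mu : {measure set T -> \bar R}) (I : Type) (s : seq I) (P : pred I) (F : I -> set T) :
  (forall i, measurable (F i)) ->
  measurable (\big[setU/set0]_(i <- s | P i) F i) /\
  (mu (\big[setU/set0]_(i <- s | P i) F i) <= \sum_(i <- s | P i) mu (F i))%E.
Proof.
move=> mF; elim: s => [|i s [mI IH]]; first by rewrite !big_nil measure0.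
rewrite !big_cons; case: (P i) => //; split; first exact: measurableU.
by apply: le_trans; [exact: measureU2|exact: leeD].
Qed.

(** * Measurable subsets of the line *)

Section line.
Variable R : realType.
Let mu := @lebesgue_measure R.
Implicit Types T : set (measurableTypeR R).

(** Greedy choice: the open intervals of radius [sg] around the points already chosen are too short
    in total to cover [T]. *)
Lemma separated_points n (sg : R) T : measurable T -> 0 <= sg ->
  ((n%:R * (2 * sg))%:E < mu T)%E ->
  exists t : 'I_n -> R, (forall i, T (t i)) /\
    (forall i j, i != j -> sg <= `|t i - t j|).
Proof.
move=> mT sg0 h.
suff [s [ss sT sP]] : exists s : seq R, [/\ size s = n, (forall x, x \in s -> T x) &
    pairwise (fun x y => sg <= `|x - y|) s].
  exists (fun i => nth 0 s i); split=> [i|i j ij]; first by apply: sT; rewrite mem_nth ?ss.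
  move/pairwiseP : sP => /(_ 0) sP.
  have [ltij|ltji|/val_inj eij] := ltngtP i j; last by rewrite eij eqxx in ij.
    by apply: sP => //; rewrite inE ss.
  by rewrite distrC; apply: sP => //; rewrite inE ss.
elim: n h => [|n IH] h; first by exists [::].
have [|s [ss sT sP]] := IH.
  by apply: le_lt_trans h; rewrite lee_fin ler_wpM2r ?ler_nat// mulr_ge0.
pose U := \big[setU/set0]_(x <- s) (`]x - sg, x + sg[%classic : set (measurableTypeR R)).
have [mU leU] := @le_measure_bigsetU_cond _ _ _ mu _ s xpredT
  (fun x => `]x - sg, x + sg[%classic : set (measurableTypeR R))
  (fun x => measurable_itv _).
have muU : (mu U <= (n%:R * (2 * sg))%:E)%E.
  apply: le_trans leU _; rewrite -ss; elim: (s) => [|x r IHr].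
    by rewrite big_nil mul0r.
  rewrite big_cons /= -natr1 mulrDl mul1r EFinD addeC leeD//.
  rewrite lebesgue_measure_itv/= lte_fin; case: ifPn => _; last by rewrite lee_fin mulr_ge0.
  by rewrite lee_fin le_eqVlt; apply/orP; left; apply/eqP; ring.
have [x Tx Ux] : exists2 x, T x & ~ U x.
  apply: contrapT => no; have TU : T `<=` U.
    by move=> x Tx; apply: contrapT => Ux; apply: no; exists x.
  have : (mu T <= mu U)%E by apply: le_measure; rewrite ?inE.
  rewrite leNgt => /negP; apply; apply: le_lt_trans muU _; apply: le_lt_trans h.
  by rewrite lee_fin ler_wpM2r ?ler_nat// mulr_ge0.
exists (x :: s); split; first by rewrite /= ss.
  by move=> y; rewrite inE => /orP[/eqP->//|/sT].
rewrite /= sP andbT; apply/allP => y ys; rewrite leNgt; apply/negP => xy.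
apply: Ux; rewrite /U -bigcup_seq; exists y => //=.
by rewrite in_itv/=; move: xy; rewrite ltr_distl.
Qed.

Definition cell (m k : nat) : set (measurableTypeR R) := `[k%:R / m%:R, k.+1%:R / m%:R[%classic.

(** The cells holding less than c / (2 m) of [T] are at most m in number, so discarding them loses
    at most c / 2. *)
Lemma dense_cells m (c : R) T : (0 < m)%N -> measurable T -> T `<=` `[0, 1[ ->
  (c%:E <= mu T)%E -> 0 <= c ->
  exists T', [/\ measurable T', ((c / 2)%:E <= mu T')%E &
    forall x, T' x -> T x /\ exists2 k : 'I_m, cell m k x &
                         ((c / (2 * m%:R))%:E <= mu (T `&` cell m k))%E].
Proof.
move=> m0 mT T01 cT c0.
have mR : 0 < m%:R :> R by rewrite ltr0n.
pose good (k : 'I_m) := ((c / (2 * m%:R))%:E <= mu (T `&` cell m k))%E.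
have mcell k : measurable (cell m k) by exact: measurable_itv.
have mTcell k : measurable (T `&` cell m k) by exact: measurableI.
pose T' := \big[setU/set0]_(k < m | good k) (T `&` cell m k).
pose T'' := \big[setU/set0]_(k < m | ~~ good k) (T `&` cell m k).
have [mT' _] := @le_measure_bigsetU_cond _ _ _ mu _ (index_enum 'I_m) good _ (fun k : 'I_m => mTcell k).
have [mT'' leT''] := @le_measure_bigsetU_cond _ _ _ mu _ (index_enum 'I_m) (fun k => ~~ good k) _ (fun k : 'I_m => mTcell k).
exists T'; split=> //; last first.
  move=> x; rewrite /T' -bigcup_seq_cond => -[k /= /andP[_ gk] [Tx kx]].
  by split=> //; exists k.
have TT : T `<=` T' `|` T''.
  move=> x Tx; have /= := T01 _ Tx; rewrite in_itv/= => /andP[x0 x1].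
  have km : (Num.truncn (x * m%:R) < m)%N.
    rewrite -(ltr_nat R); apply: le_lt_trans (_ : x * m%:R < _).
      by have /andP[] := truncn_itv (mulr_ge0 x0 (ltW mR)).
    by rewrite gtr_pMl.
  pose k := Ordinal km.
  have xk : (T `&` cell m k) x.
    split=> //; rewrite /cell /= in_itv/= ler_pdivrMr// ltr_pdivlMr//.
    exact: truncn_itv (mulr_ge0 x0 (ltW mR)).
  have [gk|bk] := boolP (good k).
    by left; rewrite /T' (bigD1 k)//=; left.
  by right; rewrite /T'' (bigD1 k)//=; left.
have h1 : (mu T <= mu T' + mu T'')%E.
  apply: (@le_trans _ _ (mu (T' `|` T''))); last exact: measureU2.
  by apply: le_measure; rewrite ?inE//; exact: measurableU.
have h2 : (mu T'' <= (c / 2)%:E)%E.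
  apply: le_trans leT'' _; apply: (@le_trans _ _ (\sum_(k < m) (c / (2 * m%:R))%:E)%E).
    rewrite big_mkcond /=; apply: lee_sum => k _; case: ifPn => [|_].
      by rewrite -ltNge => /ltW.
    by rewrite lee_fin divr_ge0// mulr_ge0.
  rewrite sumEFin lee_fin sumr_const card_ord -[leLHS]mulr_natl.
  rewrite le_eqVlt; apply/orP; left; apply/eqP; field; exact: lt0r_neq0.
have : (c%:E <= mu T' + (c / 2)%:E)%E.
  by apply: le_trans cT _; apply: le_trans h1 _; exact: leeD.
rewrite -leeBlDr// -EFinB; apply: le_trans; rewrite lee_fin.
by rewrite le_eqVlt; apply/orP; left; apply/eqP; field.
Qed.

End line.

(** * Short intervals on which a polynomial curve is nearly axis-parallel *)

Section frames.
Variable R : realType.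
Let mu := @lebesgue_measure R.
Implicit Types T : set (measurableTypeR R).

(** The coefficients come from inverting the matrix of the increments of the powers. Were it
    singular, a nonzero polynomial of degree at most q without constant term would agree at both
    ends of each interval, and by Rolle its derivative, of degree below q, would have q distinct
    roots. *)
Lemma dual_polys q (u l : 'I_q -> R) :
  (forall i, 0 < l i) ->
  (forall i j z, i != j -> u i <= z <= u i + l i -> u j <= z <= u j + l j -> False) ->
  exists F : 'I_q -> {poly R}, [/\ forall j, (size (F j) <= q.+1)%N, forall j, (F j)`_0 = 0 &
    forall i j, (F j).[u i + l i] - (F j).[u i] = (i == j)%:R].
Proof.
move=> l0 dis.
pose P (v : 'I_q -> R) : {poly R} := \sum_(e < q) v e *: 'X^(e.+1).
have P0 v : (P v)`_0 = 0.
  by rewrite coef_sum big1// => e _; rewrite coefZ coefXn mulr0.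
have PS v (e : 'I_q) : (P v)`_e.+1 = v e.
  rewrite coef_sum (bigD1 e)//= coefZ coefXn eqxx mulr1 big1 ?addr0// => k ke.
  by rewrite coefZ coefXn eqSS eq_sym val_eqE (negPf ke) mulr0.
have szP v : (size (P v) <= q.+1)%N.
  apply: (leq_trans (size_sum _ _ _)); apply/bigmax_leqP => e _.
  by rewrite (leq_trans (size_scale_leq _ _))// size_polyXn ltnS.
have Px v x : (P v).[x] = \sum_(e < q) v e * x ^+ e.+1.
  by rewrite horner_sum; apply: eq_bigr => e _; rewrite !hornerE.
pose V : 'M[R]_q := \matrix_(i, e) ((u i + l i) ^+ e.+1 - u i ^+ e.+1).
have VU : V \in unitmx.
  rewrite -unitmx_tr unitmxE unitfE; apply/negP => /det0P[v v0 vV].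
  case/negP: v0; apply/eqP/rowP => e; rewrite mxE.
  pose Q := P (fun e => v 0 e).
  have rt i : exists z, u i <= z <= u i + l i /\ root Q^`() z.
    have ui : u i < u i + l i by rewrite ltrDl.
    have [z zi e'] := polyrcf.poly_mvt Q ui; exists z.
    split; first by move: zi; rewrite in_itv/= => /andP[/ltW-> /ltW->].
    have : Q.[u i + l i] - Q.[u i] = 0.
      transitivity ((v *m V^T) 0 i); last by rewrite vV mxE.
      by rewrite !Px -sumrB mxE; apply: eq_bigr => k _; rewrite !mxE mulrBr.
    rewrite e' => /eqP; rewrite mulf_eq0 => /orP[|]; first by [].
    by rewrite addrAC subrr add0r gt_eqF.
  have [z zP] := choice rt.
  have Q0 : Q^`() = 0.
    apply: (@roots_geq_poly_eq0 _ _ (map z (enum 'I_q))).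
    - by apply/allP => _ /mapP[i _ ->]; case: (zP i).
    - rewrite map_inj_uniq ?enum_uniq// => i j zij; apply/eqP; apply: contrapT => /negP ij.
      by apply: (dis i j (z i)) => //; [case: (zP i)|rewrite zij; case: (zP j)].
    - rewrite size_map size_enum_ord; have := lt_size_deriv (p := Q).
      have [->|Qn0 /(_ isT) h] := eqVneq Q 0; first by rewrite deriv0 size_poly0.
      by rewrite -ltnS (leq_trans h)// szP.
  have : Q^`()`_e = 0 by rewrite Q0 coef0.
  by rewrite coef_deriv PS => /eqP; rewrite mulrn_eq0 => /eqP.
exists (fun j => P (fun e => (invmx V) e j)); split=> // i j.
rewrite !Px -sumrB; have /matrixP/(_ i j) := mulmxV VU; rewrite !mxE => <-.
by apply: eq_bigr => k _; rewrite !mxE -mulrBr mulrC.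
Qed.

(* Each T meets the short intervals [a_i, a_i + r] substantially, and the curve
   F = (F_j)_j moves by the j-th unit vector from u_j to u_j + l_j and is nearly
   parallel to the i-th coordinate axis over the i-th interval. *)
Record frame q T (r l0 K b : R) (a l u : 'I_q -> R) (F : 'I_q -> {poly R}) : Prop := Frame {
  fr_r : 0 < r ; fr_l0 : 0 < l0 ;
  fr_l : forall i, l0 <= l i <= r ;
  fr_uT : forall i, T (u i) /\ T (u i + l i) ;
  fr_u : forall i, a i <= u i /\ u i + l i <= a i + r ;
  fr_a : forall i, 0 <= a i /\ a i + r <= 1 ;
  fr_disj : forall i j, i != j -> r < `|a i - a j| ;
  fr_size : forall j, (size (F j) <= q.+1)%N ;
  fr_F0 : forall j, (F j)`_0 = 0 ;
  fr_coef : forall j e, `|(F j)`_e| <= K ;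
  fr_dual : forall i j, (F j).[u i + l i] - (F j).[u i] = (i == j)%:R ;
  fr_near : forall i j x y, a i <= x <= a i + r -> a i <= y <= a i + r ->
    `|l j * ((F j).[x] - (F j).[y]) - (i == j)%:R * (x - y)| <= `|x - y| / (4 * q%:R) ;
  fr_meas : forall i, (b%:E <= mu (T `&` `]a i, (a i + r)%R[))%E }.

Lemma frame_exists q (c : R) : (0 < q)%N -> 0 < c <= 1 ->
  exists r l0 K b : R, [/\ 0 < r, 0 < l0, 0 < K, 0 < b &
    forall T, measurable T -> T `<=` `[0, 1[ -> (c%:E <= mu T)%E ->
      exists a l u F, @frame q T r l0 K b a l u F].
Proof.
move=> q0 /andP[c0 c1]; have qR : 0 < q%:R :> R by rewrite ltr0n.
have q1 : 1 <= q%:R :> R by rewrite ler1n.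
(* 2 q sg = c / 4 is less than the measure c / 2 left in the dense cells, so q points at mutual
   distance [sg] exist there. *)
pose sg := c / (8 * q%:R); have sg0 : 0 < sg by rewrite divr_gt0// mulr_gt0.
have sg1 : sg / 2 <= 1.
  by rewrite ler_pdivrMr// mul1r ler_pdivrMr ?mulr_gt0//; nra.
pose K0 := (2 / (sg / 2)) ^+ q.
have K00 : 0 < K0 by apply: exprn_gt0; apply: divr_gt0 => //; apply: divr_gt0.
(* Lower bound for the number m of cells. The first summand gives r < sg / 4, so that the chosen
   cells stay sg / 2 apart; the second makes the derivative of F_j, scaled by l_j, vary by at most 1
   / (4 q) over one cell. *)
pose y := 4 / sg + 4 * q%:R ^+ 3 * K0.
have q3 : 0 <= 4 * q%:R ^+ 3 * K0 by apply: mulr_ge0; [apply: mulr_ge0; rewrite ?exprn_ge0|exact: ltW].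
have y0 : 0 <= y by apply: addr_ge0 => //; apply: divr_ge0 => //; exact: ltW.
have [m ym m0] : exists2 m : nat, y < m%:R & (0 < m)%N.
  exists (Num.bound y); first exact: archi_boundP.
  by rewrite -(ltr_nat R) (le_lt_trans y0)// archi_boundP.
have mR : 0 < m%:R :> R by rewrite ltr0n.
pose r : R := m%:R^-1; have r0 : 0 < r by rewrite invr_gt0.
have yr : y * r < 1 by rewrite ltr_pdivrMr// mul1r.
have rsg : 4 * r < sg.
  have : 4 / sg * r < 1.
    apply: le_lt_trans yr; apply: ler_wpM2r; first exact: ltW.
    by rewrite lerDl.
  by rewrite mulrAC ltr_pdivrMr// mul1r.
have rK0 : 4 * q%:R ^+ 3 * K0 * r < 1.
  apply: le_lt_trans yr; apply: ler_wpM2r; first exact: ltW.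
  by rewrite lerDr; apply: divr_ge0 => //; exact: ltW.
(* A dense cell holds at least c r / 2 of [T], more than 4 l0, so it contains two points of [T] at
   distance at least [l0]. *)
pose l0 := c * r / 10; have l00 : 0 < l0 by apply: divr_gt0 => //; exact: mulr_gt0.
exists r, l0, (K0 / l0), (c * r / 2); split=> //; [exact: divr_gt0|by apply: divr_gt0 => //; exact: mulr_gt0|].
move=> T mT T01 cT.
have [T' [mT' cT' T'P]] := dense_cells m0 mT T01 cT (ltW c0).
have [|t [tT' tsep]] := @separated_points R q sg T' mT' (ltW sg0).
  apply: lt_le_trans cT'; rewrite lte_fin.
  have -> : q%:R * (2 * sg) = c / 4 by rewrite /sg; field; exact: lt0r_neq0.
  by rewrite ltr_pM2l// ltf_pV2 ?posrE// ltr_nat.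
have /choice[k kP] : forall i, exists k : 'I_m, [/\ cell m k (t i) &
    ((c * r / 2)%:E <= mu (T `&` cell m k))%E].
  move=> i; have [_ [k k1 k2]] := T'P _ (tT' i); exists k; split=> //.
  apply: le_trans k2; rewrite lee_fin le_eqVlt; apply/orP; left; apply/eqP.
  by rewrite /r; field; exact: lt0r_neq0.
pose a i : R := (k i)%:R * r.
have cellE i : cell m (k i) = `[a i, a i + r[%classic.
  by rewrite /cell /a -natr1 mulrDl mul1r.
have ta i : a i <= t i < a i + r.
  by have [] := kP i; rewrite cellE /= in_itv.
have ja i : 0 <= a i /\ a i + r <= 1.
  split; first by rewrite mulr_ge0// ltW.
  by rewrite /a -[X in _ + X]mul1r -mulrDl natr1 ler_pdivrMr// mul1r ler_nat.
have sepJ i j z w : i != j -> a i <= z <= a i + r -> a j <= w <= a j + r ->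
    sg / 2 <= `|z - w|.
  move=> ij /andP[z1 z2] /andP[w1 w2]; have := tsep _ _ ij.
  have /andP[t1 t2] := ta i; have /andP[t3 t4] := ta j.
  have : `|t i - t j| <= `|z - w| + 2 * r.
    rewrite ler_norml; have := ler_norm (z - w); have := ler_norm (w - z); rewrite distrC.
    by clear -z1 z2 w1 w2 t1 t2 t3 t4 => ? ?; apply/andP; split; lra.
  by clear -rsg => ? ?; lra.
have mJ i : ((c * r / 2)%:E <= mu (T `&` `]a i, (a i + r)%R[))%E.
  have [_ h] := kP i; apply: le_trans h _.
  apply: (@le_trans _ _ (mu (T `&` `]a i, (a i + r)%R[) + mu [set a i])%E).
    apply: le_trans; last first.
      by apply: measureU2; [apply: measurableI => //; exact: measurable_itv|exact: measurable_set1].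
    apply: le_measure; rewrite ?inE.
    - by apply: measurableI => //; exact: measurable_itv.
    - by apply: measurableU; [apply: measurableI => //; exact: measurable_itv|exact: measurable_set1].
    - move=> x [Tx]; rewrite cellE => h; have : a i <= x < a i + r by move: h; rewrite /= in_itv.
      move=> /andP[]; rewrite le_eqVlt => /orP[/eqP->|ax xa].
        by right.
      by left; split=> //; rewrite /= in_itv/= ax.
  by rewrite [mu [set _]]lebesgue_measure_set1 adde0.
have /choice[v vP] : forall i, exists v : R * R, [/\ T v.1, T (v.1 + v.2),
    a i <= v.1, v.1 + v.2 <= a i + r & l0 <= v.2].
  move=> i.
  have [| | |s [sT ss]] := @separated_points R 2 l0 (T `&` `]a i, a i + r[).
  - by apply: measurableI => //; exact: measurable_itv.
  - exact: ltW.
  - apply: lt_le_trans (mJ i); rewrite lte_fin /l0; have := mulr_gt0 c0 r0; lra.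
  have := ss 0 1 isT.
  have [T0 /=] := sT 0; rewrite in_itv/= => /andP[s1 s2].
  have [T1 /=] := sT 1; rewrite in_itv/= => /andP[s3 s4].
  have [s01|s10] := leP (s 0) (s 1).
    rewrite distrC ger0_norm ?subr_ge0// => h.
    by exists (s 0, s 1 - s 0) => /=; rewrite addrC subrK; split=> //; exact: ltW.
  rewrite ger0_norm; last by rewrite subr_ge0 ltW.
  move=> h.
  by exists (s 1, s 0 - s 1) => /=; rewrite addrC subrK; split=> //; exact: ltW.
pose u i := (v i).1; pose l i := (v i).2.
have lgt i : 0 < l i by have [_ _ _ _] := vP i; exact: lt_le_trans.
have uJ i z : u i <= z <= u i + l i -> a i <= z <= a i + r.
  have [_ _ h1 h2 _] := vP i; rewrite -/(u i) -/(l i) in h1 h2.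
  by move=> /andP[h3 h4]; rewrite (le_trans h1)// (le_trans h4).
have [F [szF F0 dualF]] : exists F : 'I_q -> {poly R}, [/\ forall j, (size (F j) <= q.+1)%N,
    forall j, (F j)`_0 = 0 & forall i j, (F j).[u i + l i] - (F j).[u i] = (i == j)%:R].
  apply: dual_polys => // i j z ij /uJ zi /uJ zj.
  have := sepJ _ _ _ _ ij zi zj; rewrite subrr normr0 leNgt divr_gt0//.
(* At these mean value points the derivative of F_j is known. They are q separated nodes for a
   polynomial of degree below q, so its coefficients are bounded independently of [T]. *)
have /choice[z zP] : forall j, exists z : 'I_q -> R, forall i,
    a i <= z i <= a i + r /\ (F j)^`().[z i] = (i == j)%:R / l j.
  move=> j.
  have rt i : exists z : R, a i <= z <= a i + r /\ (F j)^`().[z] = (i == j)%:R / l j.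
    have ui : u i < u i + l i by rewrite ltrDl.
    have [z zi] := polyrcf.poly_mvt (F j) ui.
    rewrite dualF [u i + _ - _]addrAC subrr add0r => e; exists z; split.
      by apply: uJ; move: zi; rewrite in_itv/= => /andP[/ltW-> /ltW->].
    apply: (mulIf (lt0r_neq0 (lgt i))); rewrite -e.
    have [<-|_] := eqVneq i j; last by rewrite !mul0r.
    by rewrite divfK ?lt0r_neq0.
  by have [z zP] := choice rt; exists z.
have szdF j : (size (F j)^`() <= q)%N.
  have := lt_size_deriv (p := F j); have [->|Fn0 /(_ isT) h] := eqVneq (F j) 0.
    by rewrite deriv0 size_poly0.
  by rewrite -ltnS (leq_trans h)// szF.
have a1 i x : a i <= x <= a i + r -> `|x| <= 1.
  have [h1 h2] := ja i; move=> /andP[h3 h4]; rewrite ler_norml.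
  by apply/andP; split; lra.
have codF j e : `|(F j)^`()`_e| <= K0 / l j.
  have := @coef_le_sum_separated R q (z j) (sg / 2) (F j)^`() e.
  move=> /(_ _ _ _ (szdF j)) h.
  apply: le_trans (h _ _ _) _.
  - by rewrite divr_gt0.
  - by move=> i; apply: (a1 i); have [] := zP j i.
  - by move=> i i' ii'; apply: sepJ ii' _ _; [have [] := zP j i|have [] := zP j i'].
  rewrite -/K0 ler_wpM2l ?(ltW K00)// (bigD1 j)//= big1 ?addr0 => [|i ij].
    by have [_ ->] := zP j j; rewrite eqxx mul1r ger0_norm// invr_ge0 ltW.
  by have [_ ->] := zP j i; rewrite (negPf ij) mul0r normr0.
exists a, l, u, F; split=> //.
- move=> i; have [_ _ h1 h2 ->] := vP i => /=; rewrite -/(u i) -/(l i) in h1 h2.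
  by rewrite -(lerD2l (u i)) (le_trans h2)// lerD2r.
- by move=> i; have [] := vP i.
- by move=> i; have [] := vP i.
- move=> i j ij; have := tsep _ _ ij.
  have /andP[t1 t2] := ta i; have /andP[t3 t4] := ta j.
  have : `|t i - t j| <= `|a i - a j| + r.
    rewrite ler_norml; have := ler_norm (a i - a j); have := ler_norm (a j - a i); rewrite distrC.
    by clear -t1 t2 t3 t4 => ? ?; apply/andP; split; lra.
  by clear -rsg r0 => ? ?; lra.
- move=> j [|e]; first by rewrite F0 normr0 divr_ge0// ltW.
  have : `|(F j)^`()`_e| <= K0 / l0.
    apply: le_trans (codF j e) _; rewrite ler_pM2l// lef_pV2 ?posrE//.
    by have [] := vP j.
  rewrite coef_deriv normrMn; apply: le_trans.
  by rewrite mulrS lerDl mulrn_wge0.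
- move=> i j x w xi wi.
  (* The derivative of [H] vanishes at the mean value point of the same interval, hence is small on
     all of it. *)
  pose H : {poly R} := l j *: F j - (i == j)%:R *: 'X.
  have -> : l j * ((F j).[x] - (F j).[w]) - (i == j)%:R * (x - w) = H.[x] - H.[w].
    by rewrite /H !hornerE; ring.
  rewrite [leRHS]mulrC; apply: horner_lipschitz => s sxw.
  have si : a i <= s <= a i + r.
    move: sxw; rewrite ge_min le_max; case/andP: xi => x1 x2; case/andP: wi => w1 w2.
    by clear -x1 x2 w1 w2 => /andP[/orP[]? /orP[]?]; apply/andP; split; lra.
  have [zi ezi] := zP j i.
  have -> : H^`().[s] = l j * ((F j)^`().[s] - (F j)^`().[z j i]).
    rewrite ezi /H derivB !derivZ derivX !hornerE mulrBr; congr (_ - _).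
    by rewrite mulrC divfK// lt0r_neq0.
  rewrite normrM gtr0_norm//.
  have h := @horner_dist_le R (F j)^`() q (K0 / l j) s (z j i) (szdF j).
  have {}h : `|(F j)^`().[s] - (F j)^`().[z j i]| <= q%:R ^+ 2 * (K0 / l j) * r.
    apply: le_trans (h _ (codF j) (a1 _ _ si) (a1 _ _ zi)) _.
      by rewrite divr_ge0// ltW.
    apply: ler_wpM2l.
      by apply: mulr_ge0; [exact: exprn_ge0|apply: divr_ge0; exact: ltW].
    have /andP[s1 s2] := si; have /andP[z1 z2] := zi.
    by clear -s1 s2 z1 z2; rewrite ler_norml; apply/andP; split; lra.
  apply: (@le_trans _ _ (l j * (q%:R ^+ 2 * (K0 / l j) * r))); first by rewrite ler_pM2l.
  have -> : l j * (q%:R ^+ 2 * (K0 / l j) * r) = (4 * q%:R ^+ 3 * K0 * r) / (4 * q%:R).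
    by field; rewrite ?(lt0r_neq0 qR) ?(lt0r_neq0 (lgt j)).
  by rewrite ler_pdivrMr ?mulr_gt0// mulVf ?ltW// lt0r_neq0// mulr_gt0.
Qed.

End frames.

(** * Nearly linear maps *)

Section rV_norm.
Variables (R : realType) (q : nat).
Implicit Types v : 'rV[R]_q.

Lemma rV_norm_leP v (e : R) : 0 <= e -> (`|v| <= e) <-> (forall j, `|v 0 j| <= e).
Proof.
move=> e0; rewrite /Num.Def.normr/= mx_normrE; split=> [h j|h].
  apply: le_trans h; exact: (le_bigmax _ (fun ij => `|v ij.1 ij.2|) (ord0, j)).
by apply: bigmax_le => // -[i j] _ /=; rewrite (ord1 i); exact: h.
Qed.

Lemma coord_le_norm v j : `|v 0 j| <= `|v|.
Proof. by have [h _] := rV_norm_leP v (normr_ge0 v); exact: h. Qed.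

End rV_norm.

(** Completeness of R^q, for the fixed point argument in [curve_sum_surj]. *)
HB.instance Definition _ (R : realType) (q : nat) :=
  Uniform_isComplete.Build 'rV[R]_q cauchy_cvg.

Section near_identity.
Variable R : realType.
Let mu := @lebesgue_measure R.
Variables (q : nat) (T : set (measurableTypeR R)) (r l0 K b : R).
Variables (a l u : 'I_q -> R) (F : 'I_q -> {poly R}).
Hypothesis fr : frame T r l0 K b a l u F.
Hypothesis q0 : (0 < q)%N.

Definition curve_sum (x : 'rV[R]_q) (j : 'I_q) : R := \sum_i (F j).[x 0 i].
Local Notation Phi := curve_sum.

Definition in_box (x : 'rV[R]_q) := forall i, a i <= x 0 i <= a i + r.

(** Sum of the q errors allowed by [fr_near]: with its j-th component scaled by l_j, the map is the
    identity up to a Lipschitz error of constant 1/4. *)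
Lemma curve_sum_near x y j : in_box x -> in_box y ->
  `|l j * (Phi x j - Phi y j) - (x 0 j - y 0 j)| <= `|x - y| / 4.
Proof.
move=> xJ yJ.
have -> : l j * (Phi x j - Phi y j) - (x 0 j - y 0 j) =
    \sum_i (l j * ((F j).[x 0 i] - (F j).[y 0 i]) - (i == j)%:R * (x 0 i - y 0 i)).
  rewrite sumrB -mulr_sumr -sumrB; congr (_ - _).
  by rewrite (bigD1 j)//= eqxx mul1r big1 ?addr0// => i /negPf->; rewrite mul0r.
apply: le_trans (ler_norm_sum _ _ _) _.
apply: (@le_trans _ _ (\sum_(i < q) `|x - y| / (4 * q%:R))).
  apply: ler_sum => i _; apply: le_trans (fr_near fr _ (xJ i) (yJ i)) _.
  apply: ler_wpM2r; first by rewrite invr_ge0 mulr_ge0.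
  by have := coord_le_norm (x - y) i; rewrite !mxE.
rewrite sumr_const card_ord -[leLHS]mulr_natl le_eqVlt; apply/orP; left; apply/eqP.
by field; rewrite lt0r_neq0// ltr0n.
Qed.

Lemma l_gt0 j : 0 < l j.
Proof. by have /andP[h _] := fr_l fr j; apply: lt_le_trans h; exact: fr_l0 fr. Qed.

Lemma l_le_r j : l j <= r.
Proof. by have /andP[] := fr_l fr j. Qed.

Lemma curve_sum_inj x y : in_box x -> in_box y -> Phi x =1 Phi y -> x = y.
Proof.
move=> xJ yJ e; apply/eqP; rewrite -subr_eq0 -normr_eq0 eq_le normr_ge0 andbT.
have : `|x - y| <= `|x - y| / 4.
  apply/rV_norm_leP => [|j]; first by rewrite divr_ge0.
  have := curve_sum_near j xJ yJ; rewrite e subrr mulr0 add0r normrN.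
  by rewrite !mxE.
lra.
Qed.

(** The Newton-like map z -> z - l (Phi z - y) contracts by 1/4 on the ball of radius 3/4 rho. It
    moves the centre by at most rho / 2, as l_j <= r, and 3/16 + 1/2 < 3/4; its fixed point is the
    solution. *)
Lemma curve_sum_surj (x : 'rV[R]_q) (rho : R) (y : 'I_q -> R) : 0 < rho ->
  (forall i, a i <= x 0 i - rho /\ x 0 i + rho <= a i + r) ->
  (forall j, `|y j - Phi x j| <= rho / (2 * r)) ->
  exists x', `|x' - x| < rho /\ forall j, Phi x' j = y j.
Proof.
move=> rho0 xJ yx.
pose U := [set z : 'rV[R]_q | `|z - x| <= 3 / 4 * rho].
have UJ z : U z -> in_box z.
  have h0 : 0 <= 3 / 4 * rho by lra.
  move=> /rV_norm_leP - /(_ h0) h i; have [x1 x2] := xJ i.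
  have := h i; rewrite !mxE ler_norml => /andP[h1 h2].
  by clear -x1 x2 h1 h2 rho0; apply/andP; split; lra.
have Ux : U x by rewrite /U /= subrr normr0 mulr_ge0// ltW.
pose f (z : 'rV[R]_q) : 'rV[R]_q := \row_j (z 0 j - l j * (Phi z j - y j)).
have fE z w j : (f z - f w) 0 j = - (l j * (Phi z j - Phi w j) - (z 0 j - w 0 j)).
  by rewrite !mxE; ring.
have fctr z w : U z -> U w -> `|f z - f w| <= 1 / 4 * `|z - w|.
  move=> Uz Uw; apply/rV_norm_leP => [|j]; first by rewrite mulr_ge0.
  rewrite fE normrN mul1r [leRHS]mulrC; apply: curve_sum_near; exact: UJ.
have fU z : U z -> U (f z).
  move=> Uz; rewrite /U /=.
  have -> : f z - x = (f z - f x) + (f x - x) by rewrite addrA subrK.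
  have h1 := fctr _ _ Uz Ux.
  have h2 : `|f x - x| <= rho / 2.
    apply/rV_norm_leP => [|j]; first by rewrite divr_ge0// ltW.
    have -> : (f x - x) 0 j = l j * (y j - Phi x j) by rewrite !mxE; ring.
    rewrite normrM gtr0_norm ?l_gt0//.
    have -> : rho / 2 = r * (rho / (2 * r)).
      by field; rewrite lt0r_neq0// (fr_r fr).
    by apply: ler_pM => //; [exact/ltW/l_gt0|exact: l_le_r].
  apply: le_trans (ler_normD _ _) _.
  move: Uz h1 h2; rewrite /U /=; move: `|_| `|_| `|_| => A B C; lra.
pose g : {fun U >-> U} := mkfun_fun fU.
have gc : is_contraction g.
  exists (NngNum (ltac:(lra) : 0 <= 1 / 4 :> R)); split=> /=; first lra.
  by move=> [z w] [/= Uz Uw]; exact: fctr.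
have clU : closed U.
  rewrite (_ : U = closed_ball x (3 / 4 * rho)).
    exact: closed_ball_closed.
  rewrite closed_ballE ?mulr_gt0//; apply/seteqP; split=> z;
  by rewrite /U /closed_ball_ /= distrC.
have [z Uz zg] := banach_fixed_point gc clU (ex_intro _ x Ux).
exists z; split.
  by apply: le_lt_trans Uz _; lra.
move=> j; have /rowP/(_ j) := zg; rewrite /= mxE => /eqP.
rewrite -subr_eq0 opprB addrCA subrr addr0 mulf_eq0 => /orP[|].
  by rewrite gt_eqF// l_gt0.
by rewrite subr_eq0 => /eqP.
Qed.

End near_identity.

(** * Grid cells inside an open set *)

Section grid_cells.
Variable R : realType.
Let mu := @lebesgue_measure R.

(** The points with a margin of order [e n] inside [X] increase to [X], so for some n they have
    measure above b / 2. Cells of step at most e n / 2 meeting that set lie in [X] and cover it. The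
    threshold depends on [X], the proportion does not. *)
Lemma open_grid_cells (X : set (measurableTypeR R)) (b : R) :
  open (X : set R) -> X `<=` `[0, 1] -> 0 < b -> (b%:E <= mu X)%E ->
  exists2 h0 : R, 0 < h0 & forall (h : R) (m : nat), 0 < h -> h <= h0 -> 1 < m%:R * h ->
    exists L : {set 'I_m}, b / 2 <= #|L|%:R * h /\
      forall l, l \in L -> `[l%:R * h, l.+1%:R * h] `<=` X.
Proof.
move=> oX X01 b0 bX.
pose e (n : nat) : R := 2^-1 ^+ n.
have e0 n : 0 < e n by rewrite exprn_gt0// invr_gt0.
have eS n : e n.+1 = e n / 2 by rewrite /e exprSr.
pose W n := [set y : R | ball y (2 * e n) `<=` X].
(* Thickening [W n] by balls makes it open, hence measurable, at the cost of half the margin. *)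
pose Y n : set (measurableTypeR R) := \bigcup_(y in W n) ball (y : R) (e n).
have oY n : open (Y n : set R) by apply: bigcup_open => y _; exact: ball_open.
have mY n : measurable (Y n) by apply: measurable_realfun.open_measurable; exact: oY.
have YX n x : Y n x -> ball (x : R) (e n) `<=` X.
  move=> [y Wy yx] z xz; apply: Wy; have -> : 2 * e n = e n + e n by ring.
  exact: ball_triangle yx xz.
have UX : \bigcup_n Y n = X.
  apply/seteqP; split=> [x [n _ /YX]|x Xx]; first by apply; exact: ballxx.
  have /nbhs_ballP[d /= d0 dX] : nbhs (x : R) X by exact: open_nbhs_nbhs.
  have [n _ nd] : \forall n \near \oo, 2 * e n < d.
    have : (fun n => 2 * e n) @ \oo --> (2 * 0 : R).
      by apply: cvgMr; apply: cvg_expr; rewrite ger0_norm ?invr_ge0// invf_lt1// ltr1n.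
    rewrite mulr0 => /cvgrPdist_lt /(_ d d0); apply: filterS => n.
    by rewrite sub0r normrN; apply: le_lt_trans; rewrite ler_norm.
  exists n => //; exists x; last exact: ballxx.
  by move=> z xz; apply: dX; apply: le_ball xz; apply/ltW/nd => /=.
have Ymon : {homo Y : n m / (n <= m)%N >-> (n <= m)%O}.
  apply/nondecreasing_seqP => n; apply/subsetPset => x Yx.
  exists x; last exact: ballxx.
  move=> z xz; apply: (YX n x Yx); apply: le_ball xz.
  by rewrite eS mulrC divfK.
have [n hn] : exists n, ((b / 2)%:E < mu (Y n))%E.
  apply: contrapT => no.
  have := @nondecreasing_cvg_mu _ _ _ mu Y mY _ Ymon; rewrite UX.
  have mX : measurable X by apply: measurable_realfun.open_measurable.
  move=> /(_ mX) cv.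
  have : (limn (mu \o Y) <= (b / 2)%:E)%E.
    apply: lime_le; first by apply/cvg_ex; eexists; exact: cv.
    by apply: nearW => n /=; rewrite leNgt; apply/negP => h; apply: no; exists n.
  rewrite (cvg_lim _ cv)// => h; have := le_trans bX h.
  by rewrite lee_fin; lra.
exists (e n / 2); first by rewrite divr_gt0.
move=> h m h0 hh0 mh.
pose J (l : 'I_m) : set (measurableTypeR R) := `[l%:R * h, l.+1%:R * h]%classic.
pose L := [set l : 'I_m | `[< J l `<=` X >]]%SET.
exists L; split; last by move=> l; rewrite inE => /asboolP.
have mJ l : measurable (J l) by exact: measurable_itv.
have [mU leU] := @le_measure_bigsetU_cond _ _ _ mu _ (index_enum 'I_m) (mem L) _ mJ.
have YU : Y n `<=` \big[setU/set0]_(l in L) J l.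
  move=> x Yx; have Xx : X x by apply: (YX n x Yx); exact: ballxx.
  have /= := X01 _ Xx; rewrite in_itv/= => /andP[x0 x1].
  have xh0 : 0 <= x / h by rewrite divr_ge0// ltW.
  have /andP[k1 k2] := truncn_itv xh0; set k := Num.truncn _ in k1 k2.
  rewrite ler_pdivlMr// in k1; rewrite ltr_pdivrMr// in k2.
  have km : (k < m)%N.
    rewrite -(ltr_nat R) -(ltr_pM2r h0); apply: le_lt_trans mh.
    exact: le_trans x1.
  rewrite -bigcup_seq_cond; exists (Ordinal km) => /=; last first.
    by rewrite /J /= in_itv/= k1 ltW.
  rewrite mem_index_enum/= inE; apply/asboolP => z; rewrite /J /= in_itv/= => /andP[z1 z2].
  apply: (YX n x Yx); rewrite /ball /= ltr_distlC.
  have e1 : k.+1%:R * h = k%:R * h + h by rewrite -natr1 mulrDl mul1r.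
  have := e0 n; rewrite e1 in z2 k2; clear -z1 z2 k1 k2 hh0 h0 => en0.
  by apply/andP; split; lra.
have : (mu (Y n) <= \sum_(l in L) mu (J l))%E.
  by apply: le_trans leU; apply: le_measure; rewrite ?inE.
have -> : (\sum_(l in L) mu (J l) = (#|L|%:R * h)%:E)%E.
  rewrite (eq_bigr (fun=> h%:E)); last first.
    move=> l _; rewrite /mu /J lebesgue_measure_itv/= lte_fin ltr_pM2r// ltr_nat ltnSn.
    by rewrite -EFinB -mulrBl -natr1 addrAC subrr add0r mul1r.
  by rewrite sumEFin sumr_const mulr_natl.
by move=> h1; have := lt_le_trans hn h1; rewrite lte_fin => /ltW.
Qed.

End grid_cells.

(** * Images of grid cells modulo a lattice *)

Section torus.
Variable R : realType.
Let mu := @lebesgue_measure R.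

(** This diameter of the image dictates the period [g]: taken larger by more than 1, it leaves room
    for a grid cell, so that different grid cells of the image are never congruent. *)
Lemma curve_sum_dist q T (r l0 K b : R) a l u F : @frame R q T r l0 K b a l u F ->
  (0 < q)%N -> forall x y j, in_box r a x -> in_box r a y ->
  `|curve_sum F x j - curve_sum F y j| <= 5 / 4 * r / l0.
Proof.
move=> fr q0 x y j xJ yJ.
have r0 := fr_r fr; have l00 := fr_l0 fr; have /andP[ll lr] := fr_l fr j.
have h := curve_sum_near fr q0 j xJ yJ.
have nr : `|x - y| <= r.
  apply/rV_norm_leP => [|i]; first exact: ltW.
  have /andP[x1 x2] := xJ i; have /andP[y1 y2] := yJ i.
  by clear -x1 x2 y1 y2; rewrite !mxE ler_norml; apply/andP; split; lra.
have xyj : `|x 0 j - y 0 j| <= r.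
  by have := le_trans (coord_le_norm (x - y) j) nr; rewrite !mxE.
have : l j * `|curve_sum F x j - curve_sum F y j| <= 5 / 4 * r.
  rewrite -[l j](gtr0_norm (l_gt0 fr j)) -normrM.
  move: h xyj; move: (l j * _) (x 0 j - y 0 j) => A B h xyj.
  have -> : A = (A - B) + B by rewrite subrK.
  apply: le_trans (ler_normD _ _) _; move: h nr xyj; move: `|_| `|_| `|_| => n1 n2 n3.
  by clear => ? ? ?; lra.
move=> h2; rewrite ler_pdivlMr// mulrC; apply: le_trans h2.
by apply: ler_wpM2r.
Qed.

(* Grid cells of side g / M contained in the image of [curve_sum] have pairwise
   different residues mod M, so they make up a positive proportion of (Z/M)^q. *)
Lemma curve_sum_cells q T (r l0 K b : R) a l u F (g D : nat) : @frame R q T r l0 K b a l u F ->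
  (0 < q)%N -> open (T : set R) -> T `<=` `[0, 1] -> 0 < b ->
  5 / 4 * r / l0 + 1 < g%:R -> (8 * r * g%:R / b) ^+ q <= D%:R ->
  exists M0 : nat, forall M, prime M -> (M0 <= M)%N ->
    exists A : {set 'rV['F_M]_q}, (M ^ q <= D * #|A|)%N /\
      forall c, c \in A -> exists n : 'I_q -> int,
        c = \row_j (n j)%:~R /\
        forall y : 'I_q -> R,
          (forall j, (n j)%:~R * (g%:R / M%:R) <= y j < ((n j)%:~R + 1) * (g%:R / M%:R)) ->
          exists x : 'rV[R]_q, [/\ in_box r a x, forall i, T (x 0 i) & forall j, curve_sum F x j = y j].
Proof.
move=> fr q0 oT T01 b0 hg hD.
have r0 := fr_r fr; have l00 := fr_l0 fr.
pose X i : set (measurableTypeR R) := T `&` `]a i, a i + r[.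
have oX i : open (X i : set R) by apply: openI => //; exact: interval_open.
have X01 i : X i `<=` `[0, 1] by move=> x [/T01].
have bX i : (b%:E <= mu (X i))%E by exact: fr_meas fr i.
have /choice[h0 hP] : forall i, exists h0 : R, 0 < h0 /\ forall (h : R) (m : nat), 0 < h -> h <= h0 -> 1 < m%:R * h ->
    exists L : {set 'I_m}, b / 2 <= #|L|%:R * h /\
      forall l, l \in L -> `[l%:R * h, l.+1%:R * h] `<=` X i.
  by move=> i; have [h0 h00 h0P] := open_grid_cells (oX i) (@X01 i) b0 (bX i); exists h0.
have w0 : 0 <= 5 / 4 * r / l0 by rewrite divr_ge0 ?mulr_ge0// ltW.
have g0 : 0 < g%:R :> R by apply: lt_trans hg; lra.
(* Beyond this bound, [M] makes the target step s less than 1 and the source step h at most every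
   threshold [h0 i]. *)
pose y0 := \sum_i 4 * r * g%:R / h0 i + g%:R.
have y00 : 0 <= y0.
  apply: addr_ge0; last exact: ltW.
  apply: sumr_ge0 => i _; apply: divr_ge0; last by apply: ltW; case: (hP i).
  by apply: mulr_ge0; [apply: mulr_ge0|]; rewrite ?ltW.
exists (Num.bound y0) => M pM M0M.
have yM : y0 < M%:R by apply: lt_le_trans (archi_boundP y00) _; rewrite ler_nat.
have gM : g%:R < M%:R :> R.
  apply: le_lt_trans yM; rewrite lerDr; apply: sumr_ge0 => i _; apply: divr_ge0; last by apply: ltW; case: (hP i).
  by apply: mulr_ge0; [apply: mulr_ge0|]; rewrite ?ltW.
have MR : 0 < M%:R :> R by apply: lt_trans gM.
pose s : R := g%:R / M%:R; have s0 : 0 < s by exact: divr_gt0.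
have s1 : s < 1 by rewrite ltr_pdivrMr// mul1r.
(* With radius h / 2, [curve_sum_surj] reaches everything within h / (4 r) = s of the image of the
   centre of a source cell, hence the whole target cell around that image. *)
pose h := 4 * r * s; have hh0 : 0 < h by apply: mulr_gt0 => //; apply: mulr_gt0.
have hle i : h <= h0 i.
  have hi0 : 0 < h0 i by case: (hP i).
  have : 4 * r * g%:R / h0 i < M%:R.
    apply: le_lt_trans yM; rewrite /y0 (bigD1 i)//= -addrA lerDl.
    apply: addr_ge0; last exact: ltW.
    apply: sumr_ge0 => k _; apply: divr_ge0; last by apply: ltW; case: (hP k).
    by apply: mulr_ge0; [apply: mulr_ge0|]; rewrite ?ltW.
  rewrite ltr_pdivrMr// => hh; rewrite /h /s mulrA ler_pdivrMr//.
  by rewrite [h0 i * _]mulrC ltW.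
pose m := Num.bound (h^-1).
have mh : 1 < m%:R * h by rewrite -ltr_pdivrMr// mul1r archi_boundP// invr_ge0 ltW.
have /choice[L LP] : forall i, exists L : {set 'I_m}, b / 2 <= #|L|%:R * h /\
      forall l, l \in L -> `[l%:R * h, l.+1%:R * h] `<=` X i.
  by move=> i; have [_ /(_ h m hh0 (hle i) mh)] := hP i.
pose ctr (k : {ffun 'I_q -> 'I_m}) : 'rV[R]_q := \row_i ((k i)%:R * h + h / 2).
pose fam : {set {ffun 'I_q -> 'I_m}} := [set k | k \in family (fun i => mem (L i))]%SET.
have famP k i : k \in fam -> k i \in L i by rewrite inE => /familyP.
have ctrX k i z : k \in fam -> `|z - ctr k 0 i| <= h / 2 -> X i z.
  move=> kf zc; have [_ LX] := LP i; apply: (LX _ (famP k i kf)).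
  move: zc; rewrite mxE ler_norml /= in_itv/= -[(k i).+1%:R]natr1 mulrDl mul1r => /andP[z1 z2].
  by clear -z1 z2; apply/andP; split; lra.
pose n (k : {ffun 'I_q -> 'I_m}) j : int := Num.floor (curve_sum F (ctr k) j / s).
have nP k j : (n k j)%:~R * s <= curve_sum F (ctr k) j < ((n k j)%:~R + 1) * s.
  have /andP[n1 n2] := floor_itv (curve_sum F (ctr k) j / s).
  by rewrite -ler_pdivlMr// n1/= -ltr_pdivrMr// -(@intrD R _ 1).
have surj k (y : 'I_q -> R) : k \in fam ->
    (forall j, (n k j)%:~R * s <= y j < ((n k j)%:~R + 1) * s) ->
    exists x : 'rV[R]_q, [/\ forall i, `|x 0 i - ctr k 0 i| < h / 2, in_box r a x, forall i, T (x 0 i) &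
                  forall j, curve_sum F x j = y j].
  move=> kf yP.
  have rho0 : 0 < h / 2 by rewrite divr_gt0.
  have cJ i : a i <= ctr k 0 i - h / 2 /\ ctr k 0 i + h / 2 <= a i + r.
    have [_ ] := ctrX k i (ctr k 0 i - h / 2) kf ltac:(rewrite addrAC subrr add0r normrN ger0_norm// ltW//).
    rewrite /= in_itv/= => /andP[/ltW-> _].
    have [_ ] := ctrX k i (ctr k 0 i + h / 2) kf ltac:(rewrite addrAC subrr add0r ger0_norm// ltW//).
    by rewrite /= in_itv/= => /andP[_ /ltW->].
  have hrs : h / 2 / (2 * r) = s by rewrite /h; field; rewrite lt0r_neq0.
  have [|x [xc xy]] := curve_sum_surj fr q0 rho0 cJ (y := y).
    move=> j; rewrite hrs; have /andP[y1 y2] := yP j; have /andP[n1 n2] := nP k j.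
    rewrite mulrDl mul1r in y2; rewrite mulrDl mul1r in n2.
    by clear -y1 y2 n1 n2; rewrite ler_norml; apply/andP; split; lra.
  have xc' i : `|x 0 i - ctr k 0 i| < h / 2.
    apply: le_lt_trans xc; have -> : x 0 i - ctr k 0 i = (x - ctr k) 0 i by rewrite [RHS]mxE; congr (_ + _); rewrite [RHS]mxE.
    exact: coord_le_norm.
  exists x; split=> // i.
    have [_] := ctrX k i _ kf (ltW (xc' i)); rewrite /= in_itv/= => /andP[/ltW-> /ltW->//].
  by have [] := ctrX k i _ kf (ltW (xc' i)).
pose code (k : {ffun 'I_q -> 'I_m}) : 'rV['F_M]_q := \row_j (n k j)%:~R.
have codeI : {in fam &, injective code}.
  move=> k k' kf kf' e.
  have ctrJ k1 : k1 \in fam -> in_box r a (ctr k1).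
    move=> k1f i; have [_] := ctrX k1 i (ctr k1 0 i) k1f ltac:(rewrite subrr normr0 divr_ge0// ltW//).
    by rewrite /= in_itv/= => /andP[/ltW-> /ltW->].
  have nn j : n k j = n k' j.
    have := congr1 (fun c : 'rV_q => c 0 j) e; rewrite !mxE => /eqP.
    rewrite -subr_eq0 -intrB -(dvdz_pcharf (pchar_Fp pM)) => /dvdzP[z zE].
    (* Indices congruent mod [M] that differ by less than [M] are equal; this is where the size of
       [g] enters. *)
    have lt1 : `|(n k j - n k' j)%:~R| < M%:R :> R.
      have h1 := curve_sum_dist fr q0 j (ctrJ _ kf) (ctrJ _ kf').
      have /andP[n1 n2] := nP k j; have /andP[n3 n4] := nP k' j.
      have : `|(n k j - n k' j)%:~R * s| < M%:R * s.
        have -> : M%:R * s = g%:R by rewrite /s mulrC divfK// lt0r_neq0.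
        rewrite mulrDl mul1r in n2; rewrite mulrDl mul1r in n4.
        rewrite intrB mulrBl; move: h1; rewrite ler_norml ltr_norml => /andP[h1 h2].
        by clear -n1 n2 n3 n4 h1 h2 hg s1; apply/andP; split; lra.
      by rewrite normrM (gtr0_norm s0) ltr_pM2r.
    have : z = 0.
      apply/eqP; rewrite -absz_eq0 -leqn0 -ltnS; move: lt1; rewrite zE intrM normrM.
      have -> : `|(M : int)%:~R| = M%:R :> R by rewrite -pmulrn normr_nat.
      rewrite -[ltRHS]mul1r ltr_pM2r// -intr_norm -[1]/(1%:~R) ltr_int.
      by rewrite -abszE.
    by move=> z0; apply/eqP; rewrite -subr_eq0 zE z0 mul0r.
  (* Both source cells contain a preimage of this corner of their common target cell. By injectivity
     it is the same point, strictly within h / 2 of both centres, so the source cells coincide. *)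
  pose y j := (n k j)%:~R * s.
  have yP j : (n k j)%:~R * s <= y j < ((n k j)%:~R + 1) * s.
    by rewrite lexx/= ltr_pM2r// ltrDl.
  have [x [xc xJ _ xy]] := surj k y kf yP.
  have [|x' [xc' xJ' _ xy']] := surj k' y kf'; first by move=> j; rewrite -nn.
  have xx' : x = x'.
    by apply: (curve_sum_inj fr q0 xJ xJ') => j; rewrite xy xy'.
  subst x'; apply/ffunP => i; apply/val_inj/eqP.
  have := xc i; have := xc' i; rewrite !mxE !ltr_norml => /andP[x1 x2] /andP[x3 x4].
  have le12 (k1 k2 : nat) : k1%:R * h < k2%:R * h + h -> (k1 <= k2)%N.
    by rewrite -[X in _ + X]mul1r -mulrDl natr1 ltr_pM2r// ltr_nat ltnS.
  by rewrite eqn_leq; apply/andP; split; apply: le12; clear -x1 x2 x3 x4; lra.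
exists (code @: fam)%SET; split; last first.
  move=> _ /imsetP[k kf ->]; exists (n k); split=> // y yP.
  by have [x [_ ? ? ?]] := surj k y kf yP; exists x.
rewrite card_in_imset// -(ler_nat R) natrM natrX.
have bh0 : 0 <= b / 2 / h by apply/ltW/divr_gt0 => //; exact: divr_gt0.
have cf : (b / 2 / h) ^+ q <= #|fam|%:R.
  have -> : #|fam| = (\prod_(i < q) #|L i|)%N.
    rewrite cardsE card_family foldrE big_map big_enum/=; apply: eq_bigr => i _.
    by apply: eq_card.
  rewrite natr_prod -[q in X in X <= _]card_ord -prodr_const.
  apply: ler_prod => i _; have [bL _] := LP i.
  rewrite ler_pdivrMr// bL andbT; exact: bh0.
(* The two bases multiply to [M], because h = 4 r g / M. *)
apply: (@le_trans _ _ ((8 * r * g%:R / b) ^+ q * (b / 2 / h) ^+ q)).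
  rewrite -exprMn le_eqVlt; apply/orP; left; apply/eqP; congr (_ ^+ q).
  by rewrite /h /s; field; rewrite ?(lt0r_neq0 r0) ?(lt0r_neq0 g0) ?(lt0r_neq0 b0) ?(lt0r_neq0 MR).
apply: ler_pM => //; apply: exprn_ge0 => //.
apply/ltW/divr_gt0 => //; apply: mulr_gt0 => //; exact: mulr_gt0.
Qed.

End torus.

(** * Sums of points of the moment curve *)

Section absorb.
Variable R : realType.
Let mu := @lebesgue_measure R.

Lemma exp_ratio_unbounded (D : nat) : exists J, (3 ^ J * D < 4 ^ J)%N.
Proof.
exists (3 * D)%N; elim: D => [|D IH]; first by rewrite muln0.
rewrite [(3 * D.+1)%N]mulnS -[(3 + 3 * D)%N]/((3 * D).+3) !expnS.
have : (3 ^ (3 * D) <= 4 ^ (3 * D))%N by case: (D) => [|D'] //; rewrite leq_exp2r.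
move: IH; move: (3 ^ (3 * D))%N (4 ^ (3 * D))%N => x y h1.
by move=> xy; rewrite mulnS; lia.
Qed.

(* Repeated doubling of the set of residues found in [curve_sum_cells] fills (Z/M)^q, so
   that boundedly many points of the curve reach every point of the torus (R / g Z)^q. *)
Lemma torus_cover q (r l0 b : R) : (0 < q)%N -> 0 < r -> 0 < l0 -> 0 < b ->
  exists (g : nat) (N : nat), forall T K a l u F, @frame R q T r l0 K b a l u F ->
    open (T : set R) -> T `<=` `[0, 1] ->
    forall tau : 'I_q -> R, exists (x : seq 'rV[R]_q) (z : 'I_q -> int),
      [/\ size x = N, forall y, y \in x -> in_box r a y /\ forall i, T (y 0 i) &
       forall j, \sum_(y <- x) curve_sum F y j = tau j + g%:R * (z j)%:~R].
Proof.
move=> q0 r0 l00 b0.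
have w0 : 0 <= 5 / 4 * r / l0 + 1.
  apply: addr_ge0 => //; apply: divr_ge0; last exact: ltW.
  by apply: mulr_ge0; [|exact: ltW].
pose g := Num.bound (5 / 4 * r / l0 + 1).
have hg : 5 / 4 * r / l0 + 1 < g%:R by exact: archi_boundP.
pose D := Num.bound ((8 * r * g%:R / b) ^+ q).
have hD : (8 * r * g%:R / b) ^+ q <= D%:R.
  apply/ltW/archi_boundP/exprn_ge0; apply: divr_ge0; last exact: ltW.
  by apply: mulr_ge0 => //; apply: mulr_ge0 => //; exact: ltW.
have [J hJ] := exp_ratio_unbounded D.
exists g, (2 ^ J.+1)%N => T K a l u F fr oT T01 tau.
have [M0 cells] := curve_sum_cells fr q0 oT T01 b0 hg hD.
(* [M] depends on the frame, whereas the numbers [g] and 2^(J+1) of the conclusion were fixed before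
   it. *)
have [M M0D pM] := prime_above (M0 + D).
have [A [cA AP]] := cells M pM (leq_trans (leq_addr _ _) (ltnW M0D)).
have MR : 0 < M%:R :> R by rewrite ltr0n prime_gt0.
have g0 : 0 < g%:R :> R by apply: le_lt_trans hg.
pose s : R := g%:R / M%:R; have s0 : 0 < s by exact: divr_gt0.
have cG : #|{: 'rV['F_M]_q}| = (M ^ q)%N by rewrite card_mx card_Fp// mul1n.
have AT : iter J.+1 (@sumset2 _) A = [set: 'rV['F_M]_q]%SET.
  apply: (@iter_sumset2_setT _ A D J) => //.
  - move=> H cl H0 hc; apply: (@closed_rV_Fp_setT M q D) => //.
    exact: leq_ltn_trans (leq_addl _ _) M0D.
  - rewrite lt0n; apply/eqP => A0; move: cA; rewrite A0 muln0 leqn0 expn_eq0.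
    by rewrite (gtn_eqF (prime_gt0 pM)).
  - by rewrite cG.
pose fl j : int := Num.floor (tau j / s).
have flP j : (fl j)%:~R * s <= tau j < ((fl j)%:~R + 1) * s.
  have /andP[n1 n2] := floor_itv (tau j / s).
  by rewrite -ler_pdivlMr// n1/= -ltr_pdivrMr// -(@intrD R _ 1).
have [c [sc cA' csum]] : exists c : seq 'rV['F_M]_q, [/\ size c = (2 ^ J.+1)%N,
    {subset c <= A} & \sum_(v <- c) v = \row_j (fl j)%:~R].
  by apply: sumset2_seq; rewrite AT finset.in_setT.
have /choice[n nP] : forall v : 'rV['F_M]_q, exists n : 'I_q -> int, v \in A ->
   v = \row_j (n j)%:~R /\
        forall y : 'I_q -> R,
          (forall j, (n j)%:~R * (g%:R / M%:R) <= y j < ((n j)%:~R + 1) * (g%:R / M%:R)) ->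
          exists x : 'rV[R]_q, [/\ in_box r a x, forall i, T (x 0 i) & forall j, curve_sum F x j = y j].
  move=> v; have [vA|vA] := boolP (v \in A); last by exists (fun=> 0).
  by have [n h] := AP v vA; exists n.
have divM j : exists z : int, \sum_(v <- c) n v j - fl j = z * M.
  apply/dvdzP; rewrite (dvdz_pcharf (pchar_Fp pM)) intrB subr_eq0.
  have := congr1 (fun v : 'rV_q => v 0 j) csum; rewrite summxE !mxE => <-.
  rewrite rmorph_sum /= big_seq [eqbRHS]big_seq; apply/eqP/eq_bigr => v vc.
  have [e _] := nP v (cA' v vc).
  by have := congr1 (fun w : 'rV_q => w 0 j) e; rewrite [RHS]mxE => ->.
have {divM} [z zP] := choice divM.
have lift1 v (e : 'I_q -> R) : v \in A -> (forall j, 0 <= e j < s) -> exists x : 'rV[R]_q,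
    [/\ in_box r a x, forall i, T (x 0 i) & forall j, curve_sum F x j = (n v j)%:~R * s + e j].
  move=> vA he; have [_ h] := nP v vA; apply: h => j.
  have /andP[e1 e2] := he j; rewrite -/s mulrDl mul1r lerDl e1/=.
  by rewrite ltrD2l.
(* Only the last summand carries the offset of [tau] within its grid cell; the others hit cell
   corners exactly, so no error accumulates. *)
have lifts (d : seq 'rV['F_M]_q) (e : 'I_q -> R) : (0 < size d)%N -> {subset d <= A} ->
    (forall j, 0 <= e j < s) ->
    exists x : seq 'rV[R]_q, [/\ size x = size d,
      forall y, y \in x -> in_box r a y /\ forall i, T (y 0 i) &
      forall j, \sum_(y <- x) curve_sum F y j = (\sum_(v <- d) n v j)%:~R * s + e j].
  elim: d e => // v d IH e _ dA he; have [d0|dn] := posnP (size d).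
    have [|x [x1 x2 x3]] := @lift1 v e _ he; first by rewrite dA// mem_head.
    exists [:: x]; rewrite /= d0; split=> // [y|j]; first by rewrite inE => /eqP->.
    by rewrite (size0nil d0) !big_seq1.
  have [| |x [x1 x2 x3]] := @lift1 v (fun=> 0).
  - by rewrite dA// mem_head.
  - by move=> _; rewrite lexx s0.
  have [|xs [xs1 xs2 xs3]] := IH e dn _ he.
    by move=> w wd; rewrite dA// inE wd orbT.
  exists (x :: xs); split=> [|y|j]; first by rewrite /= xs1.
    by rewrite inE => /orP[/eqP->|/xs2].
  by rewrite !big_cons x3 xs3 addr0 intrD mulrDl addrA.
have [| | |x [x1 x2 x3]] := lifts c (fun j => tau j - (fl j)%:~R * s).
- by rewrite sc expn_gt0.
- exact: cA'.
- move=> j; have /andP[f1 f2] := flP j; rewrite subr_ge0 f1/=.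
  by rewrite ltrBlDl -[X in _ + X]mul1r -mulrDl.
exists x, z; split=> //; first by rewrite x1.
move=> j; rewrite x3.
have -> : \sum_(v <- c) n v j = z j * M + fl j by rewrite -zP subrK.
rewrite intrD intrM -pmulrn /s; field; exact: lt0r_neq0.
Qed.

Lemma frame_hornerE q T (r l0 K b : R) a l u F : @frame R q T r l0 K b a l u F ->
  forall j x, (F j).[x] = \sum_(e < q) (F j)`_e.+1 * x ^+ e.+1.
Proof.
move=> fr j x; rewrite (horner_coef_wide _ (fr_size fr j)) big_ord_recl (fr_F0 fr) mul0r add0r.
by apply: eq_bigr => e _.
Qed.

(** By [fr_dual] the coefficient matrix of the F_j inverts the matrix of increments of the powers.
    Hence power sums may be checked through the sums of the F_j. *)
Lemma frame_coef_inj q T (r l0 K b : R) a l u F : @frame R q T r l0 K b a l u F ->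
  forall v1 v2 : 'I_q -> R,
  (forall j, \sum_(e < q) (F j)`_e.+1 * v1 e = \sum_(e < q) (F j)`_e.+1 * v2 e) -> v1 =1 v2.
Proof.
move=> fr v1 v2 h; pose A : 'M[R]_q := \matrix_(e, j) (F j)`_e.+1.
pose V : 'M[R]_q := \matrix_(i, e) ((u i + l i) ^+ e.+1 - u i ^+ e.+1).
have VA : V *m A = 1%:M.
  apply/matrixP => i j; rewrite !mxE -(fr_dual fr i j) !(frame_hornerE fr) -sumrB.
  by apply: eq_bigr => e _; rewrite !mxE -mulrBr mulrC.
have AV := mulmx1C VA.
have : (\row_e (v1 e - v2 e)) *m A = 0.
  apply/rowP => j; rewrite !mxE; under eq_bigr do rewrite !mxE mulrC mulrBr.
  by rewrite sumrB h subrr.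
move=> /(congr1 (mulmx^~ V)); rewrite -mulmxA AV mulmx1 mul0mx => /rowP e0 e.
by have /eqP := e0 e; rewrite !mxE subr_eq0 => /eqP.
Qed.

(* With k points of T, k depending only on q, c and R0, the moment curve reaches a
   whole box: [torus_cover] gives the right value up to g z with z integral and
   bounded, and g z is then corrected by using u_i + l_i instead of u_i the
   appropriate number of times. *)
Lemma moment_curve_box q (c R0 : R) : (0 < q)%N -> 0 < c <= 1 -> 0 <= R0 ->
  exists k : nat, forall T : set (measurableTypeR R), open (T : set R) ->
    T `<=` `[0, 1[ -> (c%:E <= mu T)%E ->
    exists w : 'I_q -> R, forall s : 'I_q -> R, (forall e, `|s e - w e| <= R0) ->
      exists t : seq R, [/\ size t = k, forall x, x \in t -> T x &
        forall e : 'I_q, \sum_(x <- t) x ^+ e.+1 = s e].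
Proof.
move=> q0 c01 R00.
have [r [l0 [K [b [r0 l00 K0 b0 frames]]]]] := frame_exists q0 c01.
have [g [N cover]] := torus_cover q0 r0 l00 b0.
(* Bound for |g z|: N summands each varying by at most the diameter of the image, plus the effect on
   the F_j of moving s by [R0]. *)
pose bd := N%:R * (5 / 4 * r / l0) + q%:R * (K * R0).
have bd0 : 0 <= bd.
  apply: addr_ge0; last by rewrite !mulr_ge0// ltW.
  by rewrite mulr_ge0// divr_ge0 ?mulr_ge0// ltW.
pose Z := Num.bound bd; have bdZ : bd < Z%:R by exact: archi_boundP.
exists (N * q + 2 * Z * q)%N => T oT T01 cT.
have mT : measurable T by apply: measurable_realfun.open_measurable.
have [a [l [u [F fr]]]] := frames T mT T01 cT.
have T01' : T `<=` `[0, 1].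
  by move=> x /T01 /=; rewrite !in_itv/= => /andP[-> /ltW].
pose u' i := u i + l i.
pose m (x : R) (e : 'I_q) : R := x ^+ e.+1.
pose Fm j (v : 'I_q -> R) := \sum_(e < q) (F j)`_e.+1 * v e.
have FmE j x : (F j).[x] = Fm j (m x) by exact: (frame_hornerE fr).
have FmD j v1 v2 : Fm j (fun e => v1 e + v2 e) = Fm j v1 + Fm j v2.
  by rewrite /Fm -big_split/=; apply: eq_bigr => e _; rewrite mulrDr.
have FmZ j k v1 : Fm j (fun e => k * v1 e) = k * Fm j v1.
  by rewrite /Fm mulr_sumr; apply: eq_bigr => e _; rewrite mulrCA.
have Fmsum (I : Type) (d : seq I) (v : I -> 'I_q -> R) j :
    Fm j (fun e => \sum_(i <- d) v i e) = \sum_(i <- d) Fm j (v i).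
  by rewrite /Fm exchange_big/=; apply: eq_bigr => e _; rewrite mulr_sumr.
have Fminj v1 v2 : (forall j, Fm j v1 = Fm j v2) -> v1 =1 v2 by exact: (frame_coef_inj fr).
pose uv : 'rV[R]_q := \row_i u i.
(* The value attained when all N tuples sit at u and no lattice correction is made. *)
pose w (e : 'I_q) := N%:R * (\sum_i m (u i) e) + Z%:R * (\sum_i (m (u' i) e + m (u i) e)).
exists w => s sw.
pose tau j := Fm j s - Z%:R * \sum_i ((F j).[u' i] + (F j).[u i]).
have uvJ : in_box r a uv.
  move=> i; rewrite mxE; have [h1 h2] := fr_u fr i; rewrite h1/=.
  by apply: le_trans h2; rewrite lerDl; have := l_gt0 fr i; exact: ltW.
have FmW j : Fm j w = N%:R * curve_sum F uv j + Z%:R * \sum_i ((F j).[u' i] + (F j).[u i]).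
  rewrite /w FmD !FmZ !Fmsum; congr (_ * _ + _ * _).
    by apply: eq_bigr => i _; rewrite mxE FmE.
  by apply: eq_bigr => i _; rewrite FmD !FmE.
have [xs [z [szx xT xsum]]] := cover T K a l u F fr oT T01' tau.
have tauN j : `|tau j - N%:R * curve_sum F uv j| <= q%:R * (K * R0).
  have -> : tau j - N%:R * curve_sum F uv j = \sum_(e < q) (F j)`_e.+1 * (s e - w e).
    under eq_bigr do rewrite mulrBr.
    by rewrite sumrB -/(Fm j s) -/(Fm j w) FmW /tau; ring.
  apply: le_trans (ler_norm_sum _ _ _) _.
  apply: (@le_trans _ _ (\sum_(e < q) K * R0)).
    by apply: ler_sum => e _; rewrite normrM ler_pM// (fr_coef fr).
  by rewrite sumr_const card_ord mulr_natl.
have gz j : `|g%:R * (z j)%:~R| <= bd.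
  have -> : g%:R * (z j)%:~R = (\sum_(y <- xs) (curve_sum F y j - curve_sum F uv j)) -
      (tau j - N%:R * curve_sum F uv j).
    rewrite sumrB xsum big_const_seq count_predT szx iter_addr_0 -mulr_natl; ring.
  apply: le_trans (ler_normB _ _) _; apply: lerD => //.
  apply: le_trans (ler_norm_sum _ _ _) _.
  apply: (@le_trans _ _ (\sum_(y <- xs) 5 / 4 * r / l0)).
    rewrite big_seq [leRHS]big_seq; apply: ler_sum => y /xT[yJ _].
    have h := curve_sum_dist fr q0 j yJ uvJ; exact h.
  by rewrite big_const_seq count_predT szx iter_addr_0 -[leLHS]mulr_natl.
have gzZ j : `|g%:Z * z j| <= Z%:Z.
  rewrite -(ler_int R) intr_norm intrM -!pmulrn; apply: ltW.
  exact: le_lt_trans (gz j) bdZ.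
(* Replacing one u_i + l_i by u_i lowers the sum of F_i by 1 and leaves those of the other F_j
   unchanged. Starting from Z copies of each point, g z_i replacements (reversed if negative) remove
   g z and keep 2 Z points per index. *)
pose np i := absz (Z%:Z - g%:Z * z i)%R.
pose nm i := absz (Z%:Z + g%:Z * z i)%R.
have npE i : (np i)%:R = Z%:R - g%:R * (z i)%:~R :> R.
  rewrite pmulrn abszE ger0_norm; first by rewrite intrB intrM -!pmulrn.
  by have := gzZ i; rewrite ler_norml subr_ge0 => /andP[].
have nmE i : (nm i)%:R = Z%:R + g%:R * (z i)%:~R :> R.
  rewrite pmulrn abszE ger0_norm; first by rewrite intrD intrM -!pmulrn.
  by have := gzZ i; rewrite ler_norml -subr_ge0 opprK addrC => /andP[].
have npm i : (np i + nm i = 2 * Z)%N.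
  apply/eqP; rewrite -(eqr_nat R) natrD npE nmE natrM; apply/eqP; ring.
pose t := flatten [seq [seq (y : 'rV[R]_q) 0 i | i <- enum 'I_q] | y <- xs] ++
  flatten [seq nseq (np i) (u' i) ++ nseq (nm i) (u i) | i <- enum 'I_q].
exists t; split.
- have szfl (I : Type) (d : seq I) (f : I -> seq R) k : (forall i, size (f i) = k) ->
      size (flatten (map f d)) = (size d * k)%N.
    by move=> fk; elim: d => //= i d IH; rewrite size_cat fk IH mulSn.
  rewrite size_cat (szfl _ xs _ q) => [|y]; last by rewrite size_map size_enum_ord.
  rewrite (szfl _ (enum 'I_q) _ (2 * Z)%N) => [|i]; last by rewrite size_cat !size_nseq.
  by rewrite szx size_enum_ord [(q * _)%N]mulnC.
- move=> x; rewrite mem_cat => /orP[/flattenP[d /mapP[y yxs ->] /mapP[i _ ->]]|].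
    by have [_] := xT y yxs.
  move=> /flattenP[d /mapP[i _ ->]]; have [h1 h2] := fr_uT fr i.
  by rewrite mem_cat => /orP[] /nseqP[-> _].
- apply: Fminj => j; rewrite (Fmsum _ t m).
  under eq_bigr do rewrite -FmE.
  rewrite big_cat !big_flatten/= [X in X + _]big_map [X in _ + X]big_map.
  have -> : \sum_(y <- xs) \sum_(x <- [seq (y : 'rV[R]_q) 0 i | i <- enum 'I_q]) (F j).[x] =
      \sum_(y <- xs) curve_sum F y j.
    by apply: eq_bigr => y _; rewrite big_map big_enum.
  rewrite xsum big_enum/=.
  have -> : \sum_i \sum_(x <- nseq (np i) (u' i) ++ nseq (nm i) (u i)) (F j).[x] =
      Z%:R * \sum_i ((F j).[u' i] + (F j).[u i]) - g%:R * (z j)%:~R.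
    have -> : g%:R * (z j)%:~R = \sum_i g%:R * (z i)%:~R * ((F j).[u' i] - (F j).[u i]).
      rewrite (bigD1 j)//= (fr_dual fr) eqxx mulr1 big1 ?addr0// => i ij.
      by rewrite (fr_dual fr) (negPf ij) mulr0.
    rewrite mulr_sumr -sumrB; apply: eq_bigr => i _.
    rewrite big_cat !big_nseq !iter_addr_0.
    have e1 : (F j).[u' i] *+ np i = (Z%:R - g%:R * (z i)%:~R) * (F j).[u' i] by rewrite -npE mulr_natl.
    have e2 : (F j).[u i] *+ nm i = (Z%:R + g%:R * (z i)%:~R) * (F j).[u i] by rewrite -nmE mulr_natl.
    by rewrite e1 e2 /=; ring.
  by rewrite /tau; ring.
Qed.

(** A frame for the interval (0, eps) gives base points at the midpoints of [u_i, u_i + l_i],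
    distinct since the intervals are disjoint. Around them [curve_sum_surj] takes the place of the
    inverse function theorem. *)
Lemma moment_map_open q (eps : R) : (0 < q)%N -> 0 < eps <= 1 ->
  exists t0 : 'rV[R]_q, [/\ forall i, 0 < t0 0 i < eps,
    forall i j, i != j -> t0 0 i != t0 0 j &
    forall rho, 0 < rho -> exists2 rho', 0 < rho' & forall s : 'I_q -> R,
      (forall e : 'I_q, `|s e - \sum_i t0 0 i ^+ e.+1| <= rho') ->
      exists t : 'rV[R]_q, `|t - t0| < rho /\ forall e : 'I_q, \sum_i t 0 i ^+ e.+1 = s e].
Proof.
move=> q0 /andP[eps0 eps1].
have [|r [l0 [K [b [r0 l00 K0 b0 frames]]]]] := @frame_exists R q eps q0; first by rewrite eps0.
have [] := frames `]0, eps[%classic.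
- exact: measurable_itv.
- move=> x /=; rewrite !in_itv/= => /andP[x0 xe]; rewrite ltW//=.
  exact: lt_le_trans eps1.
- by rewrite lebesgue_measure_itv/= lte_fin eps0 sube0.
move=> a [l [u [F fr]]].
pose t0 : 'rV[R]_q := \row_i (u i + l i / 2).
have tP i : [/\ a i <= t0 0 i - l0 / 2, t0 0 i + l0 / 2 <= a i + r & 0 < t0 0 i < eps].
  have [/= + +] := fr_uT fr i; rewrite !in_itv/= => /andP[u1 u2] /andP[u3 u4].
  have [h1 h2] := fr_u fr i; have /andP[h3 h4] := fr_l fr i.
  by rewrite mxE; clear -u1 u2 u3 u4 h1 h2 h3 h4 l00; split; [lra|lra|apply/andP; split; lra].
exists t0; split.
- by move=> i; have [] := tP i.
- move=> i j ij; apply/eqP => e; have := fr_disj fr ij.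
  have [h1 h2 _] := tP i; have [h3 h4 _] := tP j.
  rewrite ltNge => /negP; apply; rewrite ler_norml e in h1 h2 *.
  by clear -h1 h2 h3 h4 l00; apply/andP; split; lra.
move=> rho rho0; pose d := Num.min rho (l0 / 2).
have d0 : 0 < d by rewrite lt_min rho0/= divr_gt0.
have dl : d <= l0 / 2 by rewrite ge_min lexx orbT.
have qK : 0 < q%:R * K by rewrite mulr_gt0// ltr0n.
have dr : 0 < d / (2 * r) by apply: divr_gt0 => //; exact: mulr_gt0.
exists (d / (2 * r) / (q%:R * K)); first exact: divr_gt0.
move=> s hs; pose y j := \sum_(e < q) (F j)`_e.+1 * s e.
have [| |t [t1 t2]] := @curve_sum_surj R q _ _ _ _ _ _ _ _ _ fr q0 t0 d y d0.
- by move=> i; have [h1 h2 _] := tP i; clear -h1 h2 dl; split; lra.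
- move=> j; have -> : y j - curve_sum F t0 j =
      \sum_(e < q) (F j)`_e.+1 * (s e - \sum_i t0 0 i ^+ e.+1).
    rewrite /y /curve_sum; under [in RHS]eq_bigr do rewrite mulrBr mulr_sumr.
    rewrite sumrB exchange_big/=; congr (_ - _).
    by apply: eq_bigr => i _; rewrite (frame_hornerE fr).
  apply: le_trans (ler_norm_sum _ _ _) _.
  apply: (@le_trans _ _ (\sum_(e < q) K * (d / (2 * r) / (q%:R * K)))).
    by apply: ler_sum => e _; rewrite normrM ler_pM// (fr_coef fr).
  rewrite sumr_const card_ord -[leLHS]mulr_natl mulrA mulrC divfK//.
  exact: lt0r_neq0.
exists t; split; first by apply: lt_le_trans t1 _; rewrite ge_min lexx.
apply: (frame_coef_inj fr) => j; rewrite -/(y j) -t2 /curve_sum.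
under [in LHS]eq_bigr do rewrite mulr_sumr.
by rewrite exchange_big/=; apply: eq_bigr => i _; rewrite (frame_hornerE fr).
Qed.

End absorb.

(** * Monomials along the moment curve *)

Section base_digits.
Local Open Scope nat_scope.

Lemma digits_sum_lt (M d : nat) (f : nat -> nat) :
  (forall i, i < d -> f i < M) -> \sum_(i < d) f i * M ^ i < M ^ d.
Proof.
elim: d => [|d IH] fM; first by rewrite big_ord0.
rewrite big_ord_recr/= expnS.
have h1 := IH (fun i id => fM i (ltnW id)); have h2 := fM d (ltnSn d).
have : f d * M ^ d + M ^ d <= M * M ^ d by rewrite -mulSnr leq_mul2r h2 orbT.
by apply: leq_trans; rewrite addnC ltn_add2l.
Qed.

Lemma digits_sum_inj (M d : nat) (f g : nat -> nat) :
  (forall i, i < d -> f i < M) -> (forall i, i < d -> g i < M) ->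
  \sum_(i < d) f i * M ^ i = \sum_(i < d) g i * M ^ i -> forall i, i < d -> f i = g i.
Proof.
elim: d => [//|d IH] fM gM; rewrite !big_ord_recr/= => e.
have h1 := @digits_sum_lt M d f (fun i id => fM i (ltnW id)).
have h2 := @digits_sum_lt M d g (fun i id => gM i (ltnW id)).
have Md : 0 < M ^ d by apply: leq_ltn_trans h1.
have top : f d = g d.
  have := congr1 (fun n => n %/ M ^ d) e.
  by rewrite !divnDMl// !divn_small.
move=> i; rewrite ltnS leq_eqVlt => /orP[/eqP->//|].
apply: IH => [j jd|j jd|]; [exact/fM/ltnW|exact/gM/ltnW|].
by move/eqP: e; rewrite top eqn_add2r => /eqP.
Qed.

End base_digits.

Section monomials.
Variables (R : realType) (d m : nat).
Local Notation M := m.+1.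
Local Notation A := {ffun 'I_d -> 'I_M}.
Implicit Types (x y : 'rV[R]_d) (al be ga : A).

Definition mon al x : R := \prod_i x 0 i ^+ al i.

(* Along this curve the monomials become pairwise different powers of t: the
   exponent of t has the exponents of the monomial as its base M digits. *)
Definition mcurve (t : R) : 'rV[R]_d := \row_i t ^+ (M ^ i).
Definition mexp al : nat := (\sum_i al i * M ^ i)%N.

Lemma mon_mcurve al t : mon al (mcurve t) = t ^+ mexp al.
Proof.
rewrite /mexp expr_sum; apply: eq_bigr => i _.
by rewrite mxE mulnC exprM.
Qed.

Let digit al (i : nat) : nat := oapp (fun k => al k : nat) 0%N (insub i : option 'I_d).

Let digitE al (i : 'I_d) : digit al i = al i.
Proof. by rewrite /digit valK. Qed.

Let digit_lt al i : (digit al i < M)%N.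
Proof. by rewrite /digit; case: insub => //= k; exact: ltn_ord. Qed.

Lemma mexpE al : mexp al = (\sum_(i < d) digit al i * M ^ i)%N.
Proof. by apply: eq_bigr => i _; rewrite digitE. Qed.

Lemma mexp_lt al : (mexp al < M ^ d)%N.
Proof. by rewrite mexpE; apply: digits_sum_lt. Qed.

Lemma mexp_inj : injective mexp.
Proof.
move=> al be; rewrite !mexpE => e; apply/ffunP => i; apply/val_inj.
by rewrite /= -!digitE; apply: (digits_sum_inj _ _ e).
Qed.

Definition mon0 : A := [ffun=> ord0].

Lemma mexp_mon0 : mexp mon0 = 0%N.
Proof. by rewrite /mexp big1// => i _; rewrite ffunE. Qed.

Lemma mon0E x : mon mon0 x = 1.
Proof. by rewrite /mon big1// => i _; rewrite ffunE expr0. Qed.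

Definition mpoly1 (c : A -> R) : {poly R} := \sum_al c al *: 'X^(mexp al).

Lemma mpoly1_coef c al : (mpoly1 c)`_(mexp al) = c al.
Proof.
rewrite coef_sum (bigD1 al)//= coefZ coefXn eqxx mulr1 big1 ?addr0// => be ab.
by rewrite coefZ coefXn (inj_eq mexp_inj) eq_sym (negPf ab) mulr0.
Qed.

Lemma mpoly1_horner c t : (mpoly1 c).[t] = \sum_al c al * t ^+ mexp al.
Proof. by rewrite horner_sum; apply: eq_bigr => al _; rewrite !hornerE. Qed.

Lemma size_mpoly1 c : (size (mpoly1 c) <= M ^ d)%N.
Proof.
apply: (leq_trans (size_sum _ _ _)); apply/bigmax_leqP => al _.
by rewrite (leq_trans (size_scale_leq _ _))// size_polyXn mexp_lt.
Qed.

(** On the moment curve the combination becomes [mpoly1 c], which has the same coefficients and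
    vanishes at M^d points, more than its degree. *)
Lemma mon_free (c : A -> R) : (forall x, \sum_al c al * mon al x = 0) -> c =1 (fun=> 0).
Proof.
move=> h; suff p0 : mpoly1 c = 0 by move=> al; rewrite -mpoly1_coef p0 coef0.
apply: (@roots_geq_poly_eq0 _ _ (map (fun k : nat => k%:R) (iota 0 (M ^ d)))).
- apply/allP => _ /mapP[k _ ->]; apply/rootP; rewrite mpoly1_horner.
  by rewrite -[RHS](h (mcurve k%:R)); apply: eq_bigr => al _; rewrite mon_mcurve.
- by rewrite map_inj_uniq ?iota_uniq// => i j /eqP; rewrite eqr_nat => /eqP.
- by rewrite size_map size_iota size_mpoly1.
Qed.

(** Matrix of the substitution x -> x + y in the monomial basis. Bounding each exponent separately,
    not the total degree, lets the binomial expansion factor over the coordinates. *)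
Definition mshift y al be : R := \prod_i ('C(al i, be i)%:R * y 0 i ^+ (al i - be i)).

Lemma mon_add al x y : mon al (x + y) = \sum_be mshift y al be * mon be x.
Proof.
pose G (i : 'I_d) (b : 'I_M) : R := 'C(al i, b)%:R * y 0 i ^+ (al i - b) * x 0 i ^+ b.
transitivity (\prod_i \sum_b G i b).
  apply: eq_bigr => i _; have -> : (x + y) 0 i = y 0 i + x 0 i by rewrite mxE addrC.
  rewrite exprDn (@big_ord_widen _ _ _ _ M (fun b : nat => (y 0 i ^+ (al i - b) * x 0 i ^+ b) *+ 'C(al i, b)))//.
  rewrite [RHS](bigID (fun b : 'I_M => (b < (al i).+1)%N))/= [X in _ + X]big1 ?addr0.
    by apply: eq_bigr => b _; rewrite /G -mulr_natl mulrA.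
  by move=> b; rewrite -leqNgt => h; rewrite /G bin_small// !mul0r.
rewrite bigA_distr_bigA/=; apply: eq_bigr => be _.
by rewrite /mshift /mon -big_split.
Qed.

(** The translations by y and -y cancel; coefficients are compared by [mon_free]. *)
Lemma mshiftK y al ga : \sum_be mshift y al be * mshift (- y) be ga = (al == ga)%:R.
Proof.
apply/eqP; rewrite -subr_eq0; apply/eqP; move: ga; apply: mon_free => x.
under eq_bigr do rewrite mulrBl mulr_suml.
rewrite sumrB exchange_big/=.
have -> : \sum_be \sum_ga mshift y al be * mshift (- y) be ga * mon ga x = mon al x.
  rewrite -{2}(subrK y x) mon_add; apply: eq_bigr => be _.
  by rewrite mon_add mulr_sumr; apply: eq_bigr => ga _; rewrite mulrA.
rewrite (bigD1 al)//= eqxx mul1r big1 ?addr0 ?subrr// => ga ag.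
by rewrite eq_sym (negPf ag) mul0r.
Qed.

Lemma mshift_mon0 y be : mshift y mon0 be = (be == mon0)%:R.
Proof.
have [->|] := eqVneq be mon0.
  by rewrite /mshift big1// => i _; rewrite ffunE bin0 subn0 expr0 mulr1.
move=> bn; have [i bi] : exists i, be i != ord0.
  apply: contrapT => no; case/negP: bn; apply/eqP/ffunP => i; rewrite ffunE.
  by apply: contrapT => bi; apply: no; exists i; apply/eqP.
rewrite /mshift (bigD1 i)//= ffunE bin_small ?mul0r//.
by rewrite lt0n; apply: contra bi => /eqP h; apply/eqP/val_inj.
Qed.

(** Per coordinate, 2^M bounds the binomial and 3^M the power of y, for y in the cube of radius
    3. *)
Definition mshift_bound : R := (2 ^+ M * 3 ^+ M) ^+ d.

Lemma mshift_bound_gt0 : 0 < mshift_bound.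
Proof. by rewrite exprn_gt0// mulr_gt0// exprn_gt0. Qed.

Lemma mshift_le y al be : (forall i, `|y 0 i| <= 3) -> `|mshift y al be| <= mshift_bound.
Proof.
move=> y3; rewrite normr_prod /mshift_bound -[d in X in _ <= X]card_ord -prodr_const.
apply: ler_prod => i _; rewrite normr_ge0/= normrM normr_nat normrX ler_pM ?exprn_ge0//.
  rewrite -natrX ler_nat; apply: leq_trans (_ : 2 ^ al i <= _)%N; last first.
    by rewrite leq_exp2l// ltnW.
  have [h|h] := leqP (be i) (al i); last by rewrite bin_small.
  have := Pascal 1 1 (al i).
  rewrite addn1 => ->.
  under eq_bigr do rewrite !exp1n !muln1.
  have hb : (be i < (al i).+1)%N by [].
  by rewrite (bigD1 (Ordinal hb))//= leq_addr.
apply: (@le_trans _ _ (3 ^+ (al i - be i))).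
  by apply: lerXn2r; rewrite ?nnegrE.
by rewrite ler_eXn2l ?ltr1n// (leq_trans (leq_subr _ _))// ltnW.
Qed.

Lemma sum_mshift_le y (c : A -> R) (e : R) al : (forall i, `|y 0 i| <= 3) ->
  (forall be, `|c be| <= e) ->
  `|\sum_be mshift y al be * c be| <= #|{: A}|%:R * (mshift_bound * e).
Proof.
move=> y3 ce; apply: le_trans (ler_norm_sum _ _ _) _.
apply: (@le_trans _ _ (\sum_(be : A) mshift_bound * e)).
  by apply: ler_sum => be _; rewrite normrM ler_pM// mshift_le.
by rewrite sumr_const -[leLHS]mulr_natl.
Qed.

End monomials.

(** * Translates of the moment curve *)

Section slices.
Variables (R : realType) (d m : nat).
Let mu := @lebesgue_measure R.
Local Notation M := m.+1.
Local Notation A := {ffun 'I_d -> 'I_M}.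

Lemma continuous_rV (T : topologicalType) (q : nat) (f : T -> 'rV[R]_q) (x : T) :
  (forall j, {for x, continuous (fun t => f t 0 j)}) -> {for x, continuous f}.
Proof.
move=> h; apply/cvgrPdist_lt => e e0.
have : \forall t \near x, forall j, `|f x 0 j - f t 0 j| <= e / 2.
  apply: filter_forall => j; have /cvgrPdist_le := h j; apply; exact: divr_gt0.
apply: filterS => t ht; apply: (@le_lt_trans _ _ (e / 2)); last by lra.
by apply/rV_norm_leP => [|j]; [rewrite divr_ge0// ltW|rewrite !mxE].
Qed.

Lemma continuous_mcurve (y : 'rV[R]_d) : continuous (fun t : R => y + mcurve d m t).
Proof.
move=> t; apply: continuous_rV => j.
rewrite (_ : (fun _ => _) = (fun t : R => y 0 j + t ^+ (M ^ j))); last first.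
  by apply/funext => s; rewrite !mxE.
by apply: continuousD; [exact: cst_continuous|exact: exprn_continuous].
Qed.

Definition slice (S : set 'rV[R]_d) (y : 'rV[R]_d) : set (measurableTypeR R) :=
  [set t : R | `]0, 1[%classic t /\ S (y + mcurve d m t)].

Lemma slice_open S y : open S -> open (slice S y : set R).
Proof.
move=> oS; apply: openI; first exact: interval_open.
by apply: open_comp => // t _; exact: continuous_mcurve.
Qed.

Lemma slice_sub S y : slice S y `<=` `[0, 1[.
Proof. by move=> t [/=]; rewrite !in_itv/= => /andP[/ltW-> ->]. Qed.

(** Prescribing monomial sums on the curve translated by y amounts to prescribing power sums of the
    parameters, after applying the inverse matrix [mshift (- y)] to the target. *)
Lemma mon_curve_sum y (s : A -> R) (t : seq R) :
  (forall be, \sum_(x <- t) x ^+ mexp be = \sum_ga mshift (- y) be ga * s ga) ->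
  forall al, \sum_(x <- t) mon al (y + mcurve d m x) = s al.
Proof.
move=> h al; under eq_bigr do rewrite addrC mon_add.
rewrite exchange_big/=; under eq_bigr do rewrite -mulr_sumr.
have -> : \sum_be mshift y al be * \sum_(x <- t) mon be (mcurve d m x) =
    \sum_be \sum_ga mshift y al be * mshift (- y) be ga * s ga.
  apply: eq_bigr => be _; under eq_bigr do rewrite mon_mcurve.
  by rewrite h mulr_sumr; apply: eq_bigr => ga _; rewrite mulrA.
rewrite exchange_big/=; under eq_bigr do rewrite -mulr_suml mshiftK.
by rewrite (bigD1 al)//= eqxx mul1r big1 ?addr0// => ga ag; rewrite eq_sym (negPf ag) mul0r.
Qed.

(* On a slice the monomials become distinct powers of t: this is the Remez-type
   inequality [coef_le_sum_separated] in one variable. *)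
Lemma mon_coef_bound (c : R) : 0 < c -> exists2 K : R, 0 < K &
  forall (S : set 'rV[R]_d) y (p : A -> R) (e : R),
    measurable (slice S y) -> (c%:E <= mu (slice S y))%E -> (forall i, `|y 0 i| <= 3) ->
    (forall x, S x -> `|\sum_al p al * mon al x| <= e) -> forall al, `|p al| <= K * e.
Proof.
move=> c0; pose n := (M ^ d)%N.
have n0 : 0 < n%:R :> R by rewrite ltr0n expn_gt0.
pose sg := Num.min 1 (c / (4 * n%:R)).
have sg0 : 0 < sg by rewrite lt_min ltr01/= divr_gt0// mulr_gt0.
pose K1 := (2 / sg) ^+ n * n%:R.
have K10 : 0 < K1 by rewrite mulr_gt0// exprn_gt0// divr_gt0.
have A0 : 0 < #|{: A}|%:R :> R by rewrite ltr0n; apply/card_gt0P; exists (mon0 d m).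
exists (#|{: A}|%:R * (mshift_bound R d m * K1)).
  by apply: mulr_gt0 => //; apply: mulr_gt0 => //; exact: mshift_bound_gt0.
move=> S y p e mT cT y3 pe al.
have [| |t [tT tsep]] := @separated_points R n sg (slice S y) mT.
- exact: ltW.
- apply: lt_le_trans cT; rewrite lte_fin.
  have : n%:R * (2 * sg) <= n%:R * (2 * (c / (4 * n%:R))).
    by rewrite ler_pM2l// ler_pM2l// ge_min lexx orbT.
  have -> : n%:R * (2 * (c / (4 * n%:R))) = c / 2 by field; exact: lt0r_neq0.
  by clear -c0 => ?; lra.
(* Coefficients along the translated curve, where the one-variable inequality applies; [mshiftK]
   recovers p from them. *)
pose p' be := \sum_al p al * mshift y al be.
have p'E x : \sum_al p al * mon al (y + mcurve d m x) = (mpoly1 p').[x].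
  rewrite mpoly1_horner; under eq_bigr do rewrite addrC mon_add mulr_sumr.
  rewrite exchange_big/=; apply: eq_bigr => be _; rewrite mulr_suml.
  by apply: eq_bigr => ga _; rewrite mon_mcurve mulrA.
have p'le be : `|p' be| <= K1 * e.
  have := @coef_le_sum_separated R n t sg (mpoly1 p') (mexp be).
  rewrite mpoly1_coef => h; apply: le_trans (h _ _ _ _) _.
  - by rewrite sg0 ge_min lexx.
  - move=> i; have [/=] := tT i; rewrite in_itv/= => /andP[h1 h2] _.
    by rewrite ger0_norm ltW.
  - exact: tsep.
  - exact: size_mpoly1.
  rewrite -mulrA ler_wpM2l//; first by rewrite exprn_ge0// divr_ge0// ltW.
  rewrite mulr_natl -[n in X in _ <= X]card_ord -sumr_const; apply: ler_sum => i _.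
  by rewrite -p'E; apply: pe; have [] := tT i.
have -> : p al = \sum_be p' be * mshift (- y) be al.
  rewrite /p'; under eq_bigr do rewrite mulr_suml.
  rewrite exchange_big/=; under eq_bigr do under eq_bigr do rewrite -mulrA.
  under eq_bigr do rewrite -mulr_sumr mshiftK.
  by rewrite (bigD1 al)//= eqxx mulr1 big1 ?addr0// => ga ag; rewrite (negPf ag) mulr0.
apply: le_trans (ler_norm_sum _ _ _) _.
apply: (@le_trans _ _ (\sum_(be : A) mshift_bound R d m * K1 * e)).
  apply: ler_sum => be _; rewrite normrM mulrC -mulrA ler_pM// mshift_le// => i.
  by rewrite mxE normrN.
by rewrite sumr_const -[leLHS]mulr_natl mulrA.
Qed.

Hypothesis m0 : (0 < m)%N.
Hypothesis d0 : (0 < d)%N.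

(** Exponent 0 is set apart: its power sum only counts the points. *)
Let q := (M ^ d).-1.
Let q0 : (0 < q)%N.
Proof.
rewrite /q -ltnS prednK ?expn_gt0//; apply: leq_trans (_ : 2 ^ 1 <= _)%N => //.
by apply: leq_trans (_ : 2 ^ d <= _)%N; [rewrite leq_exp2l|rewrite leq_exp2r].
Qed.

(* s indexed by monomials, s' by the exponents 1 .. q of t *)
Let to_exp (s : A -> R) (s0 : 'I_q -> R) (e : 'I_q) : R :=
  if [pick al : A | mexp al == e.+1] is Some al then s al else s0 e.

Let to_expP s s0 (al : A) (e : 'I_q) : mexp al = e.+1 -> to_exp s s0 e = s al.
Proof.
move=> h; rewrite /to_exp; case: pickP => [be /eqP hb|/(_ al)]; last by rewrite h eqxx.
by congr (s _); apply: (@mexp_inj d m); rewrite hb.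
Qed.

Let mexp_cases (al : A) : al = mon0 d m \/ exists e : 'I_q, mexp al = e.+1.
Proof.
case e : (mexp al) => [|k]; first by left; apply: (@mexp_inj d m); rewrite e mexp_mon0.
right; have kq : (k < q)%N by rewrite /q -ltnS prednK ?expn_gt0// -e mexp_lt.
by exists (Ordinal kq).
Qed.

(** [moment_curve_box] read through the invertible matrix [mshift]: in power sums, a monomial box of
    radius [R0] lies in a box of radius [R1]. The coordinate of the constant monomial is pinned to
    k, the number of points. *)
Lemma mon_box (c R0 : R) : 0 < c <= 1 -> 0 <= R0 ->
  exists k : nat, forall (S : set 'rV[R]_d) y, open S ->
    (c%:E <= mu (slice S y))%E -> (forall i, `|y 0 i| <= 3) ->
    exists w : A -> R, w (mon0 d m) = k%:R /\ forall s : A -> R, s (mon0 d m) = k%:R ->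
      (forall al, `|s al - w al| <= R0) ->
      exists x : seq 'rV[R]_d, [/\ size x = k, forall z, z \in x -> S z &
        forall al, \sum_(z <- x) mon al z = s al].
Proof.
move=> c01 R00; pose R1 := #|{: A}|%:R * (mshift_bound R d m * R0).
have R10 : 0 <= R1 by apply: mulr_ge0 => //; apply: mulr_ge0 => //; apply/ltW/mshift_bound_gt0.
have [k kP] := moment_curve_box q0 c01 R10.
exists k => S y oS cS y3.
have [w1 w1P] := kP _ (@slice_open S y oS) (@slice_sub S y) cS.
pose wh (be : A) : R := if be == mon0 d m then k%:R else
  if [pick e : 'I_q | mexp be == e.+1] is Some e then w1 e else 0.
have whE (be : A) (e : 'I_q) : mexp be = e.+1 -> wh be = w1 e.
  move=> h; rewrite /wh; case: eqP => [b0|_]; first by rewrite b0 mexp_mon0 in h.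
  case: pickP => [e' /eqP h'|/(_ e)]; last by rewrite h eqxx.
  by congr w1; apply/val_inj/succn_inj; rewrite -h -h'.
exists (fun al => \sum_be mshift y al be * wh be); split.
  rewrite (bigD1 (mon0 d m))//= mshift_mon0 eqxx mul1r big1 ?addr0 ?/wh ?eqxx// => be bn.
  by rewrite mshift_mon0 (negPf bn) mul0r.
move=> s s0 sw; pose sh be := \sum_ga mshift (- y) be ga * s ga.
have sh0 : sh (mon0 d m) = k%:R.
  rewrite /sh (bigD1 (mon0 d m))//= mshift_mon0 eqxx mul1r big1 ?addr0// => be bn.
  by rewrite mshift_mon0 (negPf bn) mul0r.
have shw be : `|sh be - wh be| <= R1.
  have -> : sh be - wh be = \sum_ga mshift (- y) be ga *
      (s ga - \sum_al mshift y ga al * wh al).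
    under [in RHS]eq_bigr do rewrite mulrBr mulr_sumr.
    rewrite sumrB; congr (_ - _); rewrite exchange_big/=.
    have := mshiftK (- y) be; rewrite opprK => hK.
    under [in RHS]eq_bigr do under eq_bigr do rewrite mulrA.
    under [in RHS]eq_bigr do rewrite -mulr_suml hK.
    by rewrite (bigD1 be)//= eqxx mul1r big1 ?addr0// => ga bg; rewrite eq_sym (negPf bg) mul0r.
  by apply: sum_mshift_le => // i; rewrite mxE normrN.
have [e|t [st tT ts]] := w1P (to_exp sh w1).
  rewrite {1}/to_exp; case: pickP => [al /eqP h|_]; last by rewrite subrr normr0.
  by rewrite -(whE _ _ h).
exists [seq y + mcurve d m x | x <- t]; split.
- by rewrite size_map.
- by move=> _ /mapP[x /tT[_ Sx] ->].
- move=> al; rewrite big_map; apply: mon_curve_sum => be; rewrite -/(sh be).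
  have [->|[e h]] := mexp_cases be.
    rewrite mexp_mon0 sh0; under eq_bigr do rewrite expr0.
    by rewrite big_const_seq count_predT iter_addr_0 st.
  by rewrite h ts (to_expP _ _ h).
Qed.

(** The same transport as in [mon_box], now for [moment_map_open]; the admissible error shrinks by
    the norm bound of [mshift]. *)
Lemma mon_open (y : 'rV[R]_d) (eps : R) : 0 < eps <= 1 -> (forall i, `|y 0 i| <= 3) ->
  exists t0 : 'rV[R]_q, [/\ forall i, 0 < t0 0 i < eps,
    forall i j, i != j -> t0 0 i != t0 0 j &
    forall rho, 0 < rho -> exists2 rho', 0 < rho' & forall s : A -> R,
      s (mon0 d m) = q%:R ->
      (forall al, `|s al - \sum_i mon al (y + mcurve d m (t0 0 i))| <= rho') ->
      exists t : 'rV[R]_q, `|t - t0| < rho /\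
        forall al, \sum_i mon al (y + mcurve d m (t 0 i)) = s al].
Proof.
move=> eps01 y3; have [t0 [t0eps t0inj t0P]] := moment_map_open q0 eps01.
exists t0; split=> // rho rho0; have [r r0 rP] := t0P rho rho0.
have A0 : 0 < #|{: A}|%:R :> R by rewrite ltr0n; apply/card_gt0P; exists (mon0 d m).
have B0 := mshift_bound_gt0 R d m.
exists (r / (#|{: A}|%:R * mshift_bound R d m)); first by apply: divr_gt0 => //; exact: mulr_gt0.
move=> s s0 hs; pose sh be := \sum_ga mshift (- y) be ga * s ga.
have sh0 : sh (mon0 d m) = q%:R.
  rewrite /sh (bigD1 (mon0 d m))//= mshift_mon0 eqxx mul1r big1 ?addr0// => be bn.
  by rewrite mshift_mon0 (negPf bn) mul0r.
have shr be : `|sh be - \sum_i t0 0 i ^+ mexp be| <= r.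
  have -> : sh be - \sum_i t0 0 i ^+ mexp be = \sum_ga mshift (- y) be ga *
      (s ga - \sum_i mon ga (y + mcurve d m (t0 0 i))).
    under [in RHS]eq_bigr do rewrite mulrBr mulr_sumr.
    rewrite sumrB; congr (_ - _); rewrite exchange_big/=; apply: eq_bigr => i _.
    by rewrite -mon_mcurve -[in LHS](addKr y (mcurve d m _)) addrC mon_add.
  have := @sum_mshift_le R d m (- y) _ _ be _ hs.
  have -> : #|{: A}|%:R * (mshift_bound R d m * (r / (#|{: A}|%:R * mshift_bound R d m))) = r.
    by field; rewrite ?(lt0r_neq0 A0) ?(lt0r_neq0 B0).
  by apply=> i; rewrite mxE normrN.
have [e|t [tt0 ts]] := rP (to_exp sh (fun e => \sum_i t0 0 i ^+ e.+1)).
  rewrite {1}/to_exp; case: pickP => [al /eqP h|_]; last by rewrite subrr normr0 ltW.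
  by rewrite -h.
exists t; split=> // al.
transitivity (\sum_(x <- [seq t 0 i | i <- enum 'I_q]) mon al (y + mcurve d m x)).
  by rewrite big_map big_enum.
apply: mon_curve_sum => be; rewrite big_map big_enum/= -/(sh be).
have [->|[e h]] := mexp_cases be.
  rewrite mexp_mon0 sh0; under eq_bigr do rewrite expr0.
  by rewrite sumr_const card_ord.
by rewrite h ts (to_expP _ _ h).
Qed.

End slices.

(** * Slices of large measure *)

Section slicing.
Variables (R : realType) (d m : nat).
Let lam := @lebesgue_measure R.
Local Notation M := m.+1.
Variable nu : {sigma_finite_measure set (rVborel R d) -> \bar R}.
Hypothesis nu_transl : forall (A : set (rVborel R d)) (v : 'rV[R]_d), measurable A ->
  nu [set x : rVborel R d | A ((x : 'rV[R]_d) + v)] = nu A.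

Definition cube (a : R) : set (rVborel R d) := [set v : 'rV[R]_d | forall i, `|v 0 i| <= a].

Lemma measurable_cube a : measurable (cube a).
Proof.
have := @measurable_rV_setX R d (fun=> `[- a, a]%classic) (fun=> measurable_itv _).
rewrite (_ : mkset _ = cube a)//; apply/seteqP; split=> v h i.
  by have /= := h i; rewrite in_itv/= -ler_norml.
by have := h i; rewrite ler_norml /= in_itv.
Qed.

Lemma measurable_curve_pair : measurable_fun [set: measurableTypeR R * rVborel R d]
  (fun z : measurableTypeR R * rVborel R d => ((z.2 : 'rV[R]_d) + mcurve d m z.1) : rVborel R d).
Proof.
apply: measurable_fun_rVP => j.
rewrite (_ : (fun _ => _) = (fun z : measurableTypeR R * rVborel R d =>
    ((z.2 : 'rV[R]_d) ord0 j) + (z.1 : R) ^+ (M ^ j))); last first.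
  by apply/funext => z; rewrite !mxE.
apply: measurable_realfun.measurable_funD.
  by apply: (measurableT_comp (measurable_coord_rV (R := R) j)).
apply: (@measurableT_comp _ _ _ _ _ _ (fun t : measurableTypeR R => (t : R) ^+ (M ^ j)) _ fst) => //.
Qed.

Let inslice (S : set (rVborel R d)) : set (measurableTypeR R * rVborel R d) :=
  [set z | [/\ `]0, 1[%classic z.1, cube 3 z.2 & S ((z.2 : 'rV[R]_d) + mcurve d m z.1)]].

Let measurable_inslice S : measurable S -> measurable (inslice S).
Proof.
move=> mS; rewrite (_ : inslice S = (`]0, 1[%classic `*` cube 3) `&`
    ((fun z : measurableTypeR R * rVborel R d => ((z.2 : 'rV[R]_d) + mcurve d m z.1) : rVborel R d) @^-1` S)).
  apply: measurableI.
    by apply: measurableX; [exact: measurable_itv|exact: measurable_cube].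
  by rewrite -[X in measurable X]setTI; apply: measurable_curve_pair.
by apply/seteqP; split=> [z [? ? ?]|z [[? ?] ?]]; split.
Qed.

Lemma measurable_slice (S : set (rVborel R d)) y : measurable S -> measurable (slice m (S : set 'rV[R]_d) y).
Proof.
move=> mS; have mf : measurable_fun [set: measurableTypeR R]
    (fun t : measurableTypeR R => (y + mcurve d m t) : rVborel R d).
  exact: (measurableT_comp measurable_curve_pair (measurable_pair2 (y : rVborel R d))).
apply: measurableI; first exact: measurable_itv.
by rewrite -[X in measurable X]setTI; apply: mf.
Qed.

(** Fubini: for t in (0, 1) the curve has coordinates in [0, 1], so the y with y + mcurve t in S, S
    in the cube of radius 2, all lie in the cube of radius 3 and form a full translate of S. The
    mean length of the slices is thus at least [kap]. *)
Lemma exists_slice (S : set (rVborel R d)) (kap : R) : 0 < kap ->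
  measurable S -> S `<=` cube 2 -> (nu (cube 3) < +oo)%E -> (0 < nu (cube 3))%E ->
  (kap%:E * nu (cube 3) <= nu S)%E ->
  exists2 y : 'rV[R]_d, cube 3 y & ((kap / 2)%:E <= lam (slice m (S : set 'rV[R]_d) y))%E.
Proof.
move=> kap0 mS S2 fin3 pos3 hS.
apply: contrapT => no.
have mE := measurable_inslice mS.
have := indic_fubini_tonelli (@lebesgue_measure R) nu mE.
rewrite indic_fubini_tonelli_FE// indic_fubini_tonelli_GE// => fub.
have LHS : (\int[lam]_x (nu \o xsection (inslice S)) x = nu S)%E.
  rewrite (_ : nu \o xsection (inslice S) = (cst (nu S)) \_ `]0, 1[%classic).
    rewrite -integral_mkcond integral_cst//.
    transitivity (nu S * 1)%E; last by rewrite mule1.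
    by congr (_ * _)%E; rewrite /= lebesgue_measure_itv/= lte_fin ltr01 sube0.
  apply/funext => t; rewrite patchE /=; case: ifPn => [|].
    rewrite inE /= in_itv/= => /andP[t0 t1].
    rewrite -(nu_transl (mcurve d m t) mS); congr (nu _); apply/seteqP; split=> y.
      by rewrite xsectionE/= => -[_ _].
    rewrite xsectionE /= => Sy; split=> //=; first by rewrite in_itv/= t0.
    move=> i; have /(_ i) := S2 _ Sy; rewrite !mxE => h.
    have p1 : 0 <= t ^+ (M ^ i) <= 1 by rewrite exprn_ge0 ?exprn_ile1// ltW.
    case/andP: p1; move: h; rewrite !ler_norml => /andP[h1 h2] p1 p2.
    by clear -h1 h2 p1 p2; apply/andP; split; lra.
  rewrite notin_setE /= => nt; rewrite (_ : xsection _ _ = set0) ?measure0//.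
  by apply/seteqP; split=> y //; rewrite xsectionE /= => -[].
have RHS : (\int[nu]_y (lam \o ysection (inslice S)) y <= (kap / 2)%:E * nu (cube 3))%E.
  rewrite -integral_cst; last exact: measurable_cube.
  have -> : lam \o ysection (inslice S) = (lam \o ysection (inslice S)) \_ (cube 3).
    apply/funext => y; rewrite patchE; case: ifPn => //; rewrite notin_setE => ny.
    rewrite /= (_ : ysection _ _ = set0); first by rewrite /lam measure0.
    by apply/seteqP; split=> t //; rewrite ysectionE /= => -[].
  rewrite -integral_mkcond; apply: ge0_le_integral => //.
  - exact: measurable_cube.
  - by apply: measurable_funTS; apply: measurable_fun_ysection.
  move=> y y3 /=; rewrite leNgt; apply/negP => h; apply: no; exists y => //.
  rewrite ltW//; apply: lt_le_trans h _; apply: le_measure; rewrite ?inE.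
  + exact: measurable_ysection.
  + exact: measurable_slice.
  + by move=> t; rewrite ysectionE /= => -[].
have cfin : nu (cube 3) \is a fin_num by rewrite ge0_fin_numE.
move: pos3 hS RHS; rewrite -fub LHS -(fineK cfin) lte_fin -!EFinM => p3 h1 h2.
have := le_trans h1 h2; rewrite lee_fin ler_pM2r// => h.
by lra.
Qed.

End slicing.

Lemma Rintegral_sum d (T : measurableType d) (R : realType) (mu : {measure set T -> \bar R})
    (D : set T) (I : Type) (s : seq I) (f : I -> T -> R) : measurable D ->
  (forall i, mu.-integrable D (EFin \o f i)) ->
  mu.-integrable D (EFin \o (fun x => \sum_(i <- s) f i x)) /\
  \int[mu]_(x in D) (\sum_(i <- s) f i x) = \sum_(i <- s) \int[mu]_(x in D) f i x.
Proof.
move=> mD fi; elim: s => [|i s [IH1 IH2]].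
  rewrite big_nil; split.
    rewrite (_ : EFin \o _ = cst 0%E); first exact: integrable0.
    by apply/funext => x; rewrite /= big_nil.
  under eq_Rintegral do rewrite big_nil.
  by rewrite /Rintegral integral0.
split.
  rewrite (_ : EFin \o _ = (EFin \o f i) \+ (EFin \o (fun x => \sum_(i <- s) f i x))).
    exact: integrableD.
  by apply/funext => x; rewrite /= big_cons EFinD.
rewrite big_cons -IH2 -RintegralD//.
by under eq_Rintegral do rewrite big_cons.
Qed.

Lemma integrable_cst d (T : measurableType d) (R : realType) (mu : {measure set T -> \bar R})
    (D : set T) (c : R) : measurable D -> (mu D < +oo)%E -> mu.-integrable D (EFin \o (fun=> c)).
Proof.
move=> mD fD; apply: measurable_bounded_integrable => //.
by exists `|c|; split; [rewrite num_real|move=> y hy x _ /=; exact: ltW].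
Qed.

(* Markov's inequality for the function Q + h, which has mean h. *)
Lemma mean0_half d (T : measurableType d) (R : realType) (mu : {measure set T -> \bar R})
    (B S : set T) (Q : T -> R) (h : R) :
  measurable B -> measurable S -> S `<=` B -> mu (B `\` S) = 0%E -> (mu B < +oo)%E ->
  measurable_fun [set: T] Q -> mu.-integrable B (EFin \o Q) ->
  \int[mu]_(x in B) Q x = 0 -> 0 < h -> (forall x, S x -> - h <= Q x) ->
  measurable (S `&` [set x | `|Q x| <= h]) /\
  (2^-1%:E * mu B <= mu (S `&` [set x | (`|Q x| <= h)%R]))%E.
Proof.
move=> mB mS SB nBS finB mQ iQ Q0 h0 hQ.
pose D := S `&` [set x | h <= Q x].
pose E := S `&` [set x | `|Q x| <= h].
have mD : measurable D.
  apply: measurableI => //; rewrite -[X in measurable X]setTI.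
  rewrite (_ : [set x | h <= Q x] = Q @^-1` `[h, +oo[%classic); first exact: mQ.
  by apply/seteqP; split=> x /=; rewrite in_itv/= andbT.
have mE : measurable E.
  apply: measurableI => //; rewrite -[X in measurable X]setTI.
  rewrite (_ : [set x | `|Q x| <= h] = Q @^-1` `[- h, h]%classic); first exact: mQ.
  by apply/seteqP; split=> x /=; rewrite in_itv/= ler_norml.
split=> //.
pose f x := Q x + h.
have ih : mu.-integrable B (EFin \o (fun=> h)).
  exact: integrable_cst.
have iF : mu.-integrable B (EFin \o f).
  by rewrite (_ : EFin \o f = (EFin \o Q) \+ (EFin \o (fun=> h)))//; exact: integrableD.
have finBn : mu B \is a fin_num by rewrite ge0_fin_numE.
have intf : (\int[mu]_(x in B) (f x)%:E = h%:E * mu B)%E.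
  rewrite -[LHS]fineK; last exact: integrable_fin_num.
  have -> : fine (\int[mu]_(x in B) (f x)%:E) = \int[mu]_(x in B) f x by [].
  rewrite RintegralD// Q0 add0r Rintegral_cst// EFinM fineK//.
have mf : measurable_fun [set: T] (EFin \o f).
  by apply/measurable_EFinP; exact: measurable_funD.
have fS x : S x -> (0 <= (f x)%:E)%E.
  by move=> /hQ; rewrite lee_fin /f; lra.
have BS : B `\` (B `\` S) = S by rewrite setDD setIC; exact/setIidPl.
(* [f] is known to be nonnegative only on S, so the null set outside S is removed before restricting
   to D, where f >= 2 h. *)
have le1 : (\int[mu]_(x in D) (f x)%:E <= h%:E * mu B)%E.
  rewrite -intf (@negligible_integral _ _ _ mu B (B `\` S))//; last exact: measurableD.
  rewrite BS; apply: ge0_subset_integral => //.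
    exact: measurable_funTS.
  by move=> x [].
have le2 : ((2 * h)%:E * mu D <= \int[mu]_(x in D) (f x)%:E)%E.
  rewrite -integral_cst//; apply: ge0_le_integral => //.
  - by move=> x _; rewrite lee_fin mulr_ge0// ltW.
  - exact: measurable_funTS.
  - by move=> x [_ /= hx]; rewrite lee_fin /f; lra.
have mBS : measurable (B `\` S) by exact: measurableD.
have le3 : (mu B <= mu D + mu E)%E.
  apply: (@le_trans _ _ (mu ((D `|` E) `|` (B `\` S)))).
    apply: le_measure; rewrite ?inE//; first by apply: measurableU => //; exact: measurableU.
    move=> x Bx; have [Sx|Sx] := pselect (S x); last by right.
    left; have [hx|hx] := leP h (Q x); [by left|right; split=> //=].
    by rewrite ler_norml hQ// ltW.
  rewrite -[leRHS]adde0 -nBS; apply: le_trans; first by apply: measureU2 => //; exact: measurableU.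
  by rewrite leeD2r//; exact: measureU2.
have finD : mu D \is a fin_num.
  rewrite ge0_fin_numE//; apply: le_lt_trans finB; apply: le_measure; rewrite ?inE//.
  by move=> x [/SB].
have finE : mu E \is a fin_num.
  rewrite ge0_fin_numE//; apply: le_lt_trans finB; apply: le_measure; rewrite ?inE//.
  by move=> x [/SB].
move: le3 (le_trans le2 le1); rewrite -/E -(fineK finBn) -(fineK finD) -(fineK finE).
rewrite -EFinD -!EFinM !lee_fin; move: (fine (mu B)) (fine (mu D)) (fine (mu E)) => b dd e h1 h2.
have : 2 * dd <= b by rewrite -(ler_pM2l h0) mulrA [h * 2]mulrC.
lra.
Qed.

(** * Points decreasing the error *)

Section greedy.
Variables (R : realType) (d m : nat).
Local Notation M := m.+1.
Local Notation A := {ffun 'I_d -> 'I_M}.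

(** [nu] stands for Lebesgue measure in affine coordinates, whose scaling factor is left
    unspecified: only the ratio [kap] is quantitative. The cube of radius 3 leaves room for
    translating the one of radius 2 by points of the moment curve. *)
Record normalized (kap : R) (nu : {sigma_finite_measure set (rVborel R d) -> \bar R})
    (B : set (rVborel R d)) : Prop := Normalized {
  nz_transl : forall (A : set (rVborel R d)) (v : 'rV[R]_d), measurable A ->
    nu [set x : rVborel R d | A ((x : 'rV[R]_d) + v)] = nu A ;
  nz_set1 : forall v : rVborel R d, nu [set v] = 0%E ;
  nz_fin : (nu (cube (R := R) (d := d) 3) < +oo)%E ;
  nz_meas : measurable B ;
  nz_gt0 : (0 < nu B)%E ;
  nz_sub : B `<=` cube (R := R) (d := d) 2 ;
  nz_dens : (kap%:E * nu (cube (R := R) (d := d) 3) <= nu B)%E }.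

Definition moment (nu : {sigma_finite_measure set (rVborel R d) -> \bar R})
    (B : set (rVborel R d)) (al : A) : R :=
  (fine (nu B))^-1 * \int[nu]_(x in B) mon al (x : 'rV[R]_d).

Lemma measurable_mon (al : A) :
  measurable_fun [set: rVborel R d] (fun x : rVborel R d => mon al (x : 'rV[R]_d)).
Proof.
rewrite /mon; elim: (index_enum _) => [|i s IH].
  by under eq_fun do rewrite big_nil; exact: measurable_cst.
under eq_fun do rewrite big_cons.
apply: measurable_funM => //; apply: measurable_funX; exact: measurable_coord_rV.
Qed.

Lemma mon_le (a : R) (al : A) (x : 'rV[R]_d) : 1 <= a -> cube a x -> `|mon al x| <= a ^+ (M * d).
Proof.
move=> a1 xa; rewrite normr_prod exprM -[d in X in _ <= X]card_ord -prodr_const.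
apply: ler_prod => i _; rewrite normr_ge0/= normrX.
apply: (@le_trans _ _ (a ^+ al i)).
  have a0 : 0 <= a by apply: le_trans a1.
  by apply: lerXn2r; rewrite ?nnegrE//; exact: xa.
by apply: ler_weXn2l => //; exact: ltnW.
Qed.

Section with_nu.
Variables (kap : R) (nu : {sigma_finite_measure set (rVborel R d) -> \bar R}).
Variable B : set (rVborel R d).
Hypothesis nz : normalized kap nu B.

Lemma nz_finB : (nu B < +oo)%E.
Proof.
apply: le_lt_trans (nz_fin nz); apply: le_measure; rewrite ?inE.
- exact: nz_meas nz.
- exact: measurable_cube.
- by move=> x /(nz_sub nz) h i; apply: le_trans (h i) _; rewrite ler_nat.
Qed.

Lemma nz_fine_gt0 : 0 < fine (nu B).
Proof. by apply: fine_gt0; apply/andP; split; [exact: nz_gt0 nz|exact: nz_finB]. Qed.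

Lemma integrable_mon (al : A) : nu.-integrable B (EFin \o (fun x => mon al (x : 'rV[R]_d))).
Proof.
apply: measurable_bounded_integrable; first exact: nz_meas nz.
- exact: nz_finB.
- by apply: measurable_funTS; exact: measurable_mon.
exists (2 ^+ (M * d)); split; first by rewrite num_real.
move=> y hy x Bx /=; apply: le_trans (ltW hy).
by apply: mon_le; [rewrite ler1n|exact: (nz_sub nz Bx)].
Qed.

Lemma moment_mon0 : moment nu B (mon0 d m) = 1.
Proof.
rewrite /moment; under eq_Rintegral do rewrite mon0E.
rewrite Rintegral_cst; last exact: nz_meas nz.
by rewrite mul1r mulVf// lt0r_neq0// nz_fine_gt0.
Qed.

Lemma moment_centered (p : A -> R) :
  let Q := fun x : rVborel R d => \sum_al p al * (mon al (x : 'rV[R]_d) - moment nu B al) in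
  nu.-integrable B (EFin \o Q) /\ \int[nu]_(x in B) Q x = 0.
Proof.
move=> Q; have mB := nz_meas nz.
have ic (c : R) : nu.-integrable B (EFin \o (fun=> c)).
  by apply: integrable_cst => //; exact: nz_finB.
have i1 al : nu.-integrable B (EFin \o (fun x : rVborel R d => p al * (mon al (x : 'rV[R]_d) - moment nu B al))).
  rewrite (_ : EFin \o _ = (fun x : rVborel R d => (p al)%:E *
     ((EFin \o (fun x : rVborel R d => mon al (x : 'rV[R]_d))) \- (EFin \o (fun=> moment nu B al))) x)%E) //.
  apply: integrableZl => //; apply: integrableB => //; exact: integrable_mon.
have [h1 h2] := @Rintegral_sum _ _ _ nu B _ (index_enum _) _ mB i1.
split=> //; rewrite h2 big1// => al _.
rewrite RintegralZl//; last first.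
  rewrite (_ : EFin \o _ = ((EFin \o (fun x : rVborel R d => mon al (x : 'rV[R]_d))) \- (EFin \o (fun=> moment nu B al)))%E)//.
  by apply: integrableB => //; exact: integrable_mon.
rewrite RintegralB//; last exact: integrable_mon.
rewrite Rintegral_cst// /moment [_^-1 * _]mulrC divfK ?subrr ?mulr0//.
by rewrite lt0r_neq0// nz_fine_gt0.
Qed.

End with_nu.

(** Let P be the maximum of |p|. If Q > -P / (2 K) on all of S, then by [mean0_half] |Q| <= P / (2
    K) on half of B, and [mon_coef_bound] on a slice of that half bounds every nonconstant
    coefficient by P / 2, which contradicts the choice of P. *)
Lemma greedy_step (kap : R) : 0 < kap -> exists2 eta : R, 0 < eta &
  forall nu B (S : set 'rV[R]_d), normalized kap nu B -> open S -> S `<=` B -> nu (B `\` S) = 0%E ->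
  forall p : A -> R, p (mon0 d m) = 0 ->
  exists2 x, S x & forall al,
    \sum_al p al * (mon al x - moment nu B al) <= - (eta * `|p al|).
Proof.
move=> kap0; have kap20 : 0 < kap / 2 by rewrite divr_gt0.
have kap40 : 0 < kap / 2 / 2 by rewrite divr_gt0.
have [K K0 KP] := @mon_coef_bound R d m _ kap40.
exists (2 * K)^-1; first by rewrite invr_gt0 mulr_gt0.
move=> nu B S nz oS SB nBS p p0; apply: contrapT => no.
have mS : measurable (S : set (rVborel R d)) by apply: sub_sigma_algebra.
set Q := fun x : 'rV[R]_d => \sum_al p al * (mon al x - moment nu B al).
pose P := \big[Order.max/0]_al `|p al|.
have pP al : `|p al| <= P by exact: (le_bigmax _ (fun al => `|p al|)).
have P0 : 0 <= P by apply: bigmax_ge_id.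
have QS x : S x -> - ((2 * K)^-1 * P) < Q x.
  move=> Sx; rewrite ltNge; apply/negP => h; apply: no; exists x => // al.
  apply: le_trans h _; rewrite lerN2 ler_wpM2l// invr_ge0 mulr_ge0// ltW//.
have Sne : S !=set0.
  apply/set0P/negP => /eqP S0; move: nBS; rewrite S0 setD0 => nB0.
  by have := nz_gt0 nz; rewrite nB0 ltxx.
have {}P0 : 0 < P.
  rewrite lt_neqAle P0 andbT; apply/negP => /eqP Pe.
  have pz al : p al = 0 by apply/eqP; rewrite -normr_le0 Pe.
  have [x Sx] := Sne; have := QS x Sx; rewrite /Q big1 => [|al _]; last by rewrite pz mul0r.
  by rewrite -Pe mulr0 oppr0 ltxx.
set h := (2 * K)^-1 * P in QS.
have h0 : 0 < h by rewrite mulr_gt0// invr_gt0 mulr_gt0.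
have [iQ Q0] := moment_centered nz p.
have mQ : measurable_fun [set: rVborel R d] Q.
  rewrite /Q; elim: (index_enum _) => [|al s IH].
    by under eq_fun do rewrite big_nil; exact: measurable_cst.
  under eq_fun do rewrite big_cons.
  apply: measurable_funD => //; apply: measurable_funM => //; apply: measurable_funB => //.
  exact: measurable_mon.
have [mE hE] := mean0_half (nz_meas nz) mS SB nBS (nz_finB nz) mQ iQ Q0 h0 (fun x Sx => ltW (QS x Sx)).
set E := S `&` _ in mE hE.
have [| | | |y y3 hy] := @exists_slice R d m nu (nz_transl nz) E (kap / 2) kap20 mE.
- by move=> x [/SB /(nz_sub nz)].
- exact: nz_fin nz.
- apply: lt_le_trans (nz_gt0 nz) _; apply: le_measure; rewrite ?inE.
  + exact: nz_meas nz.
  + exact: measurable_cube.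
  + by move=> x /(nz_sub nz) hx i; apply: le_trans (hx i) _; rewrite ler_nat.
- apply: le_trans hE; rewrite mulrC EFinM -muleA; apply: lee_wpmul2l => //.
  exact: nz_dens nz.
(* The subtracted means go into the constant coefficient, which p leaves free. *)
pose p' al := p al - (if al == mon0 d m then \sum_be p be * moment nu B be else 0).
have p'E x : \sum_al p' al * mon al x = Q x.
  rewrite /Q; under [RHS]eq_bigr do rewrite mulrBr.
  under [LHS]eq_bigr do rewrite /p' mulrBl.
  rewrite !sumrB; congr (_ - _); rewrite (bigD1 (mon0 d m))//= eqxx mon0E mulr1 [X in _ + X]big1 ?addr0//.
  by move=> al /negPf->; rewrite mul0r.
have p'K al : `|p' al| <= K * h.
  apply: (KP (E : set 'rV[R]_d) y p' h _ hy) => //; first exact: measurable_slice.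
  by move=> x [_ /= hx]; rewrite p'E.
have pK al : `|p al| <= P / 2.
  have -> : P / 2 = K * h by rewrite /h; field; exact: lt0r_neq0.
  have [->|al0] := eqVneq al (mon0 d m); first by rewrite p0 normr0 mulr_ge0 ?ltW.
  by have := p'K al; rewrite /p' (negPf al0) subr0.
have : P <= P / 2 by apply: bigmax_le => //; rewrite divr_ge0// ltW.
by move: P0; clear; lra.
Qed.

End greedy.

(** * Averaging sets in normalised position *)

Section core.
Variables (R : realType) (d m : nat).
Local Notation M := m.+1.
Local Notation A := {ffun 'I_d -> 'I_M}.

Lemma moment_le kap nu B (al : A) : normalized kap nu B -> `|moment nu B al| <= 2 ^+ (M * d) :> R.
Proof.
move=> nz; have f0 := nz_fine_gt0 nz; have mB := nz_meas nz.
rewrite /moment normrM normfV (gtr0_norm f0) mulrC ler_pdivrMr//.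
have iM := integrable_mon nz al.
apply: le_trans (le_normr_Rintegral mB iM) _.
rewrite -Rintegral_cst//; apply: le_Rintegral => //.
- by have := integrable_norm iM.
- by apply: integrable_cst => //; exact: nz_finB nz.
- by move=> x Bx; apply: mon_le; [rewrite ler1n|exact: (nz_sub nz Bx)].
Qed.

(** The squared norm of the error decreases by a fixed amount per point as long as some coordinate
    is large. The final radius [R0] does not depend on the initial bound W, only the waiting time n0
    does. *)
Lemma greedy_sum (kap : R) : 0 < kap -> exists2 R0 : R, 0 <= R0 &
  forall W : R, exists n0 : nat, forall nu B (S : set 'rV[R]_d),
  normalized kap nu B -> open S -> S `<=` B -> nu (B `\` S) = 0%E ->
  forall v0 : A -> R, v0 (mon0 d m) = 0 -> (forall al, `|v0 al| <= W) ->
  forall n, (n0 <= n)%N -> exists x : seq 'rV[R]_d, [/\ size x = n, forall z, z \in x -> S z &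
    forall al, `|v0 al + \sum_(z <- x) (mon al z - moment nu B al)| <= R0].
Proof.
have sqle (X Y : R) : 0 <= Y -> X ^+ 2 <= Y -> `|X| <= 1 + Y.
  by move=> *; rewrite ler_norml; apply/andP; split; nra.
move=> kap0; have [eta eta0 step] := @greedy_step R d m kap kap0.
pose a : R := #|{: A}|%:R.
have a0 : 0 < a by rewrite ltr0n; apply/card_gt0P; exists (mon0 d m).
pose L0 : R := 2 * 2 ^+ (M * d); have L00 : 0 < L0 by rewrite mulr_gt0// exprn_gt0.
pose L := a * L0 ^+ 2; have L_gt0 : 0 < L by rewrite mulr_gt0// exprn_gt0.
pose D := a * (L / eta) ^+ 2 + L.
have D0 : 0 <= D.
  apply: addr_ge0; last exact: ltW.
  by apply: mulr_ge0; [exact: ltW|exact: sqr_ge0].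
exists (1 + D); first by rewrite addr_ge0.
move=> W; exists (Num.bound (a * W ^+ 2 / L)).
move=> nu B S nz oS SB nBS v0 v00 v0W n hn.
pose N (v : A -> R) := \sum_al v al ^+ 2.
have Nle (v : A -> R) (e : R) : (forall al, `|v al| <= e) -> N v <= a * e ^+ 2.
  move=> ve; rewrite mulr_natl -sumr_const; apply: ler_sum => al _.
  rewrite -real_normK ?num_real// lerXn2r ?nnegrE//.
  exact: le_trans (ve al).
suff [x [sx xS xN]] : exists x : seq 'rV[R]_d, [/\ size x = n, forall z, z \in x -> S z &
    N (fun al => v0 al + \sum_(z <- x) (mon al z - moment nu B al)) <= Num.max (N v0 - n%:R * L) D].
  exists x; split=> // al; move: xN; rewrite (_ : Num.max _ _ = D); last first.
    apply/max_idPr; apply: le_trans D0; rewrite subr_le0.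
    apply: le_trans (Nle _ _ v0W) _; rewrite -ler_pdivrMr//.
    apply: (@le_trans _ _ (Num.bound (a * W ^+ 2 / L))%:R); last by rewrite ler_nat.
    apply/ltW/archi_boundP; apply: divr_ge0; last exact: ltW.
    by rewrite mulr_ge0 ?exprn_even_ge0// ltW.
  set v := (v in N v); rewrite /N (bigD1 al)//= => h.
  have : v al ^+ 2 <= D.
    by apply: le_trans h; rewrite lerDl sumr_ge0// => be _; rewrite sqr_ge0.
  exact: sqle.
elim: n {hn} => [|n [x [sx xS xN]]].
  exists [::]; split=> //; under eq_fun do rewrite big_nil addr0.
  by rewrite mul0r subr0 le_max lexx.
set v := (v in N v) in xN.
have vm0 : v (mon0 d m) = 0.
  rewrite /v v00 add0r big1// => z _; rewrite mon0E (moment_mon0 m nz) subrr//.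
have [z Sz zP] := step nu B S nz oS SB nBS v vm0.
exists (z :: x); split; first by rewrite /= sx.
  by move=> w; rewrite inE => /orP[/eqP->|/xS].
pose del (al : A) := mon al z - moment nu B al.
rewrite (_ : (fun al => _) = (fun al => v al + del al)); last first.
  by apply/funext => al; rewrite big_cons /v /del addrCA addrC.
have Nexp : N (fun al => v al + del al) = N v + 2 * (\sum_al v al * del al) + N del.
  rewrite /N mulr_sumr -!big_split/=; apply: eq_bigr => al _; ring.
have Ndel : N del <= L.
  apply: Nle => al; apply: le_trans (ler_normB _ _) _.
  rewrite /L0 mulr_natl mulr2n lerD//; last exact: (moment_le al nz).
  by apply: mon_le; [rewrite ler1n|exact: (nz_sub nz (SB _ Sz))].
(* With p = v, a large coordinate makes the cross term at most -2 L, which outweighs the square L of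
   the step. Otherwise the error is already so small that one more step stays below D. *)
have [[al hal]|no] := pselect (exists al, L <= eta * `|v al|).
  apply: (@le_trans _ _ (Num.max (N v0 - n%:R * L) D - L)).
    rewrite Nexp; have := zP al; rewrite -/(del _).
    move: xN Ndel hal; rewrite -/(N v).
    move: (N v) (N del) (\sum_al v al * del al) (Num.max _ _) (eta * _) => X1 X2 X3 X4 X5.
    by clear => *; lra.
  rewrite -natr1 mulrDl mul1r opprD addrA.
  rewrite lerBlDr ge_max; apply/andP; split; rewrite -lerBlDr le_max ?lexx//.
  by apply/orP; right; rewrite lerBlDr lerDl ltW.
apply: (@le_trans _ _ D); last by rewrite le_max lexx orbT.
have Nv : N v <= a * (L / eta) ^+ 2.
  apply: Nle => al; rewrite leNgt; apply/negP => h; apply: no; exists al.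
  by move: h; rewrite ltr_pdivrMr// mulrC => /ltW.
have inn : \sum_al v al * del al <= 0.
  apply: le_trans (zP (mon0 d m)) _; rewrite oppr_le0 mulr_ge0// ltW//.
by rewrite Nexp /D; move: Nv inn Ndel; clear; move: (N v) (N del) (\sum_al _) (a * _) => *; lra.
Qed.

End core.

Lemma split_size (a b c n : nat) : (a + b + c <= n)%N ->
  n = (n - (b + c) + b + c)%N /\ (a <= n - (b + c))%N.
Proof. by move=> ?; split; lia. Qed.

(** * Distinct points and the final correction *)

Section perturbation.
Variables (R : realType) (d m : nat).
Local Notation M := m.+1.
Local Notation A := {ffun 'I_d -> 'I_M}.

Lemma continuous_mon_ray (al : A) (x v : 'rV[R]_d) (c : R) :
  (fun th : R => mon al (x + (c * th) *: v)) @ (0 : R) --> mon al x.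
Proof.
have -> : mon al x = mon al (x + (c * 0) *: v) by rewrite mulr0 scale0r addr0.
rewrite /mon; elim: (index_enum _) => [|i s IH].
  by rewrite big_nil; under eq_fun do rewrite big_nil; exact: cvg_cst.
rewrite big_cons; under eq_fun do rewrite big_cons.
apply: cvgM => //.
rewrite (_ : (fun _ => _) = (fun th : R => (x 0 i + c * th * v 0 i) ^+ al i)); last first.
  by apply/funext => th; rewrite !mxE.
have -> : (x + (c * 0) *: v) 0 i = x 0 i + c * 0 * v 0 i by rewrite !mxE.
have h : (fun th : R => x 0 i + c * th * v 0 i) @ (0 : R) --> (x 0 i + c * 0 * v 0 i : R).
  apply: cvgD; first exact: cvg_cst.
  by apply: cvgMl; apply: cvgMr; exact: cvg_id.
exact: (cvg_comp _ _ h (@exprn_continuous _ (al i) _)).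
Qed.

(** The i-th point moves by (i + 1) th along one fixed vector. Two points can then collide for at
    most one th, and all other requirements hold for small th > 0. *)
Lemma distinct_perturbation (n : nat) (x : 'I_n -> 'rV[R]_d) (U : set 'rV[R]_d) (e : R) :
  (0 < d)%N -> open U -> (forall i, U (x i)) -> 0 < e ->
  exists x' : 'I_n -> 'rV[R]_d, [/\ injective x', forall i, U (x' i),
    forall i, `|x' i - x i| < e &
    forall al : A, `|\sum_i mon al (x' i) - \sum_i mon al (x i)| <= e].
Proof.
move=> d0 oU Ux e0; pose k0 : 'I_d := Ordinal d0.
pose v : 'rV[R]_d := const_mx 1.
pose X (th : R) (i : 'I_n) := x i + (i.+1%:R * th) *: v.
have near_norm i (r : R) : 0 < r -> \forall th \near (0:R)^'+, `|X th i - x i| < r.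
  move=> r0; have p : 0 < r / (i.+1%:R * (1 + `|v|)) by rewrite divr_gt0// mulr_gt0// ltr_pwDl.
  near=> th; rewrite /X addrAC subrr add0r normrZ normrM normr_nat.
  have th0 : 0 < th by near: th; exact: nbhs_right_gt.
  have thp : th < r / (i.+1%:R * (1 + `|v|)) by near: th; exact: nbhs_right_lt.
  rewrite gtr0_norm//; move: thp; rewrite ltr_pdivlMr; last by rewrite mulr_gt0// ltr_pwDl.
  apply: le_lt_trans; rewrite mulrA [th * _]mulrC ler_wpM2l//; last by rewrite lerDr.
  by rewrite mulr_ge0// ltW.
have nearU i : \forall th \near (0:R)^'+, U (X th i).
  have /nbhs_ballP[r /= r0 rU] : nbhs (x i) U by apply: open_nbhs_nbhs; split.
  by apply: filterS (near_norm i r r0) => th h; apply: rU; rewrite -ball_normE /= distrC.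
have nearI i j : i != j -> \forall th \near (0:R)^'+, X th i != X th j.
  move=> ij; pose c := (x i 0 k0 - x j 0 k0) / (j.+1%:R - i.+1%:R).
  have ji : j.+1%:R - i.+1%:R != 0 :> R.
    by rewrite subr_eq0 eqr_nat eqSS eq_sym; move: ij; apply: contra => /eqP/val_inj->.
  have cne : \forall th \near (0:R)^'+, th != c.
    have [c0|c0] := leP c 0.
      near=> th; apply: contraTneq c0 => <-; rewrite -ltNge; near: th; exact: nbhs_right_gt.
    near=> th; apply: contraTneq isT => thc; have : th < c by near: th; exact: nbhs_right_lt.
    by rewrite thc ltxx.
  apply: filterS cne => th; apply: contraNneq => /rowP/(_ k0); rewrite !mxE !mulr1 => h.
  by rewrite /c eq_sym; apply/eqP; apply: (mulIf ji); rewrite divfK// mulrBr; move: h; clear; lra.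
have nearM (al : A) i : \forall th \near (0:R)^'+, `|mon al (X th i) - mon al (x i)| <= e / (1 + n%:R).
  have := @continuous_mon_ray al (x i) v i.+1%:R => /cvgrPdist_le /(_ (e / (1 + n%:R))).
  move=> /(_ (divr_gt0 e0 (ltr_pwDl ltr01 (ler0n _ _)))) h.
  by apply: cvg_within; apply: filterS h => th; rewrite distrC.
have f1 : \forall th \near (0:R)^'+, forall i, `|X th i - x i| < e.
  by apply: filter_forall => i; exact: near_norm.
have f2 : \forall th \near (0:R)^'+, forall i, U (X th i).
  by apply: filter_forall => i; exact: nearU.
have f3 : \forall th \near (0:R)^'+, forall ij : 'I_n * 'I_n, ij.1 != ij.2 -> X th ij.1 != X th ij.2.
  apply: filter_forall => -[i j] /=; have [->|ij] := eqVneq i j.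
    exact: nearW.
  by apply: filterS (nearI i j ij).
have f4 : \forall th \near (0:R)^'+, forall ai : A * 'I_n,
    `|mon ai.1 (X th ai.2) - mon ai.1 (x ai.2)| <= e / (1 + n%:R).
  by apply: filter_forall => -[al i]; exact: nearM.
have f12 : \forall th \near (0:R)^'+, (forall i, `|X th i - x i| < e) /\ forall i, U (X th i).
  exact: filterI.
have f34 : \forall th \near (0:R)^'+,
    (forall ij : 'I_n * 'I_n, ij.1 != ij.2 -> X th ij.1 != X th ij.2) /\
    forall ai : A * 'I_n, `|mon ai.1 (X th ai.2) - mon ai.1 (x ai.2)| <= e / (1 + n%:R).
  exact: filterI.
have f1234 : \forall th \near (0:R)^'+,
    ((forall i, `|X th i - x i| < e) /\ forall i, U (X th i)) /\
    ((forall ij : 'I_n * 'I_n, ij.1 != ij.2 -> X th ij.1 != X th ij.2) /\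
    forall ai : A * 'I_n, `|mon ai.1 (X th ai.2) - mon ai.1 (x ai.2)| <= e / (1 + n%:R)).
  exact: filterI.
have [th [[h1 h2] [h3 h4]]] := @filter_ex _ _ (at_right_proper_filter 0) _ f1234.
exists (X th); split=> //.
  by move=> i j /eqP; apply: contraTeq => ij; exact: (h3 (i, j)).
move=> al; rewrite -sumrB; apply: le_trans (ler_norm_sum _ _ _) _.
apply: (@le_trans _ _ (\sum_(i < n) e / (1 + n%:R))).
  by apply: ler_sum => i _; exact: (h4 (al, i)).
rewrite sumr_const card_ord -[leLHS]mulr_natl mulrA ler_pdivrMr ?ltr_pwDl//.
by rewrite mulrC; apply: ler_wpM2l; [exact: ltW|rewrite lerDr].
Unshelve. all: by end_near. Qed.

(** Of the n points, q are reserved, k absorb and the remaining ones are greedy. The tolerances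
    [eps], [del], [rho] depend on B, the counts do not. *)
Lemma core_averaging (kap : R) : (0 < d)%N -> (0 < m)%N -> 0 < kap ->
  exists N : nat, forall n, (N <= n)%N -> forall nu B, normalized kap nu B ->
    nu (B `\` (interior (B : set 'rV[R]_d))) = 0%E ->
    exists x : 'I_n -> 'rV[R]_d, [/\ forall al : A, \sum_k mon al (x k) = n%:R * moment nu B al,
      forall k, B (x k) & injective x].
Proof.
move=> d0 m0 kap0; have [R0 R00 greedy] := @greedy_sum R d m kap kap0.
pose c := Num.min (kap / 2) 1.
have c01 : 0 < c <= 1 by rewrite lt_min divr_gt0//= ltr01 ge_min lexx orbT.
have [k kP] := @mon_box R d m m0 d0 c R0 c01 R00.
pose q := (M ^ d).-1.
pose V : R := 2 ^+ (M * d); have V0 : 0 < V by rewrite exprn_gt0.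
have [n0 n0P] := greedy ((k + q)%:R * (2 * V)).
exists (n0 + k + q)%N => n Nn nu B nz nB.
pose Bi := interior (B : set 'rV[R]_d); rewrite -/Bi in nB.
have oBi : open Bi by exact: open_interior.
have BiB : Bi `<=` B by exact: interior_subset.
have mB := nz_meas nz.
have [u0 Bu0] : Bi !=set0.
  apply/set0P/negP => /eqP S0; move: nB; rewrite -/Bi S0 setD0 => nB0.
  by have := nz_gt0 nz; rewrite nB0 ltxx.
have u03 i : `|u0 0 i| <= 3.
  by apply: le_trans (nz_sub nz (BiB _ Bu0) i) _; rewrite ler_nat.
have mc0 : mcurve d m (0 : R) = 0.
  by apply/rowP => i; rewrite !mxE expr0n expn_eq0.
have [eps eps01 epsP] : exists2 eps : R, 0 < eps <= 1 & forall t, 0 < t < eps -> Bi (u0 + mcurve d m t).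
  have : \forall t \near (0 : R), Bi (u0 + mcurve d m t).
    apply: (@continuous_mcurve R d m u0 0); rewrite mc0 addr0.
    by apply: open_nbhs_nbhs; split.
  move=> /nbhs_ballP[r /= r0 rB]; exists (Num.min r 1).
    by rewrite lt_min r0 ltr01 ge_min lexx orbT.
  move=> t /andP[t0 tr]; apply: rB; rewrite /ball /= sub0r normrN gtr0_norm//.
  by apply: lt_le_trans tr _; rewrite ge_min lexx.
have [t0 [t0eps t0inj t0P]] := @mon_open R d m m0 d0 u0 eps eps01 u03.
pose y i := u0 + mcurve d m (t0 0 i).
have yB i : Bi (y i) by exact: epsP.
pose Y : set 'rV[R]_d := range y.
have finY : finite_set Y by apply: finite_image; exact: finite_finset.
(* Removing the finitely many reserved points costs no measure and keeps all other points off
   them. *)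
pose S := Bi `\` Y.
have oS : open S.
  rewrite /S setDE; apply: openI => //; rewrite openC; have /accessible_finite_set_closed h := hausdorff_accessible (@norm_hausdorff _ 'rV[R]_d).
  exact: h.
have SB : S `<=` B by move=> z [/BiB].
have mopen (U : set 'rV[R]_d) : open U -> measurable (U : set (rVborel R d)).
  by move=> oU; apply: sub_sigma_algebra.
have mBi := mopen _ oBi; have mS := mopen _ oS.
have mset1 (v : 'rV[R]_d) : measurable ([set v] : set (rVborel R d)).
  rewrite -[X in measurable X]setCK; apply: measurableC; apply: mopen.
  rewrite openC; have /accessible_finite_set_closed h := hausdorff_accessible (@norm_hausdorff _ 'rV[R]_d).
  exact: h.
have nBS : nu (B `\` S) = 0%E.
  have [mY leY] := @le_measure_bigsetU_cond _ _ _ nu _ (index_enum 'I_q) xpredT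
    (fun i => [set y i] : set (rVborel R d)) (fun i => mset1 (y i)).
  apply/eqP; rewrite eq_le measure_ge0 andbT.
  apply: (@le_trans _ _ (nu ((B `\` Bi) `|` \big[setU/set0]_(i <- index_enum 'I_q) [set y i]))).
    apply: le_measure; rewrite ?inE.
    - exact: measurableD.
    - by apply: measurableU => //; exact: measurableD.
    move=> z [Bz Sz]; have [Biz|Biz] := pselect (Bi z); last by left.
    right; have [i _ iz] : Y z by apply: contrapT => Yz; apply: Sz.
    by rewrite -bigcup_seq; exists i => //=; rewrite mem_index_enum.
  apply: (@le_trans _ _ (nu (B `\` Bi) + nu (\big[setU/set0]_(i <- index_enum 'I_q) [set y i]))%E).
    by apply: measureU2 => //; exact: measurableD.
  rewrite nB add0e; apply: le_trans leY _.
  by rewrite big1// => i _; exact: nz_set1 nz _.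
have nuS : (nu B <= nu S)%E.
  rewrite -[leRHS]adde0 -nBS; apply: le_trans; last by apply: measureU2 => //; exact: measurableD.
  by rewrite setDUK.
have [y1 y13 hy1] : exists2 y1 : 'rV[R]_d, cube 3 y1 &
    ((kap / 2)%:E <= lebesgue_measure (slice m (S : set 'rV[R]_d) y1))%E.
  apply: (@exists_slice R d m nu (nz_transl nz) S kap kap0 mS).
  - by move=> z [/BiB /(nz_sub nz)].
  - exact: nz_fin nz.
  - apply: lt_le_trans (nz_gt0 nz) _; apply: le_measure; rewrite ?inE//.
    + exact: measurable_cube.
    + by move=> z /(nz_sub nz) hz i; apply: le_trans (hz i) _; rewrite ler_nat.
  - exact: le_trans (nz_dens nz) nuS.
have [|w [w0 wP]] := kP S y1 oS _ y13.
  by apply: le_trans hy1; rewrite lee_fin ge_min lexx.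
have monV (al : A) z : B z -> `|mon al z| <= V.
  by move=> Bz; apply: mon_le; [rewrite ler1n|exact: (nz_sub nz Bz)].
(* Taking s = w in [wP] shows that w is itself a sum over k points of S. *)
have wV al : `|w al| <= k%:R * V.
  have [al'|x [sx xS <-]] := wP w w0; first by rewrite subrr normr0.
  apply: le_trans (ler_norm_sum _ _ _) _.
  apply: (@le_trans _ _ (\sum_(z <- x) V)).
    by rewrite big_seq [leRHS]big_seq; apply: ler_sum => z /xS /SB; exact: monV.
  by rewrite big_const_seq count_predT iter_addr_0 sx mulr_natl.
(* Initial error for the greedy choice: the k absorbing points are represented by the centre w of
   their box. *)
pose v0 (al : A) := w al + \sum_i mon al (y i) - (k + q)%:R * moment nu B al.
have v00 : v0 (mon0 d m) = 0.
  rewrite /v0 w0 (moment_mon0 m nz) mulr1 natrD.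
  rewrite (eq_bigr (fun=> 1)) ?sumr_const ?card_ord ?subrr// => i _; exact: mon0E.
have v0V al : `|v0 al| <= (k + q)%:R * (2 * V).
  apply: le_trans (ler_normB _ _) _; rewrite normrM normr_nat.
  apply: (@le_trans _ _ ((k%:R * V + q%:R * V) + (k + q)%:R * V)); last first.
    by rewrite natrD le_eqVlt; apply/orP; left; apply/eqP; ring.
  apply: lerD; last by rewrite ler_wpM2l// (moment_le al nz).
  apply: le_trans (ler_normD _ _) _; apply: lerD => //.
  apply: le_trans (ler_norm_sum _ _ _) _.
  rewrite mulr_natl -[q in X in _ <= X]card_ord -sumr_const; apply: ler_sum => i _.
  exact/monV/BiB.
pose ng := (n - (k + q))%N.
have [ngE n0ng] : n = (ng + k + q)%N /\ (n0 <= ng)%N by exact: split_size.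
have [xg [sxg xgS xgR]] := n0P nu B S nz oS SB nBS v0 v00 v0V ng n0ng.
pose s (al : A) := n%:R * moment nu B al - \sum_i mon al (y i) - \sum_(z <- xg) mon al z.
have s0 : s (mon0 d m) = k%:R.
  rewrite /s (moment_mon0 m nz) mulr1.
  rewrite (eq_bigr (fun=> 1)) ?sumr_const ?card_ord => [|i _]; last exact: mon0E.
  rewrite (eq_bigr (fun=> 1)) => [|i _]; last exact: mon0E.
  by rewrite big_const_seq count_predT iter_addr_0 sxg ngE !natrD; ring.
have sw al : `|s al - w al| <= R0.
  have -> : s al - w al = - (v0 al + \sum_(z <- xg) (mon al z - moment nu B al)).
    rewrite sumrB big_const_seq count_predT iter_addr_0 sxg -[moment nu B al *+ ng]mulr_natl.
    by rewrite /s /v0 ngE !natrD; ring.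
  by rewrite normrN.
have [xk [sxk xkS xkE]] := wP s s0 sw.
pose xs := xg ++ xk.
have xsS z : z \in xs -> S z by rewrite mem_cat => /orP[/xgS|/xkS].
have sxs : size xs = (ng + k)%N by rewrite size_cat sxg sxk.
pose n' := size xs.
pose x0 (i : 'I_n') : 'rV[R]_d := nth 0 xs i.
have x0S i : S (x0 i) by apply: xsS; rewrite mem_nth.
have x0E (al : A) : \sum_i mon al (x0 i) = n%:R * moment nu B al - \sum_i mon al (y i).
  transitivity (\sum_(z <- xs) mon al z).
    by rewrite (big_nth 0) big_mkord.
  have -> : \sum_(z <- xs) mon al z = \sum_(z <- xg) mon al z + \sum_(z <- xk) mon al z.
    by rewrite big_cat.
  by rewrite (xkE al) /s; ring.
(* The reserved points and the others stay disjoint as long as each point moves by less than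
   [del]. *)
pose del := \big[Num.min/1]_(ij : 'I_n' * 'I_q) (`|x0 ij.1 - y ij.2| / 2).
have del0 : 0 < del.
  apply: lt_bigmin => // -[i j] _ /=; rewrite divr_gt0// normr_gt0 subr_eq0.
  by apply/eqP => e; have [_] := x0S i; apply; exists j.
have delP i j : del <= `|x0 i - y j| / 2 by exact: (bigmin_le_cond _ (fun ij : 'I_n' * 'I_q => `|x0 ij.1 - y ij.2| / 2) (j := (i, j)) isT).
have [rho rho0 rhoP] : exists2 rho : R, 0 < rho & forall t : 'rV[R]_q, `|t - t0| < rho ->
    [/\ forall j, Bi (u0 + mcurve d m (t 0 j)),
      forall j, `|u0 + mcurve d m (t 0 j) - y j| < del &
      forall i j, i != j -> t 0 i != t 0 j].
  have cc j : (fun t : 'rV[R]_q => u0 + mcurve d m (t 0 j)) @ t0 --> (u0 + mcurve d m (t0 0 j)).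
    by apply: (cvg_comp _ _ (@coord_continuous _ _ _ _ _ t0) (@continuous_mcurve R d m u0 _)).
  pose P1 (t : 'rV[R]_q) := forall j, Bi (u0 + mcurve d m (t 0 j)).
  pose P2 (t : 'rV[R]_q) := forall j, `|u0 + mcurve d m (t 0 j) - y j| < del.
  pose P3 (t : 'rV[R]_q) := forall ij : 'I_q * 'I_q, ij.1 != ij.2 -> t 0 ij.1 != t 0 ij.2.
  have f1 : \forall t \near t0, P1 t.
    rewrite /P1; apply: (@filter_forall _ _ _ _ (nbhs_filter t0)) => j.
    have nb : nbhs (u0 + mcurve d m (t0 0 j)) Bi by apply: open_nbhs_nbhs; split=> //; exact: yB.
    exact: (cc j _ nb).
  have f2 : \forall t \near t0, P2 t.
    rewrite /P2; apply: (@filter_forall _ _ _ _ (nbhs_filter t0)) => j; have /cvgrPdist_lt/(_ del del0) := cc j.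
    by apply: filterS => t; rewrite distrC.
  have f3 : \forall t \near t0, P3 t.
    rewrite /P3; apply: (@filter_forall _ _ _ _ (nbhs_filter t0)) => -[i j] /=; have [->|ij] := eqVneq i j.
      exact: nearW.
    pose g := `|t0 0 i - t0 0 j|; have g0 : 0 < g by rewrite normr_gt0 subr_eq0 t0inj.
    apply/nbhs_ballP; exists (g / 2) => /=; first exact: divr_gt0.
    move=> t; rewrite -ball_normE /= => ht _; apply/eqP => tij.
    have h1 := le_lt_trans (coord_le_norm (t0 - t) i) ht.
    have h2 := le_lt_trans (coord_le_norm (t0 - t) j) ht.
    rewrite !mxE in h1 h2; have : g < g; last by rewrite ltxx.
    rewrite {1}/g (_ : t0 0 i - t0 0 j = (t0 0 i - t 0 i) - (t0 0 j - t 0 j)); last by rewrite tij; ring.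
    by apply: le_lt_trans (ler_normB _ _) _; rewrite [ltRHS]splitr ltrD.
  have f12 : \forall t \near t0, P1 t /\ P2 t by exact: (@filterI _ _ (nbhs_filter t0)).
  have f123 : nbhs t0 (fun t => (P1 t /\ P2 t) /\ P3 t) by exact: (@filterI _ _ (nbhs_filter t0)).
  have [rho /= rho0 rhoB] := (@nbhs_ballP R _ t0 _).1 f123.
  exists rho; first exact: rho0.
  move=> t ht.
  have [|[? ?] h3] := rhoB t; first by rewrite -ball_normE /= distrC.
  by split=> // i j; exact: (h3 (i, j)).
have [rho' rho'0 rho'P] := t0P rho rho0.
pose e := Num.min del rho'.
have e0 : 0 < e by rewrite lt_min del0.
have [x' [x'inj x'B x'x x'E]] := @distinct_perturbation n' x0 Bi e d0 oBi (fun i => (x0S i).1) e0.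
(* The new target for the reserved points; it differs from their old sum by the effect of the
   perturbation, at most [rho']. *)
pose s' (al : A) := n%:R * moment nu B al - \sum_i mon al (x' i).
have [||t [tt0 tE]] := rho'P s'.
- rewrite /s' (moment_mon0 m nz) mulr1.
  rewrite (eq_bigr (fun=> 1)) ?sumr_const ?card_ord => [|i _]; last exact: mon0E.
  by rewrite /n' sxs ngE !natrD; ring.
- move=> al; rewrite (_ : _ - _ = - (\sum_i mon al (x' i) - \sum_i mon al (x0 i))).
    by rewrite normrN; apply: le_trans (x'E al) _; rewrite ge_min lexx orbT.
  by rewrite /s' x0E; ring.
have [tB tdel tinj] := rhoP t tt0.
pose y' j := u0 + mcurve d m (t 0 j).
have x'y' i j : x' i != y' j.
  apply/eqP => xy; have := delP i j; rewrite leNgt => /negP; apply.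
  rewrite ltr_pdivrMr// mulr_natr mulr2n.
  have -> : x0 i - y j = (y' j - y j) - (x' i - x0 i).
    by rewrite xy opprB [RHS]addrC addrA subrK.
  apply: le_lt_trans (ler_normB _ _) _; apply: ltrD; first exact: tdel.
  by apply: lt_le_trans (x'x i) _; rewrite ge_min lexx.
have y'inj : injective y'.
  move=> i j e1; apply/eqP; apply: contraT => ij; have := tinj _ _ ij.
  have e2 : mcurve d m (t 0 i) = mcurve d m (t 0 j) by apply: (addrI u0); exact: e1.
  (* The coordinate of index 0 on [mcurve] is the parameter itself, as M^0 = 1. *)
  have /rowP/(_ (Ordinal d0)) := e2.
  by rewrite !mxE /= expn0 !expr1 => ->; rewrite eqxx.
have -> : n = (n' + q)%N by rewrite /n' sxs.
exists (fun k => match fintype.split k with inl i => x' i | inr j => y' j end); split.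
- move=> al; rewrite big_split_ord/=.
  rewrite (eq_bigr (fun i => mon al (x' i))) => [|i _]; last by rewrite (unsplitK (inl i)).
  rewrite [X in _ + X](eq_bigr (fun j => mon al (y' j))) => [|j _]; last by rewrite (unsplitK (inr j)).
  have -> : (n' + q)%:R = n%:R :> R by rewrite /n' sxs -ngE.
  by rewrite tE /s' addrC subrK.
- by move=> j; case: fintype.split => i; [exact/BiB/x'B|exact/BiB/tB].
- move=> i j; rewrite -{2}(splitK i) -{2}(splitK j).
  case: (fintype.split i) => a; case: (fintype.split j) => b //= h.
  + by rewrite (x'inj _ _ h).
  + by have := x'y' a b; rewrite h eqxx.
  + by have := x'y' b a; rewrite h eqxx.
  + by rewrite (y'inj _ _ h).
Qed.

End perturbation.

(** * Affine normalisation *)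

Section translation.
Variable R : realType.

Lemma lebesgue_measure_translate (v : R) (A : set (measurableTypeR R)) : measurable A ->
  lebesgue_measure [set x : measurableTypeR R | A ((x : R) + v)] = lebesgue_measure A.
Proof.
move=> mA; pose f (x : measurableTypeR R) : measurableTypeR R := (x : R) + v.
have mf : measurable_fun [set: measurableTypeR R] f by apply: measurable_funD.
pose m : {measure set (measurableTypeR R) -> \bar R} :=
  measure_function_pushforward__canonical__measure_function_Measure (@lebesgue_measure R) mf.
rewrite [RHS](lebesgue_measure_unique (mu := m))// => _ [[a b] _ <-].
rewrite /m /= /pushforward (_ : f @^-1` _ = `]a - v, b - v]%classic).
  rewrite !lebesgue_measure_itv/= !lte_fin ltrD2r; case: ifPn => // _.
  by rewrite -!EFinB; congr (_%:E); ring.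
by apply/seteqP; split=> x /=; rewrite !in_itv/= ltrBlDr lerBrDr.
Qed.

(** Induction on d: the translated measure agrees with the product measure on rectangles, and
    product measures are unique. *)
Lemma lebesgue_rV_translate (d : nat) (v : 'rV[R]_d) (A : set (rVborel R d)) : measurable A ->
  lebesgue_rV R d [set x : rVborel R d | A ((x : 'rV[R]_d) + v)] = lebesgue_rV R d A.
Proof.
elim: d v A => [|d IH] v A mA.
  congr (lebesgue_rV R 0 _); apply/seteqP; split=> x /=; by rewrite [v]thinmx0 addr0.
pose v0 := v ord0 ord0; pose v1 : 'rV[R]_d := \row_j v ord0 (lift ord0 j).
pose f (z : measurableTypeR R * rVborel R d) : measurableTypeR R * rVborel R d :=
  ((z.1 : R) + v0, (z.2 : 'rV[R]_d) + v1).
have mf : measurable_fun [set: measurableTypeR R * rVborel R d] f.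
  apply: measurable_fun_pair => /=; first by apply: measurable_funD.
  apply: measurable_fun_rVP => j.
  rewrite (_ : (fun _ => _) = (fun z : measurableTypeR R * rVborel R d => (z.2 : 'rV[R]_d) ord0 j + v1 ord0 j)); last first.
    by apply/funext => z; rewrite mxE.
  apply: measurable_funD => //.
  by apply: (measurableT_comp (measurable_coord_rV (R := R) j)).
pose mu := (@lebesgue_measure R \x lebesgue_rV R d)%E.
pose m : {measure set (measurableTypeR R * rVborel R d) -> \bar R} :=
  measure_function_pushforward__canonical__measure_function_Measure mu mf.
have mB : measurable (@rV_cons R d @^-1` A).
  by rewrite -[X in measurable X]setTI; apply: measurable_rV_cons.
have key : mu (@rV_cons R d @^-1` A) = m (@rV_cons R d @^-1` A).
  apply: product_measure_unique => // A1 A2 mA1 mA2.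
  have mA1' : measurable [set x : measurableTypeR R | A1 ((x : R) + v0)].
    have mg : measurable_fun [set: measurableTypeR R] (fun x : measurableTypeR R => ((x : R) + v0) : measurableTypeR R).
      by apply: measurable_funD.
    by rewrite -[X in measurable X]setTI; apply: mg.
  have mA2' : measurable [set x : rVborel R d | A2 ((x : 'rV[R]_d) + v1)].
    have mg : measurable_fun [set: rVborel R d] (fun x : rVborel R d => ((x : 'rV[R]_d) + v1) : rVborel R d).
      apply: measurable_fun_rVP => j.
      rewrite (_ : (fun _ => _) = (fun x : rVborel R d => (x : 'rV[R]_d) ord0 j + v1 ord0 j)); last first.
        by apply/funext => z; rewrite mxE.
      by apply: measurable_funD => //; exact: measurable_coord_rV.
    by rewrite -[X in measurable X]setTI; apply: mg.
  have := product_measure1E (@lebesgue_measure R) (lebesgue_rV R d) mA1' mA2'.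
  by rewrite /= lebesgue_measure_translate// IH// => <-.
rewrite /= /pushforward -/mu -[RHS]/(mu (@rV_cons R d @^-1` A)) key.
rewrite /m /= /pushforward; congr (mu _); apply/seteqP; split=> z /=;
  rewrite (_ : (rV_cons z : 'rV[R]_d.+1) + v = rV_cons (f z))//;
  apply/rowP => j; rewrite mxE; case: (unliftP ord0 j) => [k ->|->];
  by rewrite ?rV_consS ?rV_cons0 /f /= ?mxE.
Qed.

End translation.

(** * A large simplex with vertices in B *)

Section simplex.
Variables (R : realType) (d : nat).
Implicit Types (B : set 'rV[R]_d) (X : 'I_d -> 'rV[R]_d).

Definition simplex_mx (x0 : 'rV[R]_d) X : 'M[R]_d := \matrix_i (X i - x0).

Lemma cramer_row (T : 'M[R]_d) (v : 'rV[R]_d) (j : 'I_d) : T \in unitmx ->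
  (v *m invmx T) 0 j = \det (\matrix_i (if i == j then v else row i T)) / \det T.
Proof.
move=> uT; rewrite (expand_det_row _ j) mulr_suml !mxE; apply: eq_bigr => k _.
rewrite /invmx uT !mxE eqxx -mulrA; congr (_ * _); rewrite mulrC; congr (_ / _).
rewrite /cofactor; congr (_ * \det _); apply/matrixP => a b.
by rewrite !mxE eq_sym (negPf (neq_lift _ _)) !mxE.
Qed.

Lemma det_le (A : 'M[R]_d) (c : R) : (forall i j, `|A i j| <= c) ->
  `|\det A| <= #|{: 'S_d}|%:R * c ^+ d.
Proof.
move=> Ac; apply: le_trans (ler_norm_sum _ _ _) _.
rewrite -sum1_card natr_sum mulr_suml; apply: ler_sum => s _.
rewrite normrM normrX normrN1 expr1n !mul1r normr_prod -[d in c ^+ d]card_ord -prodr_const.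
by apply: ler_prod => i _; rewrite normr_ge0 Ac.
Qed.

(* The simplex is chosen with almost maximal volume, so that by Cramer's rule every point
   of B has bounded coordinates with respect to it. *)
Lemma exists_large_simplex B (b : R) : (forall x, B x -> forall i, `|x 0 i| <= b) ->
  (exists x, interior B x) ->
  exists x0 X, [/\ B x0, forall i, B (X i), simplex_mx x0 X \in unitmx &
    forall x, B x -> forall j, `|((x - x0) *m invmx (simplex_mx x0 X)) 0 j| <= 2].
Proof.
move=> Bb [z /nbhs_ballP[e /= e0 eB]].
pose S := [set r : R | exists x0 X, [/\ B x0, forall i, B (X i) & r = `|\det (simplex_mx x0 X)|]].
have Sub : has_ubound S.
  exists (#|{: 'S_d}|%:R * (b + b) ^+ d) => _ [x0 [X [Bx0 BX ->]]].
  apply: det_le => i j; rewrite !mxE; apply: le_trans (ler_normB _ _) _.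
  by apply: lerD; apply: Bb.
have e20 : 0 < e / 2 by rewrite divr_gt0.
(* A small axis-parallel simplex in a ball inside B makes the supremum positive. *)
have Sz : S ((e / 2) ^+ d).
  exists z, (fun i => z + (e / 2) *: delta_mx 0 i); split.
  - by apply: eB; exact: ballxx.
  - move=> i; apply: eB; rewrite -ball_normE /= opprD addrA subrr add0r normrN.
    apply: (@le_lt_trans _ _ (e / 2)); last by rewrite ltr_pdivrMr// ltr_pMr// ltr1n.
    apply/rV_norm_leP => [|j]; first exact: ltW.
    rewrite !mxE normrM gtr0_norm//; case: (_ && _); first by rewrite normr1 mulr1.
    by rewrite normr0 mulr0 ltW.
  rewrite (_ : simplex_mx _ _ = (e / 2)%:M) ?det_scalar.
    by rewrite ger0_norm// exprn_ge0// ltW.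
  apply/matrixP => i j; rewrite !mxE addrAC subrr add0r eqxx /= eq_sym.
  by case: (i == j); rewrite ?mulr1 ?mulr0.
have Ss : has_sup S by split=> //; exists ((e / 2) ^+ d).
have s0 : 0 < sup S.
  by apply: lt_le_trans (exprn_gt0 d e20) _; exact: ub_le_sup.
(* More than half of the supremum is enough: replacing a vertex by x multiplies the determinant by a
   coordinate of x, which is therefore at most 2 in absolute value. *)
have [r [x0 [X [Bx0 BX rE]]] rs] := sup_adherent (divr_gt0 s0 (ltr0Sn R 1)) Ss.
have {}rs : sup S < r * 2 by move: rs; lra.
have r0 : 0 < r by have := lt_trans s0 rs; rewrite pmulr_lgt0.
have dT0 : \det (simplex_mx x0 X) != 0 by rewrite -normr_gt0 -rE.
have uT : simplex_mx x0 X \in unitmx by rewrite unitmxE unitfE.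
exists x0, X; split=> // x Bx j.
rewrite cramer_row// normrM normfV -rE ler_pdivrMr// mulrC.
apply: le_trans (ltW rs); apply: ub_le_sup => //.
exists x0, (fun i => if i == j then x else X i); split=> //; first by move=> i; case: eqP.
congr `|\det _|; apply/matrixP => i k; rewrite !mxE.
by case: eqP => _; rewrite !mxE.
Qed.

(** Induction on s: split off X_i with weight c_i and rescale the rest by 1 - c_i. The strict bound
    on the sum keeps 1 - c_i positive and is inherited by the rescaled weights. *)
Lemma conv_hull_simplex B (x0 : 'rV[R]_d) (I : Type) (s : seq I) (c : I -> R) (X : I -> 'rV[R]_d) :
  B x0 -> (forall i, B (X i)) -> (forall i, 0 <= c i) -> \sum_(i <- s) c i < 1 ->
  conv_hull B (x0 + \sum_(i <- s) c i *: (X i - x0)).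
Proof.
move=> Bx0 BX c0 c1 K [cK BK].
elim: s c c0 c1 => [|i s IH] c c0; first by rewrite !big_nil addr0 => _; exact: BK.
rewrite !big_cons => ci1.
have s0 : 0 <= \sum_(j <- s) c j by apply: sumr_ge0.
have ci : c i < 1 by move: s0 ci1; lra.
have ci' : 0 < 1 - c i by rewrite subr_gt0.
have h1 : 0 <= c i <= 1 by rewrite c0 ltW.
have cj j : 0 <= (1 - c i)^-1 * c j by rewrite mulr_ge0// invr_ge0 ltW.
have sj : \sum_(j <- s) (1 - c i)^-1 * c j < 1.
  by rewrite -mulr_sumr mulrC ltr_pdivrMr// mul1r ltrBrDl.
have := cK (X i) _ (Itv01 (c0 i) (ltW ci)) (mem_set (BK _ (BX i))) (mem_set (IH _ cj sj)).
rewrite inE; congr K.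
rewrite -[LHS]/(c i *: X i + (1 - c i) *: (x0 + \sum_(j <- s) ((1 - c i)^-1 * c j) *: (X j - x0))).
have -> : \sum_(j <- s) ((1 - c i)^-1 * c j) *: (X j - x0) =
    (1 - c i)^-1 *: \sum_(j <- s) c j *: (X j - x0).
  by rewrite scaler_sumr; apply: eq_bigr => j _; rewrite scalerA.
rewrite scalerDr scalerA divff ?gt_eqF// scale1r scalerBr scalerBl scale1r.
by rewrite [LHS]addrA [RHS]addrA; congr (_ + _); rewrite [LHS]addrCA.
Qed.

End simplex.

(** * Affine coordinates and volumes *)

Section affine.
Variables (R : realType) (d : nat).
Local Notation lam := (lebesgue_rV R d).

Lemma continuous_mulmx_row (T : 'M[R]_d) : continuous (fun x : 'rV[R]_d => x *m T).
Proof.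
move=> x; apply: continuous_rV => j.
rewrite (_ : (fun _ => _) = (fun y : 'rV[R]_d => \sum_k y 0 k * T k j)); last first.
  by apply/funext => y; rewrite mxE.
elim: (index_enum _) => [|k s IH].
  rewrite (_ : (fun _ => _) = cst 0); first exact: cst_continuous.
  by apply/funext => y; rewrite big_nil.
rewrite (_ : (fun _ => _) = (fun y : 'rV[R]_d => y 0 k * T k j + \sum_(k <- s) y 0 k * T k j)); last first.
  by apply/funext => y; rewrite big_cons.
apply: continuousD => //; apply: continuousM; last exact: cst_continuous.
exact: coord_continuous.
Qed.

Lemma continuous_measurable_rV (f : 'rV[R]_d -> 'rV[R]_d) : continuous f ->
  measurable_fun [set: rVborel R d] (f : rVborel R d -> rVborel R d).
Proof.
move=> cf; apply: (@measurability _ _ (rVborel R d) (rVborel R d) setT f open) => //.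
move=> _ [A oA <-]; rewrite setTI; apply: sub_sigma_algebra.
by apply: open_comp => // x _; exact: cf.
Qed.

Variables (x0 : 'rV[R]_d) (T : 'M[R]_d).
Hypothesis uT : T \in unitmx.

Definition affine_coord (x : 'rV[R]_d) : 'rV[R]_d := (x - x0) *m invmx T.
Definition affine_point (v : 'rV[R]_d) : 'rV[R]_d := x0 + v *m T.
Local Notation u := affine_coord.
Local Notation w := affine_point.

Lemma affine_coordK : cancel u w.
Proof. by move=> x; rewrite /u /w mulmxKV// addrC subrK. Qed.

Lemma affine_pointK : cancel w u.
Proof. by move=> x; rewrite /u /w addrC addKr mulmxK. Qed.

Lemma affine_coordD x v : u (x + v *m T) = u x + v.
Proof. by rewrite /u addrAC mulmxDl mulmxK. Qed.

Lemma continuous_affine_coord : continuous u.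
Proof.
move=> x; rewrite (_ : u = (fun y : 'rV[R]_d => y *m invmx T) \- (fun=> x0 *m invmx T)); last first.
  by apply/funext => y; rewrite /u mulmxBl.
by apply: continuousB; [exact: (@continuous_mulmx_row (invmx T) x)|exact: cst_continuous].
Qed.

Lemma continuous_affine_point : continuous w.
Proof.
move=> x; rewrite (_ : w = (fun=> x0) \+ (fun y : 'rV[R]_d => y *m T))//.
by apply: continuousD; [exact: cst_continuous|exact: (@continuous_mulmx_row T x)].
Qed.

Lemma measurable_affine_coord : measurable_fun [set: rVborel R d] (u : rVborel R d -> rVborel R d).
Proof. apply: continuous_measurable_rV; exact: continuous_affine_coord. Qed.

Lemma measurable_affine_point : measurable_fun [set: rVborel R d] (w : rVborel R d -> rVborel R d).
Proof. apply: continuous_measurable_rV; exact: continuous_affine_point. Qed.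

Lemma affine_pushforward_ex : exists nu : {sigma_finite_measure set (rVborel R d) -> \bar R},
  nu = pushforward lam (u : rVborel R d -> rVborel R d) :> (set (rVborel R d) -> \bar R).
Proof.
pose m : {measure set (rVborel R d) -> \bar R} :=
  measure_function_pushforward__canonical__measure_function_Measure lam measurable_affine_coord.
apply: sigma_finite_measure_ex.
- exact: (measure0 m).
- by move=> A; exact: (measure_ge0 m).
- exact: (@measure_semi_sigma_additive _ _ _ m).
have [F FT Ff] := sigma_finiteT lam.
exists (fun k => w @^-1` F k); first by rewrite -preimage_bigcup -FT preimage_setT.
move=> k; have [mF fF] := Ff k; split.
  by rewrite -[X in measurable X]setTI; exact: measurable_affine_point.
rewrite /pushforward (_ : u @^-1` _ = F k)//.
by apply/seteqP; split=> x /=; rewrite affine_coordK.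
Qed.

Definition affine_cell (h : R) (a : 'rV[R]_d) : set (rVborel R d) :=
  [set x | forall j, a 0 j <= (u x) 0 j <= a 0 j + h].

Lemma measurable_affine_cell h a : measurable (affine_cell h a).
Proof.
have := @measurable_rV_setX R d (fun j => `[a 0 j, a 0 j + h]%classic) (fun=> measurable_itv _).
move=> mA; rewrite (_ : affine_cell h a = u @^-1` [set v : 'rV[R]_d | forall j, `[a 0 j, a 0 j + h]%classic (v ord0 j)]).
  by rewrite -[X in measurable X]setTI; exact: measurable_affine_coord.
by apply/seteqP; split=> x hx j; have := hx j; rewrite /= in_itv.
Qed.

Lemma lebesgue_affine_cell h a : lam (affine_cell h a) = lam (affine_cell h 0).
Proof.
rewrite -(lebesgue_rV_translate (- (a *m T)) (measurable_affine_cell h 0)).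
congr (lam _); apply/seteqP; split=> x hx j; have := hx j;
  rewrite -mulNmx affine_coordD !mxE add0r subr_ge0 lerBlDr [h + _]addrC //.
Qed.

(** The cube of radius 3 is covered by translates of one cell of side 1 / (d + 1), all of the same
    measure. Per axis there are 6 (d + 1) + 1 of them, the last one for the coordinate 3 itself. *)
Lemma lebesgue_affine_cube :
  (lam (u @^-1` cube 3) <= #|{ffun 'I_d -> 'I_(6 * d.+1).+1}|%:R%:E * lam (affine_cell d.+1%:R^-1 0))%E.
Proof.
pose L := (6 * d.+1)%N; pose h : R := d.+1%:R^-1.
have h0 : 0 < h by rewrite invr_gt0.
pose a (f : {ffun 'I_d -> 'I_L.+1}) : 'rV[R]_d := \row_j (-3 + (f j)%:R * h).
have [mU leU] := @le_measure_bigsetU_cond _ _ _ lam _ (index_enum {ffun 'I_d -> 'I_L.+1}) xpredT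
  (fun f => affine_cell h (a f)) (fun f => measurable_affine_cell h (a f)).
apply: (@le_trans _ _ (lam (\big[setU/set0]_f affine_cell h (a f)))).
  apply: le_measure; rewrite ?inE//.
    by rewrite -[X in measurable X]setTI; apply: measurable_affine_coord => //; exact: measurable_cube.
  move=> x /= hx; rewrite -bigcup_seq.
  pose t j := (u x 0 j + 3) * d.+1%:R.
  have t0 j : 0 <= t j.
    by rewrite mulr_ge0//; have := hx j; rewrite ler_norml => /andP[? _]; lra.
  have tL j : t j <= L%:R.
    rewrite natrM ler_wpM2r//; have := hx j; rewrite ler_norml => /andP[_ ?]; lra.
  have tr j : (Num.trunc (t j) < L.+1)%N.
    rewrite ltnS -(ler_nat R); apply: le_trans (tL j).
    by have /andP[] := truncn_itv (t0 j).
  exists [ffun j => Ordinal (tr j)]; rewrite /= ?mem_index_enum// => j.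
  have aE (f : {ffun 'I_d -> 'I_L.+1}) : a f 0 j = -3 + (f j)%:R * h by rewrite mxE.
  rewrite aE ffunE /=; have /andP[q1 q2] := truncn_itv (t0 j).
  have E : u x 0 j = -3 + t j * h by rewrite /t mulfK ?gt_eqF// addrC addrK.
  rewrite E -addrA !lerD2l; apply/andP; split; first by rewrite ler_pM2r.
  by rewrite -[X in _ + X]mul1r -mulrDl ler_pM2r// ltW// natr1.
apply: le_trans leU _.
rewrite (eq_bigr (fun=> lam (affine_cell h 0))); last by move=> f _; exact: lebesgue_affine_cell.
by rewrite sumr_const mule_natl.
Qed.

End affine.

(** * Tensor coordinates as combinations of monomials *)

Section tensor_monomials.
Variables (R : realType) (d m : nat).
Local Notation A := {ffun 'I_d -> 'I_m.+1}.

(** [inord] takes a default value once the exponent exceeds m; the bound on the total degree in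
    [mon_incrE] excludes this. *)
Definition mon_incr (k : 'I_d) (al : A) : A := [ffun i => inord (al i + (i == k))].

Lemma mon_incrE (k i : 'I_d) (al : A) : (\sum_i (al i : nat) < m)%N ->
  mon_incr k al i = (al i + (i == k))%N :> nat.
Proof.
rewrite (bigD1 i)//= => h; rewrite ffunE inordK//.
by have := leq_b1 (i == k); move: h; lia.
Qed.

Lemma mon_mon_incr (k : 'I_d) (al : A) (v : 'rV[R]_d) : (\sum_i (al i : nat) < m)%N ->
  mon (mon_incr k al) v = v 0 k * mon al v.
Proof.
move=> h; rewrite /mon (eq_bigr (fun i => v 0 i ^+ (i == k) * v 0 i ^+ al i)); last first.
  by move=> i _; rewrite mon_incrE// addnC exprD.
rewrite big_split/=; congr (_ * _).
by rewrite (bigD1 k)//= eqxx expr1 big1 ?mulr1// => i /negPf ->.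
Qed.

(** Each affine factor raises the total degree by at most 1; tracking that degree keeps the
    exponents within the range m. *)
Lemma affine_prod_mon (x0 : 'rV[R]_d) (T : 'M[R]_d) (r : seq 'I_d) : (size r <= m)%N ->
  exists s : seq (R * A), all (fun z : R * A => \sum_i (z.2 i : nat) <= size r)%N s /\
    forall v : 'rV[R]_d, \prod_(k <- r) (x0 + v *m T) 0 k = \sum_(z <- s) z.1 * mon z.2 v.
Proof.
elim: r => [_|k r IH rm].
  exists [:: (1, mon0 d m)]; split=> /=.
    by rewrite andbT leqn0; apply/eqP/big1 => i _; rewrite ffunE.
  by move=> v; rewrite big_nil big_seq1 mon0E mulr1.
have [s [sr sE]] := IH (ltnW rm).
exists ([seq (x0 0 k * z.1, z.2) | z <- s] ++
  flatten [seq [seq (T l k * z.1, mon_incr l z.2) | z <- s] | l <- index_enum 'I_d]); split.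
  rewrite all_cat; apply/andP; split.
    rewrite all_map; apply: sub_all sr => z /= h; exact: leq_trans h (leqnSn _).
  apply/allP => _ /flatten_mapP[l _] /mapP[z zs ->] /=.
  have h := allP sr _ zs; rewrite /= in h.
  rewrite (eq_bigr (fun i => z.2 i + (i == l))%N); last first.
    by move=> i _; rewrite mon_incrE//; exact: leq_ltn_trans h rm.
  rewrite big_split/= -[X in (_ <= X)%N]addn1 leq_add//.
  by rewrite (bigD1 l)//= eqxx big1 ?addn0// => i /negPf->.
move=> v; rewrite big_cons sE !mxE mulrDl big_cat/= big_map/=; congr (_ + _).
  by rewrite mulr_sumr; apply: eq_bigr => z _; rewrite mulrA.
rewrite big_flatten big_map mulr_suml; apply: eq_bigr => l _.
rewrite big_map mulr_sumr big_seq [RHS]big_seq; apply: eq_bigr => z zs /=.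
rewrite mon_mon_incr; last by apply: leq_ltn_trans rm; exact: (allP sr _ zs).
by ring.
Qed.

End tensor_monomials.

(** * Density of B in the normalised cube *)

Section normalization.
Variables (R : realType) (d : nat).
Local Notation lam := (lebesgue_rV R d).

Lemma lebesgue_rV_cube_lty (b : R) : (lam (cube b) < +oo)%E.
Proof.
have := @lebesgue_rV_setX R d (fun=> `[- b, b]%classic) (fun=> measurable_itv _).
rewrite (_ : mkset _ = cube b); last first.
  by apply/seteqP; split=> v h i; have := h i; rewrite /= in_itv/= ler_norml.
move=> ->; rewrite -ge0_fin_numE ?prode_ge0//; apply: prode_fin_num => j _.
by rewrite /= lebesgue_measure_itv/=; case: ifP.
Qed.

Lemma lebesgue_rV_set1 (v : rVborel R d) : (0 < d)%N -> lam [set v] = 0%E.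
Proof.
move=> d0; have := @lebesgue_rV_setX R d (fun j => [set (v : 'rV[R]_d) 0 j]) (fun=> measurable_set1 _).
rewrite (_ : mkset _ = [set v]); last first.
  by apply/seteqP; split=> [x /= h|_ -> //]; apply/rowP.
by move=> ->; rewrite (bigD1 (Ordinal d0))//= lebesgue_measure_set1 mul0e.
Qed.

(** The side 1 / (d + 1) makes the d barycentric weights add up to less than 1. *)
Lemma conv_hull_cell (B : set 'rV[R]_d) x0 X : B x0 -> (forall i, B (X i)) ->
  simplex_mx x0 X \in unitmx ->
  affine_cell x0 (simplex_mx x0 X) d.+1%:R^-1 0 `<=` conv_hull B.
Proof.
move=> Bx0 BX uT x hx; rewrite -(affine_coordK x0 uT x) /affine_point mulmx_sum_row.
rewrite (eq_bigr (fun i => affine_coord x0 (simplex_mx x0 X) x 0 i *: (X i - x0))); last first.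
  by move=> i _; congr (_ *: _); apply/rowP => j; rewrite !mxE.
have h i : 0 <= affine_coord x0 (simplex_mx x0 X) x 0 i <= d.+1%:R^-1.
  by have := hx i; rewrite [X in X <= _ <= _]mxE [X in _ <= _ <= X + _]mxE add0r.
apply: conv_hull_simplex => // [i|]; first by have /andP[] := h i.
apply: (@le_lt_trans _ _ (\sum_(i < d) d.+1%:R^-1)).
  by apply: ler_sum => i _; have /andP[] := h i.
by rewrite sumr_const card_ord -[_ *+ _]mulr_natl ltr_pdivrMr// mul1r ltr_nat.
Qed.

(* Volumes are compared through the outer measure, the convex hull of a Borel set being
   possibly non-Borel. *)
Lemma le_completed_lebesgue_rV (S : set (rVborel R d)) (K : set 'rV[R]_d) : measurable S -> S `<=` K ->
  (lam S <= completed_lebesgue_rV R d K)%E.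
Proof. by move=> mS SK; rewrite -(completed_lebesgue_rVE mS); exact: le_mu_ext. Qed.

(** Density of B in the cube of radius 3: that cube is covered by this number of cells, and one cell
    lies in conv(B), of volume at most C times that of B. *)
Definition cell_ratio (C : R) : R := (#|{ffun 'I_d -> 'I_(6 * d.+1).+1}|%:R * C)^-1.

Lemma cell_ratio_gt0 (C : R) : 0 < C -> 0 < cell_ratio C.
Proof.
move=> C0; rewrite invr_gt0 mulr_gt0// ltr0n; apply/card_gt0P.
by exists [ffun=> ord0].
Qed.

Lemma normalized_affine_image (C : R) (B : set (rVborel R d)) : (0 < d)%N -> 0 < C ->
  measurable B -> bounded_set (B : set 'rV[R]_d) -> (0 < lam B)%E ->
  lam (boundary (B : set 'rV[R]_d)) = 0%E ->
  (completed_lebesgue_rV R d (conv_hull (B : set 'rV[R]_d)) / lam B <= C%:E)%E ->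
  exists x0 T, T \in unitmx /\
    forall nu : {sigma_finite_measure set (rVborel R d) -> \bar R},
      nu = pushforward lam (affine_coord x0 T : rVborel R d -> rVborel R d) :> (set (rVborel R d) -> \bar R) ->
      let B' := affine_point x0 T @^-1` B in
      normalized (cell_ratio C) nu B' /\ nu (B' `\` interior (B' : set 'rV[R]_d)) = 0%E.
Proof.
move=> d0 C0 mB [b0 [_ /(_ (b0 + 1))]]; rewrite ltrDl ltr01 => /(_ isT) Bb B0 bd0 hC.
have {}Bb x : B x -> forall i, `|(x : 'rV[R]_d) 0 i| <= b0 + 1.
  by move=> Bx i; apply: le_trans (coord_le_norm _ _) _; exact: (Bb x Bx).
have mopen (U : set 'rV[R]_d) : open U -> measurable (U : set (rVborel R d)).
  by move=> oU; apply: sub_sigma_algebra.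
have mbd : measurable (boundary (B : set 'rV[R]_d) : set (rVborel R d)).
  apply: measurableD; last by apply: mopen; exact: open_interior.
  by rewrite -[X in measurable X]setCK; apply: measurableC; apply: mopen; apply: closed_openC; exact: closed_closure.
(* Without interior points, B would lie in its null boundary. *)
have iB : exists x, interior (B : set 'rV[R]_d) x.
  apply: contrapT => no; have : (lam B <= 0)%E.
    rewrite -bd0; apply: le_measure; rewrite ?inE// => x Bx; split; first exact: subset_closure.
    by move=> ix; apply: no; exists x.
  by rewrite leNgt B0.
have finB : (lam B < +oo)%E.
  apply: le_lt_trans (lebesgue_rV_cube_lty (b0 + 1)); apply: le_measure; rewrite ?inE//.
  exact: measurable_cube.
have finBn : lam B \is a fin_num by rewrite ge0_fin_numE.
have [x0 [X [Bx0 BX uT hX]]] := exists_large_simplex Bb iB.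
exists x0, (simplex_mx x0 X); split=> // nu nuE; set T := simplex_mx x0 X in uT hX nuE *.
set u := affine_coord x0 T in nuE *; set w := affine_point x0 T => B'.
have uw v : u (w v) = v by exact: affine_pointK.
have wu x : w (u x) = x by exact: affine_coordK.
have mB' : measurable (B' : set (rVborel R d)).
  by rewrite -[X in measurable X]setTI; exact: measurable_affine_point.
have nuw (S : set (rVborel R d)) : nu (w @^-1` S) = lam S.
  by rewrite nuE /pushforward; congr (lam _); apply/seteqP; split=> x /=; rewrite wu.
have mcell : measurable (affine_cell x0 T d.+1%:R^-1 0).
  exact: measurable_affine_cell.
have lB : lam B = (fine (lam B))%:E by rewrite fineK.
have fB0 : 0 < fine (lam B) by rewrite -lte_fin -lB.
have cellB : (lam (affine_cell x0 T d.+1%:R^-1 0) <= C%:E * lam B)%E.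
  apply: le_trans (le_completed_lebesgue_rV mcell (conv_hull_cell Bx0 BX uT)) _.
  by move: hC; rewrite {1}lB inver gt_eqF// lee_pdivrMr// -lB.
pose I := {ffun 'I_d -> 'I_(6 * d.+1).+1}.
have cube3 : (nu (cube 3) <= (#|{: I}|%:R * C)%:E * lam B)%E.
  rewrite nuE; apply: le_trans (lebesgue_affine_cube x0 uT) _.
  by rewrite EFinM -muleA lee_wpmul2l// lee_fin.
split; last first.
  apply/eqP; rewrite eq_le measure_ge0 andbT -bd0 -nuw.
  have ww : continuous w by exact: continuous_affine_point.
  apply: le_measure; rewrite ?inE.
  - apply: measurableD => //; apply: mopen; exact: open_interior.
  - by rewrite -[X in measurable X]setTI; exact: measurable_affine_point.
  move=> v [B'v iv]; split; first exact: subset_closure.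
  by move=> iw; apply: iv; exact: (ww v B iw).
split.
- move=> S v mS; rewrite nuE /pushforward.
  rewrite -(lebesgue_rV_translate (v *m T) (A := u @^-1` S)); last first.
    by rewrite -[X in measurable X]setTI; exact: measurable_affine_coord.
  by congr (lam _); apply/seteqP; split=> x /=; rewrite /u affine_coordD.
- move=> v; rewrite -(lebesgue_rV_set1 (w v) d0) -nuw; congr (nu _).
  by apply/seteqP; split=> [_ -> //|x /= h]; rewrite -(uw x) h uw.
- by apply: le_lt_trans cube3 _; rewrite lB -EFinM ltry.
- exact: mB'.
- by rewrite /B' nuw.
- by move=> v B'v i; rewrite -(uw v); exact: hX.
- have k0 : 0 < #|{: I}|%:R * C by rewrite -invr_gt0; exact: cell_ratio_gt0.
  by rewrite /B' nuw /cell_ratio lee_pdivrMl.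
Qed.

End normalization.

Unset Implicit Arguments.
Set Strict Implicit.

Theorem propositionC10 (R : realType) (d : nat) (C : R) (p : nat)
    (hd : (0 < d)%N) (hC : 0 < C) :
  exists N : nat, (0 < N)%N /\
    forall n : nat, (N <= n)%N ->
    forall B : set (rVborel R d),
      measurable B ->
      bounded_set (B : set 'rV[R]_d) ->
      (0 < lebesgue_rV R d B)%E ->
      (lebesgue_rV R d (boundary (B : set 'rV[R]_d)) = 0)%E ->
      (completed_lebesgue_rV R d (conv_hull (B : set 'rV[R]_d))
         / lebesgue_rV R d B <= C%:E)%E ->
      exists x : 'I_n -> 'rV[R]_d,
        [/\ averaging_set p B x, (forall k, B (x k)) & injective x].
Proof.
(* Exponents go up to p + 1, so that the bound is positive, as [core_averaging] requires, also for p
   = 0. *)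
have [N NP] := @core_averaging R d p.+1 (cell_ratio d C) hd isT (cell_ratio_gt0 d hC).
exists N.+1; split=> // n Nn B mB bB B0 bd0 hull.
have n0 : n%:R != 0 :> R by rewrite pnatr_eq0 -lt0n; exact: leq_ltn_trans Nn.
have [x0 [T [uT aff]]] := normalized_affine_image hd hC mB bB B0 bd0 hull.
have [nu nuE] := affine_pushforward_ex x0 uT.
have [nz nzI] := aff nu nuE.
set u := affine_coord x0 T in nuE; set w := affine_point x0 T in nz nzI.
set B' := w @^-1` B in nz nzI.
have wu (x : 'rV[R]_d) : w (u x) = x by exact: affine_coordK.
have uB' : u @^-1` B' = B by apply/seteqP; split=> x; rewrite /B' /= wu.
have nuB' : nu B' = lebesgue_rV R d B by rewrite nuE /pushforward uB'.
have mu_ : measurable_fun [set: rVborel R d] (u : rVborel R d -> rVborel R d).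
  exact: measurable_affine_coord.
have finB : (lebesgue_rV R d B < +oo)%E by rewrite -nuB'; exact: nz_finB nz.
have imon (al : {ffun 'I_d -> 'I_p.+2}) : (lebesgue_rV R d).-integrable B (EFin \o (fun x : rVborel R d => mon al (u x))).
  apply: measurable_bounded_integrable => //.
    apply: measurable_funTS.
    exact: (measurableT_comp (measurable_mon al) mu_).
  exists (2 ^+ (p.+2 * d)); split; first by rewrite num_real.
  move=> y hy x Bx /=; apply: ltW; apply: le_lt_trans hy.
  apply: mon_le; first by rewrite ler1n.
  by apply: (nz_sub nz); rewrite /B' /= wu.
have momE (al : {ffun 'I_d -> 'I_p.+2}) :
    moment nu B' al = (fine (lebesgue_rV R d B))^-1 * \int[lebesgue_rV R d]_(x in B) mon al (u x).
  rewrite /moment nuB'; congr (_ * _); rewrite /Rintegral; congr (fine _).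
  rewrite (_ : integral nu = integral (pushforward (lebesgue_rV R d) (u : rVborel R d -> rVborel R d))); last by congr integral.
  rewrite -uB' (integral_pushforward mu_)//.
  - by apply/measurable_EFinP; exact: measurable_mon.
  - by rewrite uB'; exact: imon.
  - exact: nz_meas nz.
have [x [xE xB xinj]] := NP n (ltnW Nn) nu B' nz nzI.
exists (fun k => w (x k)); split=> //; last first.
  by move=> j k /(can_inj (affine_pointK x0 uT)); exact: xinj.
move=> q qp; apply/ffunP => i.
(* A tensor coordinate of an affine image is a product of q affine forms, hence a fixed combination
   of monomials, for which the averages are already known. *)
pose r := [seq i k | k <- index_enum 'I_q].
have [|s [_ sE]] := @affine_prod_mon R d p.+1 x0 T r.
  by rewrite size_map -[index_enum _]enumT size_enum_ord; exact: leq_trans qp _.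
have {}sE v : tensor_pow q (w v) i = \sum_(z <- s) z.1 * mon z.2 v.
  by rewrite -sE ffunE big_map.
rewrite !ffunE sum_ffunE.
have -> : \sum_(k < n) tensor_pow q (w (x k)) i = \sum_(z <- s) z.1 * (n%:R * moment nu B' z.2).
  rewrite (eq_bigr (fun k => \sum_(z <- s) z.1 * mon z.2 (x k))); last by move=> k _; exact: sE.
  by rewrite exchange_big/=; apply: eq_bigr => z _; rewrite -mulr_sumr xE.
rewrite (_ : (fun _ => _) = (fun y : rVborel R d => \sum_(z <- s) z.1 * mon z.2 (u y))); last first.
  by apply/funext => y; rewrite -sE wu.
have [|_ ->] := @Rintegral_sum _ _ R (lebesgue_rV R d) B _ s
  (fun z y => z.1 * mon z.2 (u y)) mB.
  move=> z; rewrite (_ : EFin \o _ = (fun y => z.1%:E * (EFin \o (fun y => mon z.2 (u y))) y)%E)//.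
  exact: integrableZl.
rewrite /GRing.scale /= !mulr_sumr; apply: eq_bigr => z _.
by rewrite RintegralZl// momE mulrCA [RHS]mulrCA [n%:R^-1 * _]mulrA mulVf// mul1r.
Qed.
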